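(* Let $p=(p_t)_{t\ge 0}$ follow the jump-diffusion process $$p_t = p_0+\int_0^t \mu_u\,\mathrm{d}u+\int_0^t\sigma_u\,\mathrm{d}W_u+\sum_{i=1}^{N_t}J_i ,\qquad t\ge 0,$$ where $\mu$ is a locally bounded and predictable drift, $\sigma$ is a càdlàg volatility process, $W$ is a standard Brownian motion, $N=(N_t)_{t\ge0}$ is a finite activity simple counting process and the $J_i$ are non-zero random variables. Let $m\in\mathbb{N}$ be fixed and set $$RRV_b^{n,m}=\frac{1}{\lambda_{2,m}}\sum_{i=1}^n s_{p_{i\Delta,\Delta},m}^2,\qquad RTV^{n,m}=\frac{n}{n-2}\sum_{i=1}^{n-2}\prod_{j=1}^3\frac{s_{p_{(i+j-1)\Delta,\Delta},m}^{2/3}}{\lambda_{2/3,m}},$$ $$RRV^{n,m}=\lambda_{2,m}\,RRV_b^{n,m}+(1-\lambda_{2,m})\,RTV^{n,m}.$$ Then, as $n\to\infty$, $$RRV^{n,m}\ \overset{p}{\to}\ \int_0^1\sigma_u^2\,\mathrm{d}u+\sum_{i=1}^{N_1}J_i^2 ,$$ where $\overset{p}{\to}$ denotes convergence in probability.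
   Context: All processes are defined on a filtered probability space $(\Omega,\mathcal{F},(\mathcal{F}_t)_{t\ge0},\mathbb{P})$; $p$ and $\sigma$ are adapted and $W$ is an $(\mathcal{F}_t)$-Brownian motion. The counting process $N_t$ (number of jumps of $p$ up to and including time $t$) is of finite activity: $N_t<\infty$ for all $t\ge 0$ almost surely; ''simple'' means that it has jumps of size one; $J_i$ is the size of the $i$-th jump of $p$. The unit interval $[0,1]$ is considered. For $n,m\in\mathbb{N}$, $p$ is observed at the times $i/(nm)$, $i=0,1,\dots,nm$; write $\Delta=1/n$. The integer $m$ is kept fixed while $n\to\infty$ (with $n\ge3$). For $i=1,\dots,n$ the discretely observed range of $p$ over $[(i-1)/n,i/n]$ is $$s_{p_{i\Delta,\Delta},m}=\max_{s,t\in\{0,1,\dots,m\}}\Bigl(p_{\frac{i-1}{n}+\frac{t}{nm}}-p_{\frac{i-1}{n}+\frac{s}{nm}}\Bigr)\ge 0.$$ For $r\geq 0$, $\lambda_{r,m}=\mathbb{E}\bigl(s_{W,m}^r\bigr)$ with $s_{W,m}=\max_{s,t\in\{0,1,\dots,m\}}\{W_{t/m}-W_{s/m}\}$, $W$ a standard Brownian motion. *)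

(* Defs.v *)
From HB Require Import structures.
From mathcomp Require Import all_boot all_order all_algebra.
From mathcomp Require Import all_classical all_reals all_analysis.

Set Implicit Arguments.
Unset Strict Implicit.
Unset Printing Implicit Defensive.

Import Order.TTheory GRing.Theory Num.Theory.
Import numFieldNormedType.Exports.

Local Open Scope classical_set_scope.
Local Open Scope ring_scope.

(* Processes are maps X : R -> T -> R (time, then outcome); only the times
   t >= 0 matter. *)

Section stochastic_basis.
Context d (T : measurableType d) (R : realType).
Implicit Types (P : probability T R) (F : R -> set (set T)) (X W : R -> T -> R).

(* No completeness or right-continuity is required of the filtration. *)
Definition filtration F :=
  [/\ forall t : R, 0 <= t -> sigma_algebra [set: T] (F t),
      forall t : R, 0 <= t -> F t `<=` d.-measurable
    & forall s t : R, 0 <= s -> s <= t -> F s `<=` F t].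

Definition measurable_wrt (G : set (set T)) (Y : T -> R) :=
  forall B : set R, measurable B -> G (Y @^-1` B).

Definition adapted F X := forall t : R, 0 <= t -> measurable_wrt (F t) (X t).

Definition stopping_time F (tau : T -> \bar R) :=
  (forall w, (0 <= tau w)%E) /\
  forall t : R, 0 <= t -> F t [set w | (tau w <= t%:E)%E].

(* Generators of the predictable sigma-algebra on [0, +oo[ x T. *)
Definition predictable_rectangles F : set (set (R * T)) :=
  [set D | (exists A, F 0 A /\ D = [set 0] `*` A) \/
           (exists (s t : R) A, [/\ 0 <= s, s < t, F s A & D = `]s, t] `*` A])].

Definition predictable F X :=
  let D := `[0, +oo[ `*` [set: T] in
  forall B : set R, measurable B ->
    <<s D, predictable_rectangles F >> (D `&` [set z | B (X z.1 z.2)]).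

(* There are stopping times tau_k increasing to +oo such that each stopped
   process X^(tau_k) 1_{tau_k > 0} is bounded. *)
Definition locally_bounded P F X :=
  exists tau : nat -> T -> \bar R,
    [/\ forall k, stopping_time F (tau k),
        {ae P, forall w, {homo tau ^~ w : k l / (k <= l)%N >-> (k <= l)%E} /\
                         tau k w @[k --> \oo] --> +oo%E}
      & forall k, exists C : R, {ae P, forall w, (0 < tau k w)%E ->
          forall t : R, 0 <= t -> (t%:E <= tau k w)%E -> `|X t w| <= C}].

Definition cadlag (x : R -> R) :=
  (forall t : R, 0 <= t -> x s @[s --> t^'+] --> x t) /\
  (forall t : R, 0 < t -> cvg (x s @[s --> t^'-])).

Definition increment W s t (w : T) : R := W t w - W s w.

Definition brownian_motion P F W :=
  [/\ adapted F W,
      {ae P, forall w, W 0 w = 0},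
      {ae P, forall w, {within `[0, +oo[, continuous (W ^~ w)}},
      forall (s t : R) A (B : set R),
        0 <= s -> s < t -> F s A -> measurable B ->
        P (A `&` increment W s t @^-1` B) = (P A * P (increment W s t @^-1` B))%E
    & forall (s t : R) (B : set R), 0 <= s -> s < t -> measurable B ->
        P (increment W s t @^-1` B) = normal_prob 0 (Num.sqrt (t - s)) B].

(* Path of a counting process all of whose jumps have size one.  Finite
   activity is built in: the values are natural numbers. *)
Definition simple_counting_path (x : R -> nat) :=
  [/\ x 0 = 0%N,
      forall s t : R, 0 <= s -> s <= t -> (x s <= x t)%N,
      forall t : R, 0 <= t -> \forall s \near t^'+, x s = x t
    & forall t : R, 0 < t -> \forall s \near t^'-, (x t <= (x s).+1)%N].

(* Convergence in probability to 0 of nonnegative quantities.  mu_ext P is the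
   outer probability; it agrees with P on measurable sets, and is used because
   the events below are only measurable up to P-negligible sets when the
   regularity of paths holds almost surely. *)
Definition cvg0_in_probability P (Z : nat -> T -> \bar R) :=
  forall e : R, 0 < e ->
    mu_ext P [set w | (e%:E < Z n w)%E] @[n --> \oo] --> 0%E.

Definition cvg_in_probability P (Y : nat -> T -> R) (L : T -> R) :=
  cvg0_in_probability P (fun n w => `|Y n w - L w|%:E).

(* Simple integrands sum_(j < k) xi_j 1_]t_j, t_(j+1)], and their integrals. *)
Record simple_process := SimpleProcess {
  sp_size : nat ;
  sp_time : nat -> R ;
  sp_coef : nat -> T -> R }.

Definition sp_predictable F (S : simple_process) :=
  0 <= sp_time S 0 /\
  forall j, (j < sp_size S)%N ->
    [/\ sp_time S j <= sp_time S j.+1,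
        measurable_wrt (F (sp_time S j)) (sp_coef S j)
      & exists C, forall w, `|sp_coef S j w| <= C].

Definition sp_val (S : simple_process) (t : R) (w : T) : R :=
  \sum_(j < sp_size S)
    sp_coef S j w * \1_(`]sp_time S j, sp_time S j.+1]) t.

Definition sp_integral (S : simple_process) W (t : R) (w : T) : R :=
  \sum_(j < sp_size S) sp_coef S j w *
    (W (Num.min t (sp_time S j.+1)) w - W (Num.min t (sp_time S j)) w).

(* I is the Ito integral of H against W: the continuous process that is the
   limit, uniformly on compacts in probability, of the integrals of simple
   integrands approximating H in L^2(0, t) in probability, for every t.  By the
   Ito isometry I is determined up to indistinguishability and does not depend
   on the approximating sequence. *)
Definition ito_integral P F W (H I : R -> T -> R) :=
  {ae P, forall w, {within `[0, +oo[, continuous (I ^~ w)}} /\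
  exists S : nat -> simple_process,
    (forall k, sp_predictable F (S k)) /\
    forall t : R, 0 < t ->
      cvg0_in_probability P (fun k w =>
        \int[lebesgue_measure]_(u in `[0%R, t])
          ((sp_val (S k) u w - H u w) ^+ 2)%:E)%E /\
      cvg0_in_probability P (fun k w =>
        ereal_sup [set `|sp_integral (S k) W u w - I u w|%:E | u in `[0, t]]).

End stochastic_basis.

Section realized_range.
Context d (T : measurableType d) (R : realType).
Implicit Types (P : probability T R) (p W : R -> T -> R).

(* Maximum of y t - y s over s, t in {0, ..., m}; the neutral element 0 is
   harmless since it is the value at s = t. *)
Definition grid_range m (y : nat -> R) : R :=
  \big[Num.max/0]_(s < m.+1) \big[Num.max/0]_(t < m.+1) (y t - y s).

Definition observed_range p n m i (w : T) : R :=
  grid_range m (fun t => p ((i%:R - 1) / n%:R + t%:R / (n * m)%:R) w).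

(* W is meant to be a standard Brownian motion, in which case the value depends
   only on r and m. *)
Definition lambda P W (r : R) m : R :=
  fine 'E_P[fun w => grid_range m (fun t => W (t%:R / m%:R) w) `^ r].

Definition RRVb P W p n m (w : T) : R :=
  (lambda P W 2 m)^-1 * \sum_(1 <= i < n.+1) observed_range p n m i w ^+ 2.

(* Meaningful for n >= 3. *)
Definition RTV P W p n m (w : T) : R :=
  n%:R / (n%:R - 2) * \sum_(1 <= i < (n - 2).+1) \prod_(1 <= j < 4)
    (observed_range p n m (i + j - 1)%N w `^ (2 / 3) / lambda P W (2 / 3) m).

Definition RRV P W p n m (w : T) : R :=
  lambda P W 2 m * RRVb P W p n m w + (1 - lambda P W 2 m) * RTV P W p n m w.

End realized_range.

(* Main.v *)
(** Let [c] be [p] without its initial value and its jumps: the drift plus the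
    Ito integral.  Path by path, when [n] is large every three consecutive
    windows contain at most one jump.  A jump [J] in a window replaces the range
    of [c] by [`|J|] up to an error bounded by the range of [c]; hence passing
    from [c] to [p] adds [\sum_i J_i ^+ 2] to the sum of squared ranges in the
    limit, and nothing to the tripower sum, where a jump is multiplied by two
    small ranges.

    For [c], the volatility is approximated by simple integrands, which are then
    frozen at the beginning of a window (for the tripower, of the first window
    of a triple).  Lenglart's inequality bounds the sum over all cells of the
    squared errors made on the increments of [c], and the range is Lipschitz in
    these increments.  The drift contributes nothing since its increments are of
    the order of the mesh.  There remain averages of [v_i ^+ 2], known at the
    beginning of window [i], times functions of the rescaled Brownian ranges over
    at most three windows; after centring, terms three windows apart are
    orthogonal, so that these averages have variance of order [n^-1].

    The approximation of the volatility is indexed by [k]; the limit in [n] is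
    taken before the one in [k].  The squared ranges contribute [lambda_(2,m)]
    times the integrated variance plus the squared jumps, the tripower part
    [1 - lambda_(2,m)] times the integrated variance. *)
From HB Require Import structures.
Require Import Defs.
From mathcomp Require Import all_boot all_order all_algebra.
From mathcomp Require Import all_classical all_reals all_analysis.
From mathcomp Require Import measurable_realfun ring lra zify.

Set Implicit Arguments.
Unset Strict Implicit.
Unset Printing Implicit Defensive.

Import Order.TTheory GRing.Theory Num.Theory.
Import numFieldNormedType.Exports.

Local Open Scope classical_set_scope.
Local Open Scope ring_scope.

(** * Integrable and square-integrable random variables *)

(** Nothing is assumed about moments of the volatility, so no expectation of the Ito integral can be
    used. Its errors are controlled in probability only, and whatever is proportional to the
    integrated variance is absorbed by tightness, with an arbitrarily small factor. Since [m] is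
    fixed, a window range depends on [m] cell increments; Cauchy-Schwarz over the cells replaces any
    maximal inequality. The simple integrands that approximate the volatility are those provided by
    [ito_integral] at time 1; they are bounded, each by its own constant, which is why [n] must go
    to infinity before [k]. No relation between jumps and [W] is assumed, so jumps are treated path
    by path. Returning from almost sure convergence to convergence in probability requires genuine
    measurability, whereas everything else works with outer probability and tolerates null sets. The
    exponent 2/3 is handled through its cube: with A = x^(2/3) one has A^3 = x^2, so that
    inequalities on tripower terms become polynomial, and a weighted AM-GM compares a triple product
    with squares. *)

Lemma measurable_EFin_fun d (T : measurableType d) (R : realType) (f : T -> R) :
  measurable_fun [set: T] f -> measurable_fun [set: T] (fun x => (f x)%:E).
Proof. by move=> mf; exact/measurable_EFinP. Qed.

Lemma measurable_fun_abs d (T : measurableType d) (R : realType) (f : T -> R) :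
  measurable_fun [set: T] f -> measurable_fun [set: T] (fun x => `|f x|).
Proof. by move=> mf; exact: (measurableT_comp (@normr_measurable R setT)). Qed.

(** One induction serves integrability, square integrability and measurability with respect to a
    sub-sigma-algebra. *)
Lemma sum_closed (T I : Type) (R : realType) (K : (T -> R) -> Prop) (s : seq I) (Q : pred I)
    (h : I -> T -> R) :
  K (fun=> 0) -> (forall f g, K f -> K g -> K (fun w => f w + g w)) ->
  (forall i, Q i -> K (h i)) -> K (fun w => \sum_(i <- s | Q i) h i w).
Proof.
move=> K0 KD Kh; elim: s => [|a s ih].
  by under [X in K X]funext do rewrite big_nil.
have [Qa|/negPf nQa] := boolP (Q a).
  by under [X in K X]funext do rewrite big_cons Qa; apply: KD => //; exact: Kh.
by under [X in K X]funext do rewrite big_cons nQa.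
Qed.

Section expectation.
Context d (T : measurableType d) (R : realType) (P : probability T R).
Implicit Types f g : T -> R.

Definition L1 f := P.-integrable [set: T] (EFin \o f).
Definition Ex f : R := \int[P]_w f w.
Definition L2 f := measurable_fun [set: T] f /\ L1 (fun w => f w ^+ 2).

Lemma L1_meas f : L1 f -> measurable_fun [set: T] f.
Proof. by move=> /integrableP[/measurable_EFinP]. Qed.

Lemma L1_le f g : measurable_fun [set: T] f -> L1 g ->
  (forall w, `|f w| <= g w) -> L1 f.
Proof.
move=> mf ig fg; apply: (le_integrable _ _ _ ig) => //.
  exact/measurable_EFinP.
move=> w _ /=; rewrite lee_fin (le_trans (fg w))// ler_norm//.
Qed.

Lemma L1_cst (c : R) : L1 (fun=> c).
Proof. exact: finite_measure_integrable_cst. Qed.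

Lemma L1_bounded f (C : R) : measurable_fun [set: T] f ->
  (forall w, `|f w| <= C) -> L1 f.
Proof. by move=> mf fC; apply: L1_le (L1_cst C) fC. Qed.

Lemma L1D f g : L1 f -> L1 g -> L1 (fun w => f w + g w).
Proof. move=> hf hg; exact: (integrableD _ hf hg). Qed.

Lemma L1Z (c : R) f : L1 f -> L1 (fun w => c * f w).
Proof. move=> hf; exact: (integrableZl _ c hf). Qed.

Lemma L1N f : L1 f -> L1 (fun w => - f w).
Proof. move=> hf; exact: (integrableN hf). Qed.

Lemma L1B f g : L1 f -> L1 g -> L1 (fun w => f w - g w).
Proof. by move=> hf hg; exact: L1D hf (L1N hg). Qed.

Lemma L1_sum (I : Type) (s : seq I) (Q : pred I) (h : I -> T -> R) :
  (forall i, Q i -> L1 (h i)) -> L1 (fun w => \sum_(i <- s | Q i) h i w).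
Proof. by apply: (sum_closed (K := L1)) => [|f g]; [exact: L1_cst|exact: L1D]. Qed.

Lemma ExD f g : L1 f -> L1 g -> Ex (fun w => f w + g w) = Ex f + Ex g.
Proof. by move=> hf hg; rewrite /Ex RintegralD. Qed.

Lemma ExB f g : L1 f -> L1 g -> Ex (fun w => f w - g w) = Ex f - Ex g.
Proof. by move=> hf hg; rewrite /Ex RintegralB. Qed.

Lemma ExZ (c : R) f : L1 f -> Ex (fun w => c * f w) = c * Ex f.
Proof. by move=> hf; rewrite /Ex RintegralZl. Qed.

Lemma Ex_cst (c : R) : Ex (fun=> c) = c.
Proof. rewrite /Ex Rintegral_cst//.
transitivity (c * fine 1%E); last by rewrite mulr1.
congr (c * fine _); exact: probability_setT. Qed.

Lemma Ex_sum (I : Type) (s : seq I) (Q : pred I) (h : I -> T -> R) :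
  (forall i, Q i -> L1 (h i)) ->
  Ex (fun w => \sum_(i <- s | Q i) h i w) = \sum_(i <- s | Q i) Ex (h i).
Proof.
move=> H; elim: s => [|a s ih].
  by under [X in Ex X]funext do rewrite big_nil; rewrite Ex_cst big_nil.
have [Qa|/negPf nQa] := boolP (Q a).
  under [X in Ex X]funext do rewrite big_cons Qa.
  by rewrite big_cons Qa ExD ?ih//; [exact: H|exact: L1_sum].
by under [X in Ex X]funext do rewrite big_cons nQa; rewrite big_cons nQa.
Qed.

Lemma le_Ex f g : L1 f -> L1 g -> (forall w, f w <= g w) -> Ex f <= Ex g.
Proof. by move=> hf hg fg; apply: le_Rintegral. Qed.

Lemma Ex_ge0 f : (forall w, 0 <= f w) -> 0 <= Ex f.
Proof. by move=> f0; apply: Rintegral_ge0. Qed.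

Lemma ExE f : L1 f -> (Ex f)%:E = (\int[P]_w (f w)%:E)%E.
Proof. by move=> hf; rewrite fineK//; exact: integrable_fin_num hf. Qed.

Lemma L2M f g : L2 f -> L2 g -> L1 (fun w => f w * g w).
Proof.
move=> [mf f2] [mg g2]; apply: (@L1_le _ (fun w => f w ^+ 2 + g w ^+ 2)).
- exact: measurable_funM.
- exact: L1D.
- move=> w; rewrite normrM -(real_normK (num_real (f w))) -(real_normK (num_real (g w))).
  move: (`|f w|) (`|g w|) (normr_ge0 (f w)) (normr_ge0 (g w)) => x y x0 y0; nra.
Qed.

Lemma L2_bounded f (C : R) : measurable_fun [set: T] f ->
  (forall w, `|f w| <= C) -> L2 f.
Proof.
move=> mf fC; split => //; apply: (@L1_bounded _ (C ^+ 2)).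
  exact: measurable_funX.
move=> w; rewrite normrX; apply: lerXn2r (fC w); rewrite nnegrE//.
exact: le_trans (fC w).
Qed.

Lemma L2_cst (c : R) : L2 (fun=> c).
Proof. by apply: (@L2_bounded _ `|c|). Qed.

Lemma L2_L1 f : L2 f -> L1 f.
Proof.
move=> hf; have := L2M hf (L2_cst 1).
by under [X in L1 X -> _]funext do rewrite mulr1.
Qed.

Lemma L2D f g : L2 f -> L2 g -> L2 (fun w => f w + g w).
Proof.
move=> hf hg; have mf := hf.1; have mg := hg.1; split.
  exact: measurable_funD.
have -> : (fun w => (f w + g w) ^+ 2) =
    (fun w => (f w * f w + 2 * (f w * g w)) + g w * g w).
  by apply/funext => w; ring.
apply: L1D (L2M hg hg); apply: L1D (L2M hf hf) _; exact/L1Z/L2M.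
Qed.

Lemma L2Mb f g (C : R) : L2 f -> measurable_fun [set: T] g ->
  (forall w, `|g w| <= C) -> L2 (fun w => g w * f w).
Proof.
move=> [mf f2] mg gC; split; first exact: measurable_funM.
apply: (@L1_le _ (fun w => C ^+ 2 * f w ^+ 2)).
- by apply: measurable_funX; exact: measurable_funM.
- exact: L1Z.
- move=> w; rewrite exprMn normrM (ger0_norm (sqr_ge0 (f w))).
  apply: ler_wpM2r; first exact: sqr_ge0.
  rewrite normrX; apply: lerXn2r (gC w); rewrite nnegrE//.
  exact: le_trans (gC w).
Qed.

Lemma L2Z (c : R) f : L2 f -> L2 (fun w => c * f w).
Proof. by move=> hf; apply: (@L2Mb f (fun=> c) `|c|). Qed.

Lemma L2B f g : L2 f -> L2 g -> L2 (fun w => f w - g w).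
Proof.
move=> hf /(L2Z (-1)) hg; have := L2D hf hg.
by under [X in L2 X -> _]funext do rewrite mulN1r.
Qed.

Lemma L2_sum (I : Type) (s : seq I) (Q : pred I) (h : I -> T -> R) :
  (forall i, Q i -> L2 (h i)) -> L2 (fun w => \sum_(i <- s | Q i) h i w).
Proof. by apply: (sum_closed (K := L2)) => [|f g]; [exact: L2_cst|exact: L2D]. Qed.

Lemma Ex_sqrD f g : L2 f -> L2 g ->
  Ex (fun w => (f w + g w) ^+ 2) =
  Ex (fun w => f w ^+ 2) + 2 * Ex (fun w => f w * g w) + Ex (fun w => g w ^+ 2).
Proof.
move=> hf hg.
have -> : (fun w => (f w + g w) ^+ 2) =
    (fun w => (f w ^+ 2 + 2 * (f w * g w)) + g w ^+ 2).
  by apply/funext => w; ring.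
have fg := L2M hf hg.
rewrite ExD ?ExD ?ExZ//; [exact: hf.2|exact: L1Z| | exact: hg.2].
by apply: L1D; [exact: hf.2|exact: L1Z].
Qed.

Lemma Ex_orth_sum (U : nat -> T -> R) (n : nat) :
  (forall i, (i < n)%N -> L2 (U i)) ->
  (forall i j, (i < j < n)%N -> Ex (fun w => U i w * U j w) = 0) ->
  Ex (fun w => (\sum_(i < n) U i w) ^+ 2) = \sum_(i < n) Ex (fun w => U i w ^+ 2).
Proof.
elim: n => [|n ih] hU hO.
  rewrite big_ord0; under [X in Ex X]funext do rewrite big_ord0 expr0n/=.
  by rewrite Ex_cst.
rewrite big_ord_recr /= -ih; last 2 first.
  by move=> i Hi; apply: hU; lia.
  by move=> i j Hi; apply: hO; lia.
under [X in Ex X]funext do rewrite big_ord_recr/=.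
rewrite Ex_sqrD; last 2 first.
  by apply: L2_sum => i _; apply: hU; have := ltn_ord i; lia.
  by apply: hU.
rewrite (_ : Ex (fun w => _ * _) = 0) ?mulr0 ?addr0//.
under [X in Ex X]funext do rewrite mulr_suml.
rewrite Ex_sum; last first.
  by move=> i _; apply: L2M; apply: hU => //; have := ltn_ord i; lia.
by rewrite big1// => i _; apply: hO; rewrite ltn_ord/=.
Qed.

(** The last term can be correlated only with the two before it. By [2xy <= x^2 + y^2] each such
    product has expectation at most [K], so a new term adds at most K + 2 * (2 * K) = 5 * K. *)
Lemma Ex_3orth_sum (U : nat -> T -> R) (n : nat) (K : R) : 0 <= K ->
  (forall i, (i < n)%N -> L2 (U i) /\ Ex (fun w => U i w ^+ 2) <= K) ->
  (forall i j, (i + 2 < j)%N -> (j < n)%N -> Ex (fun w => U i w * U j w) = 0) ->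
  Ex (fun w => (\sum_(i < n) U i w) ^+ 2) <= 5 * K * n%:R.
Proof.
move=> K0; elim: n => [|n ih] hU hO.
  under [X in Ex X]funext do rewrite big_ord0 expr0n/=.
  by rewrite Ex_cst mulr0.
have {}ih : Ex (fun w => (\sum_(i < n) U i w) ^+ 2) <= 5 * K * n%:R.
  by apply: ih => [i Hi|i j Hi Hj]; [apply: hU; lia|apply: hO; lia].
under [X in Ex X]funext do rewrite big_ord_recr/=.
have [Un Unk] := hU n (ltnSn n).
rewrite Ex_sqrD//; last first.
  by apply: L2_sum => i _; apply: (hU _ _).1; have := ltn_ord i; lia.
have cross : Ex (fun w => (\sum_(i < n) U i w) * U n w) <= 2 * K.
  under [X in Ex X]funext do rewrite mulr_suml.
  have hL i : (i < n)%N -> L1 (fun w => U i w * U n w).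
    by move=> Hi; apply: L2M => //; apply: (hU _ _).1; lia.
  rewrite Ex_sum; last by move=> i _; exact: hL.
  have b i : (i < n)%N -> Ex (fun w => U i w * U n w) <= K.
    move=> Hi; have [Ui Uik] := hU i (ltnW Hi).
    have : Ex (fun w => 2 * (U i w * U n w)) <= Ex (fun w => U i w ^+ 2 + U n w ^+ 2).
      apply: le_Ex => [| |w]; [exact/L1Z/L2M|by apply: L1D; [exact: Ui.2|exact: Un.2]|].
      by have := sqr_ge0 (U i w - U n w); nra.
    rewrite ExZ ?ExD//; [lra|exact: Ui.2|exact: Un.2|exact: hL].
  clear ih; case: n hU hO Un Unk hL b => [|[|n]] hU hO Un Unk hL b.
  - by rewrite big_ord0; lra.
  - by rewrite big_ord_recr big_ord0/= add0r (le_trans (b _ _)) //; lra.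
  - rewrite !big_ord_recr/= big1 ?add0r; last first.
      by move=> i _; apply: hO => //=; have := ltn_ord i; lia.
    have := b n; have := b n.+1 (ltnSn _); move=> ? /(_ (leqnSn _)); lra.
rewrite -natr1; lra.
Qed.

Lemma Ex_markov f (e : R) : 0 < e -> L1 f -> (forall w, 0 <= f w) ->
  (P [set w | (e < f w)%R] <= (Ex f / e)%:E)%E.
Proof.
move=> e0 hf f0; have mf := L1_meas hf.
have m1 : measurable [set w | e < f w].
  rewrite -[X in measurable X]setTI; apply: measurable_fun_ltr => //.
have m2 : measurable [set w | e <= f w].
  rewrite -[X in measurable X]setTI; apply: measurable_fun_ler => //.
apply: (@le_trans _ _ (P [set w | e <= f w])).
  by apply: le_measure; rewrite ?inE// => w /= /ltW.
have := @le_integral_abse _ _ _ P setT measurableT (EFin \o f) e _ e0.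
move=> /(_ (proj2 (measurable_EFinP _ _) mf)).
rewrite setTI.
have -> : [set x | (e%:E <= `|(EFin \o f) x|)%E] = [set w | e <= f w].
  by apply/seteqP; split => w /=; rewrite lee_fin ger0_norm.
under [X in (_ <= X)%E]eq_integral do rewrite /= ger0_norm//.
rewrite -ExE//.
rewrite -lee_pdivlMl// => /le_trans; apply.
by rewrite -EFinM lee_fin mulrC.
Qed.

End expectation.

(** * Expectations of products of independent factors *)

Section independence.
Context d d' (T : measurableType d) (T' : measurableType d') (R : realType).
Variables (P : probability T R) (nu : probability T' R).

(** When [G] contains the whole space, taking it for [A] shows that [nu] is the law of [Z]; one
    identity thus carries both the law and the independence from [G]. *)
Definition indep_law (G : set (set T)) (Z : T -> T') :=
  forall A B, G A -> measurable B -> P (A `&` Z @^-1` B) = (P A * nu B)%E.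

(** The law of the pair [(X, Z)] and the product of the law of [X] with [nu] agree on rectangles,
    hence everywhere; Fubini then splits the expectation. This replaces conditional expectations
    throughout. *)
Lemma indep_lawM (G : set (set T)) (Z : T -> T') (X : T -> R) (f : T' -> R) :
  G `<=` measurable -> indep_law G Z -> measurable_fun [set: T] Z ->
  measurable_wrt G X -> L1 P X -> L1 nu f ->
  L1 P (fun w => X w * f (Z w)) /\
  Ex P (fun w => X w * f (Z w)) = Ex P X * Ex nu f.
Proof.
move=> GM GZ mZ GX iX inuf.
have mf := L1_meas inuf; have mX := L1_meas iX.
pose Xm : {RV P >-> R} := HB.pack X (isMeasurableFun.Build _ _ _ _ X mX).
pose XZ : T -> R * T' := fun w => (X w, Z w).
have mXZ : measurable_fun [set: T] XZ by exact: measurable_fun_pair.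
pose XZm : {RV P >-> (R * T')%type} :=
  HB.pack XZ (isMeasurableFun.Build _ _ _ _ XZ mXZ).
have E : forall D, measurable D ->
    (distribution P Xm \x nu)%E D = distribution P XZm D.
  apply: product_measure_unique => A B mA mB.
  by rewrite /distribution /pushforward /= -GZ//; exact: GX.
pose h : R * T' -> \bar R := fun z => (z.1 * f z.2)%:E.
have mh : measurable_fun [set: _] h.
  apply/measurable_EFinP/measurable_funM => //; exact: measurableT_comp.
have iabsX : (\int[distribution P Xm]_x `|x|%:E < +oo)%E.
  rewrite ge0_integral_distribution//.
    by have /integrableP[_] := iX.
  by apply: measurable_EFin_fun; exact: normr_measurable.
have ih : (distribution P Xm \x nu)%E.-integrable [set: _] h.
  apply/integrable12ltyP => //.
  under eq_integral => x _.
    under eq_integral => y _ do rewrite /h /= normrM EFinM.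
    rewrite ge0_integralZl//; last by apply: measurable_EFin_fun; exact: measurable_fun_abs.
    over.
  have f1 : (\int[nu]_y `|f y|%:E)%E \is a fin_num.
    rewrite ge0_fin_numE; last by apply: integral_ge0.
    by have /integrableP[_] := inuf.
  rewrite ge0_integralZr//.
  - rewrite -(fineK f1) lte_mul_pinfty ?ltry//.
      by apply: integral_ge0.
    by rewrite ge0_fin_numE//; exact: integral_ge0.
  - by apply: measurable_EFin_fun; exact: normr_measurable.
  - exact: integral_ge0.
have ih' : (distribution P XZm).-integrable [set: _] h.
  have /integrableP[_ hlt] := ih.
  apply/integrableP; split => //; rewrite (@eq_measure_integral _ _ _ _ (distribution P Xm \x nu)%E)//.
  by move=> A mA _; exact: esym (E A mA).
have i1 : L1 P (fun w => X w * f (Z w)).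
  have /integrableP[_ hlt] := ih'.
  apply/integrableP; split; first by apply: (measurableT_comp mh mXZ).
  move: hlt; rewrite ge0_integral_distribution//.
  exact: measurableT_comp.
split => //.
apply: EFin_inj; rewrite ExE// EFinM !ExE//.
rewrite -[LHS](@integral_distribution _ _ _ _ _ _ XZm h mh i1).
rewrite (@eq_measure_integral _ _ _ _ (distribution P Xm \x nu)%E); last first.
  by move=> A mA _; exact: esym (E A mA).
rewrite -integral12_prod_meas1//.
have -> : (\int[P]_w (X w)%:E = \int[distribution P Xm]_x x%:E)%E.
  by rewrite integral_distribution.
rewrite -(fineK (integrable_fin_num measurableT inuf)) -integralZr//; last first.
  apply/integrableP; split; first exact/measurable_EFinP.
  exact: iabsX.
apply: eq_integral => x _; rewrite /fubini_F /h /=.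
under eq_integral do rewrite EFinM.
by rewrite integralZl// (fineK (integrable_fin_num measurableT inuf)).
Qed.

End independence.

(** * Moments of the normal law *)

Import HBNNSimple.

Section normal_moments.
Context (R : realType).
Local Notation mu := (@lebesgue_measure R).

(** An inequality is enough to obtain finite moments; it follows by comparing the integrals of the
    simple functions below [f]. *)
Lemma ge0_integral_normal_prob_le (s : R) (f : R -> R) :
  measurable_fun [set: R] f -> (forall x, 0 <= f x) ->
  (\int[normal_prob 0 s]_x (f x)%:E <= \int[mu]_x (f x * normal_pdf 0 s x)%:E)%E.
Proof.
move=> mf f0; have mpdf := measurable_normal_pdf (0 : R) s.
rewrite ge0_integralTE//; apply: ge_ereal_sup => _ [h hf <-].
rewrite sintegralE.
have -> : (\sum_(x \in range h) x%:E * normal_prob 0 s (h @^-1` [set x]) =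
  \sum_(x \in range h) \int[mu]_y (x * \1_(h @^-1` [set x]) y * normal_pdf 0 s y)%:E)%E.
  apply: eq_fsbigr => r /set_mem [z _ <-].
  rewrite /normal_prob -ge0_integralZl//=; first last.
  - by rewrite lee_fin.
  - by move=> x _; rewrite lee_fin normal_pdf_ge0.
  - by apply: measurable_funTS; exact: measurable_EFin_fun.
  rewrite integral_mkcond; apply: eq_integral => x _.
  rewrite patchE indicE; case: ifPn => _; rewrite ?mulr1 -?EFinM//.
  by rewrite mulr0 mul0r.
rewrite -ge0_integral_fsum//=; first last.
- move=> r x _; rewrite lee_fin mulr_ge0 ?normal_pdf_ge0//.
  by have := nnfun_muleindic_ge0 h r x; rewrite lee_fin.
- move=> r; apply: measurable_EFin_fun; apply: measurable_funM => //.
  by apply: measurable_funM.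
apply: ge0_le_integral => //=.
- move=> x _; rewrite fsumEFin// -mulr_fsuml -fimfunE lee_fin mulr_ge0//.
  exact: normal_pdf_ge0.
- under eq_fun do rewrite fsumEFin//.
  apply: measurable_EFin_fun; under eq_fun do rewrite -mulr_fsuml -fimfunE.
  exact: measurable_funM.
- by apply: measurable_EFin_fun; exact: measurable_funM.
- move=> x _; rewrite fsumEFin// -mulr_fsuml -fimfunE lee_fin.
  by apply: ler_wpM2r; [exact: normal_pdf_ge0|rewrite -lee_fin hf].
Qed.

(** The scaled image measure agrees with Lebesgue measure on half-open intervals, and uniqueness of
    the latter concludes. *)
Lemma lebesgue_measureZ (c : R) (A : set R) : 0 < c -> measurable A ->
  (c%:E * mu (( *%R c : measurableTypeR R -> measurableTypeR R) @^-1` A) = mu A)%E.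
Proof.
move=> c0 mA; have mc : measurable_fun [set: measurableTypeR R]
  ( *%R c : measurableTypeR R -> measurableTypeR R) by exact: mulrl_measurable.
pose c' : {nonneg R} := NngNum (ltW c0).
have mc0 : forall A : set R, measurable A ->
    mu A = mscale c' (pushforward mu
      ( *%R c : measurableTypeR R -> measurableTypeR R)) A.
  move=> m; apply: lebesgue_measure_unique => _ [[a b]] _ <-.
  pose I : set R := `]a / c, b / c]%classic.
  transitivity (c%:E * mu I)%E; last first.
    congr (_ * mu _)%E.
    apply/seteqP; split => x; rewrite /I /= !in_itv/= ltr_pdivrMr// ler_pdivlMr//;
      by rewrite ![x * c]mulrC.
  rewrite !lebesgue_measure_itv/= !lte_fin ltr_pM2r ?invr_gt0//.
  case: ifPn => _; rewrite ?mule0// -!EFinB -EFinM -mulrBl mulrCA divff ?mulr1//.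
  by rewrite gt_eqF.
by rewrite (mc0 mc A mA).
Qed.

Lemma normal_pdfZ (c s x : R) : 0 < c -> 0 < s ->
  normal_pdf 0 (c * s) (c * x) = c^-1 * normal_pdf 0 s x.
Proof.
move=> c0 s0; rewrite !normal_pdfE ?gt_eqF ?mulr_gt0//.
rewrite /normal_peak /normal_fun !subr0.
have -> : - (c * x) ^+ 2 / ((c * s) ^+ 2 *+ 2) = - x ^+ 2 / (s ^+ 2 *+ 2).
  by field; rewrite !gt_eqF.
rewrite -!mulrnAr exprMn -mulrA sqrtrM ?sqr_ge0// sqrtr_sqr gtr0_norm// invfM.
by rewrite mulrA.
Qed.

Lemma normal_probZ (c s : R) (B : set R) : 0 < c -> 0 < s -> measurable B ->
  normal_prob 0 (c * s) B = normal_prob 0 s ( *%R c @^-1` B).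
Proof.
move=> c0 s0 mB.
have mc : measurable_fun [set: measurableTypeR R]
  ( *%R c : measurableTypeR R -> measurableTypeR R) by exact: mulrl_measurable.
pose c' : {nonneg R} := NngNum (ltW c0).
have mpdf r : measurable_fun [set: measurableTypeR R] (fun x => (normal_pdf 0 r x)%:E).
  by apply: measurable_EFin_fun; exact: measurable_normal_pdf.
rewrite /normal_prob (@eq_measure_integral _ _ _ _ (mscale c' (pushforward mu
      ( *%R c : measurableTypeR R -> measurableTypeR R)))); last first.
  by move=> A mA _; exact: esym (lebesgue_measureZ c0 mA).
rewrite ge0_integral_mscale//; last 2 first.
- exact: measurable_funTS (mpdf _).
- by move=> x _; rewrite lee_fin normal_pdf_ge0.
rewrite ge0_integral_pushforward//; last 2 first.
- exact: measurable_funTS (mpdf _).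
- by move=> x _; rewrite lee_fin normal_pdf_ge0.
rewrite -ge0_integralZl//; last 3 first.
- by rewrite -[X in measurable X]setTI; exact: mc.
- exact: measurable_funTS (measurableT_comp (mpdf _) mc).
- by move=> x _; rewrite lee_fin normal_pdf_ge0.
apply: eq_integral => x _ /=.
by rewrite normal_pdfZ// -EFinM mulrA divff ?mul1r// gt_eqF.
Qed.

Lemma normal_probN (s : R) (B : set R) : 0 < s -> measurable B ->
  normal_prob 0 s B = normal_prob 0 s ( -%R @^-1` B).
Proof.
move=> s0 mB.
have mc : measurable_fun [set: measurableTypeR R]
  ( -%R : measurableTypeR R -> measurableTypeR R) by exact: oppr_measurable.
have mpdf r : measurable_fun [set: measurableTypeR R] (fun x => (normal_pdf 0 r x)%:E).
  by apply: measurable_EFin_fun; exact: measurable_normal_pdf.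
rewrite /normal_prob (@eq_measure_integral _ _ _ _ (pushforward mu
      ( -%R : measurableTypeR R -> measurableTypeR R))); last first.
  by move=> //= A mA _; apply/esym; exact: lebesgue_measureN.
rewrite (ge0_integral_pushforward mc); last 3 first.
- exact: mB.
- exact: measurable_funTS (mpdf _).
- by move=> x _; rewrite lee_fin normal_pdf_ge0.
apply: eq_integral => x _ /=.
rewrite !normal_pdfE ?gt_eqF// /normal_fun !subr0.
by rewrite sqrrN.
Qed.

(** Half of the Gaussian exponent absorbs the fourth power and the other half is the density of
    variance 2. With y = x^2 / 4 one has x^4 = 16 y^2, and y^2 e^(-y) <= 2 because e^y >= 1 + y^2 /
    2. The ratio of the normalising constants is 1 / sqrt 2 >= 1 / 2, whence 64 = 16 * 2 * 2. *)
Lemma normal_pdf_exp4_le (x : R) :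
  (x ^+ 2) ^+ 2 * normal_pdf 0 1 x <= 64 * normal_pdf 0 (Num.sqrt 2) x.
Proof.
have h2 : Num.sqrt 2 ^+ 2 = 2 :> R by rewrite sqr_sqrtr.
have s2 : 0 < Num.sqrt 2 :> R by rewrite sqrtr_gt0.
have s21 : Num.sqrt 2 <= 2 :> R.
  by rewrite -(ler_pXn2r (n:=2)) ?nnegrE ?ltW// h2; lra.
rewrite !normal_pdfE ?gt_eqF// /normal_fun /normal_peak !subr0 h2.
rewrite expr1n mul1r.
set y := x ^+ 2 / 4.
have -> : - x ^+ 2 / (1 *+ 2) = - y + - y by rewrite /y; field.
have -> : - x ^+ 2 / (2 *+ 2) = - y by rewrite /y; field.
have -> : x ^+ 2 = 4 * y by rewrite /y; field.
have y0 : 0 <= y by rewrite /y divr_ge0// sqr_ge0.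
have pp : 0 < Num.sqrt (pi *+ 2) :> R by rewrite sqrtr_gt0 pmulrn_lgt0// pi_gt0.
have -> : Num.sqrt (2 * pi *+ 2) = Num.sqrt 2 * Num.sqrt (pi *+ 2) :> R.
  by rewrite -mulrnAr sqrtrM.
rewrite invfM expRD.
have e0 := expR_gt0 (- y).
have e1 : y ^+ 2 * expR (- y) <= 2.
  have := expR_ge1Dxn 1 y0; rewrite (_ : 2`!%:R = 2)// => h.
  have -> : 2 = (2 * expR y) * expR (- y) :> R by rewrite -mulrA -expRD subrr expR0 mulr1.
  by apply: ler_wpM2r; [exact: ltW|lra].
have s22 : 2^-1 <= (Num.sqrt 2)^-1 :> R by rewrite lef_pV2 ?posrE.
set a := (Num.sqrt (pi *+ 2))^-1.
have a0 : 0 < a by rewrite invr_gt0.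
set b := (Num.sqrt 2)^-1; set e := expR (- y).
have -> : (4 * y) ^+ 2 * (a * (e * e)) = (16 * (a * e)) * (y ^+ 2 * e) by ring.
have -> : 64 * (b * a * e) = (16 * (a * e)) * (4 * b) by ring.
apply: ler_wpM2l; first by rewrite !mulr_ge0// ltW.
apply: le_trans e1 _; rewrite /b; lra.
Qed.

Local Notation nu := (normal_prob (0 : R) 1).

(** Finiteness of the fourth moment, obtained by comparison with the total mass of the normal law of
    variance 2. *)
Lemma L2_normal_sqr : L2 nu (fun x => x ^+ 2).
Proof.
have mX : measurable_fun [set: R] (fun x : R => x ^+ 2) by exact: exprn_measurable.
split => //; apply/integrableP; split.
  by apply: measurable_EFin_fun; exact: measurable_funX.
under eq_integral do rewrite /= ger0_norm ?sqr_ge0//.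
apply: le_lt_trans (ge0_integral_normal_prob_le _ _ _) _.
- exact: measurable_funX.
- by move=> x; exact: sqr_ge0.
apply: (@le_lt_trans _ _ (\int[mu]_x (64%:E * (normal_pdf 0 (Num.sqrt 2) x)%:E))%E).
  apply: ge0_le_integral => //=.
  - by move=> x _; rewrite lee_fin mulr_ge0 ?sqr_ge0 ?normal_pdf_ge0.
  - apply: measurable_EFin_fun; apply: measurable_funM; first exact: measurable_funX.
    exact: measurable_normal_pdf.
  - apply: measurable_funeM; apply: measurable_EFin_fun; exact: measurable_normal_pdf.
  - by move=> x _; rewrite -EFinM lee_fin normal_pdf_exp4_le.
rewrite ge0_integralZl//=.
- by rewrite integral_normal_pdf mule1 ltry.
- by apply: measurable_EFin_fun; exact: measurable_normal_pdf.
- by move=> x _; rewrite lee_fin normal_pdf_ge0.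
Qed.

Lemma L2_normal_id : L2 nu (fun x => x).
Proof. by split; [exact: measurable_id|exact: L2_L1 L2_normal_sqr]. Qed.

Lemma Ex_normal_id : Ex nu (fun x => x) = 0.
Proof.
have i1 := L2_L1 L2_normal_id.
have mN : measurable_fun [set: measurableTypeR R] (-%R : measurableTypeR R -> measurableTypeR R) by exact: oppr_measurable.
have h : Ex nu (fun x => x) = Ex nu (fun x => - x).
  apply: EFin_inj; rewrite !ExE//; last exact: L1N.
  rewrite -[RHS](@integral_pushforward _ _ _ _ _ _ mN nu setT EFin)//; last first.
    exact: L1N i1.
  by apply: eq_measure_integral => A mA _; exact: normal_probN.
have : Ex nu (fun x => - x) = - Ex nu (fun x => x).
  rewrite -[RHS]mulN1r -ExZ//; congr (Ex _ _); apply/funext => x.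
  by rewrite mulN1r.
by move=> h2; lra.
Qed.

Lemma normal_prob_set1 (a : R) : nu [set a] = 0%E.
Proof.
by rewrite /normal_prob integral_set1.
Qed.

End normal_moments.

(** * Brownian increments *)

Section measurable_wrt.
Context d (T : measurableType d) (R : realType) (G : set (set T)).
Hypothesis hG : sigma_algebra [set: T] G.

(** A member of the filtration is a bare set of sets. Viewing it as the sigma-algebra it generates
    makes the closure properties of measurable functions available for it. *)
Lemma measurable_wrtP (Y : T -> R) :
  measurable_wrt G Y <-> measurable_fun [set: g_sigma_algebraType G] Y.
Proof.
have E : <<s G >> = G by exact: sigma_algebra_id.
split=> [h _ B mB|h B mB].
- by rewrite setTI /measurable/= E; exact: h.
- by have := h measurableT B mB; rewrite setTI /measurable/= E.
Qed.

Lemma measurable_wrt_cst (c : R) : measurable_wrt G (fun=> c : R).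
Proof. by apply/measurable_wrtP. Qed.

Lemma measurable_wrtD (X Y : T -> R) : measurable_wrt G X -> measurable_wrt G Y ->
  measurable_wrt G (fun w => X w + Y w).
Proof.
move=> /measurable_wrtP hX /measurable_wrtP hY; apply/measurable_wrtP.
exact: measurable_funD.
Qed.

Lemma measurable_wrtM (X Y : T -> R) : measurable_wrt G X -> measurable_wrt G Y ->
  measurable_wrt G (fun w => X w * Y w).
Proof.
move=> /measurable_wrtP hX /measurable_wrtP hY; apply/measurable_wrtP.
exact: measurable_funM.
Qed.

Lemma measurable_wrt_comp (f : R -> R) (X : T -> R) :
  measurable_fun [set: R] f -> measurable_wrt G X ->
  measurable_wrt G (fun w => f (X w)).
Proof.
move=> mf hX B mB; have := hX (f @^-1` B); apply.
by rewrite -[X in measurable X]setTI; exact: mf.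
Qed.

Lemma measurable_wrtB (X Y : T -> R) : measurable_wrt G X -> measurable_wrt G Y ->
  measurable_wrt G (fun w => X w - Y w).
Proof.
move=> hX hY; apply: measurable_wrtD => //.
by apply: (measurable_wrt_comp (f := -%R)) => //; exact: oppr_measurable.
Qed.

Lemma measurable_wrt_sum (I : Type) (s : seq I) (Q : pred I) (h : I -> T -> R) :
  (forall i, Q i -> measurable_wrt G (h i)) ->
  measurable_wrt G (fun w => \sum_(i <- s | Q i) h i w).
Proof.
apply: (sum_closed (K := measurable_wrt G)) => [|f g]; [exact: measurable_wrt_cst|].
exact: measurable_wrtD.
Qed.

Lemma measurable_wrt_le_indic (X : T -> R) (c : R) : measurable_wrt G X ->
  measurable_wrt G (fun w => (X w <= c)%R%:R : R).
Proof.
move=> hX; apply: (measurable_wrt_comp (f := fun x => (x <= c)%R%:R)) => //.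
have -> : (fun x : R => (x <= c)%R%:R) = \1_(`]-oo, c]%classic : set R) :> (R -> R).
  by apply/funext => x; rewrite indicE mem_setE in_itv.
exact: measurable_indic.
Qed.

Lemma measurable_wrt_sub (G' : set (set T)) (X : T -> R) :
  G `<=` G' -> measurable_wrt G X -> measurable_wrt G' X.
Proof. by move=> GG' hX B mB; apply: GG'; exact: hX. Qed.

Lemma measurable_wrt_fun (X : T -> R) :
  G `<=` measurable -> measurable_wrt G X -> measurable_fun [set: T] X.
Proof. by move=> GM hX _ B mB; rewrite setTI; apply: GM; exact: hX. Qed.

End measurable_wrt.

Section brownian.
Context d (T : measurableType d) (R : realType) (P : probability T R)
  (F : R -> set (set T)) (W : R -> T -> R).
Hypotheses (hF : filtration F) (hW : brownian_motion P F W).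
Local Notation nu := (normal_prob (0 : R) 1).
Local Notation Wincr s t := (fun w => W t w - W s w).

(** The value 1 is kept symbolic: the estimates below rely only on [normal_var] being a nonnegative
    constant. *)
Definition normal_var : R := Ex nu (fun x => x ^+ 2).

Lemma normal_var_ge0 : 0 <= normal_var.
Proof. by apply: Ex_ge0 => x; exact: sqr_ge0. Qed.

Lemma filtration_sigma t : 0 <= t -> sigma_algebra [set: T] (F t).
Proof. by case: hF => + _ _; exact. Qed.

Lemma filtration_sub t : 0 <= t -> F t `<=` measurable.
Proof. by case: hF => _ + _; exact. Qed.

Lemma filtration_le s t : 0 <= s -> s <= t -> F s `<=` F t.
Proof. by case: hF => _ _; exact. Qed.

Lemma brownian_wrt t : 0 <= t -> measurable_wrt (F t) (W t).
Proof. by case: hW => + _ _ _ _; exact. Qed.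

Lemma measurable_brownian t : 0 <= t -> measurable_fun [set: T] (W t).
Proof.
by move=> t0; apply: measurable_wrt_fun (filtration_sub t0) _; exact: brownian_wrt.
Qed.

Lemma increment_wrt s t : 0 <= s -> s <= t -> measurable_wrt (F t) (Wincr s t).
Proof.
move=> s0 st; have t0 := le_trans s0 st.
apply: measurable_wrtB; [exact: filtration_sigma|exact: brownian_wrt|].
exact: measurable_wrt_sub (filtration_le s0 st) (brownian_wrt s0).
Qed.

(** Standardised increments all have the same law [nu], so a single reference law serves for every
    time and mesh. *)
Lemma brownian_indep s t : 0 <= s -> s < t ->
  indep_law P (nu : probability (measurableTypeR R) R) (F s)
    (fun w => (W t w - W s w) / Num.sqrt (t - s) : measurableTypeR R).
Proof.
move=> s0 st A B FA mB; case: hW => _ _ _ hind hlaw.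
have r0 : 0 < Num.sqrt (t - s) by rewrite sqrtr_gt0 subr_gt0.
pose r := Num.sqrt (t - s).
pose B' : set R := (fun x => x / r) @^-1` B.
have mB' : measurable B'.
  rewrite -[X in measurable X]setTI.
  by apply: (mulrr_measurable r^-1) => //.
have -> : (fun w => (W t w - W s w) / r) @^-1` B = increment W s t @^-1` B' by [].
rewrite (hind s t A B' s0 st FA mB') (hlaw s t B' s0 st mB'); congr (P A * _)%E.
rewrite -[Num.sqrt _]mulr1 (normal_probZ r0 ltr01 mB'); congr (normal_prob 0 1 _).
by apply/seteqP; split => x; rewrite /B' /= mulrC mulrA mulVf ?mul1r ?gt_eqF.
Qed.

Let mZ s t : 0 <= s -> s < t -> measurable_fun [set: T]
  (fun w => (W t w - W s w) / Num.sqrt (t - s) : measurableTypeR R).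
Proof.
move=> s0 st; have t0 : 0 <= t by apply: le_trans s0 (ltW st).
apply: measurable_funM => //.
by apply: measurable_funB; exact: measurable_brownian.
Qed.

(** The martingale property of [W], in the form needed for orthogonality. The case [s = t] is
    separate because the standardisation divides by [Num.sqrt (t - s)]. *)
Lemma L1_mul_increment s t (X : T -> R) : 0 <= s -> s <= t ->
  measurable_wrt (F s) X -> L1 P X ->
  L1 P (fun w => X w * (W t w - W s w)) /\
  Ex P (fun w => X w * (W t w - W s w)) = 0.
Proof.
move=> s0; rewrite le_eqVlt => /predU1P[<-|st] hX iX.
  by under [X in L1 _ X /\ Ex _ X = _]funext do rewrite subrr mulr0;
    split; [exact: L1_cst|exact: Ex_cst].
have r0 : 0 < Num.sqrt (t - s) by rewrite sqrtr_gt0 subr_gt0.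
have := indep_lawM (filtration_sub s0) (brownian_indep s0 st) (mZ s0 st) hX iX
  (L2_L1 (L2_normal_id R)).
rewrite Ex_normal_id mulr0 => -[i1 e1].
have E : (fun w => X w * (W t w - W s w)) =
  (fun w => Num.sqrt (t - s) * (X w * ((W t w - W s w) / Num.sqrt (t - s)))).
  by apply/funext => w; field; rewrite gt_eqF.
by rewrite E; split; [exact: L1Z|rewrite ExZ// e1 mulr0].
Qed.

Lemma L1_mul_increment_sqr s t (X : T -> R) : 0 <= s -> s <= t ->
  measurable_wrt (F s) X -> L1 P X ->
  L1 P (fun w => X w * (W t w - W s w) ^+ 2) /\
  Ex P (fun w => X w * (W t w - W s w) ^+ 2) = Ex P X * ((t - s) * normal_var).
Proof.
move=> s0; rewrite le_eqVlt => /predU1P[<-|st] hX iX.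
  rewrite subrr mul0r mulr0.
  by under [X in L1 _ X /\ Ex _ X = _]funext do rewrite subrr expr0n mulr0;
    split; [exact: L1_cst|exact: Ex_cst].
have r0 : 0 < Num.sqrt (t - s) by rewrite sqrtr_gt0 subr_gt0.
have [i1 e1] := indep_lawM (filtration_sub s0) (brownian_indep s0 st) (mZ s0 st) hX iX
  (L2_L1 (L2_normal_sqr R)).
have r2 : Num.sqrt (t - s) ^+ 2 = t - s by rewrite sqr_sqrtr// subr_ge0 ltW.
have E : (fun w => X w * (W t w - W s w) ^+ 2) =
  (fun w => (t - s) * (X w * ((W t w - W s w) / Num.sqrt (t - s)) ^+ 2)).
  apply/funext => w; rewrite expr_div_n r2; field.
  by rewrite subr_eq0 gt_eqF.
by rewrite E; split; [exact: L1Z|rewrite ExZ// e1 mulrCA].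
Qed.

Lemma L2_increment s t : 0 <= s -> s <= t -> L2 P (Wincr s t).
Proof.
move=> s0 st; have t0 := le_trans s0 st.
split; first by apply: measurable_funB; exact: measurable_brownian.
have := (L1_mul_increment_sqr s0 st (measurable_wrt_cst (filtration_sigma s0) 1)
  (L1_cst P 1)).1.
by under [X in L1 _ X -> _]funext do rewrite mul1r.
Qed.

(** For [i < j] the product of the [i]-th term with [H j] is known at time [c j], hence orthogonal
    to the next increment of [W]; only the diagonal terms survive. Steps of zero length are allowed,
    since they arise when partitions are clipped. *)
Lemma ito_isometry (c : nat -> R) (H : nat -> T -> R) (n : nat) :
  0 <= c 0%N -> (forall j, (j < n)%N -> c j <= c j.+1) ->
  (forall j, (j < n)%N -> measurable_wrt (F (c j)) (H j)) ->
  (forall j, (j < n)%N -> exists C : R, forall w, `|H j w| <= C) ->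
  (forall j, (j < n)%N -> L2 P (fun w => H j w * (W (c j.+1) w - W (c j) w))) /\
  Ex P (fun w => (\sum_(j < n) H j w * (W (c j.+1) w - W (c j) w)) ^+ 2) =
  normal_var * \sum_(j < n) (c j.+1 - c j) * Ex P (fun w => H j w ^+ 2).
Proof.
move=> c0 cS hH hC.
have cle i j : (i <= j <= n)%N -> c i <= c j.
  move=> /andP[]; elim: j => [|j ih]; first by rewrite leqn0 => /eqP->.
  rewrite leq_eqVlt => /predU1P[->//|ij jn].
  by apply: le_trans (cS _ jn); apply: ih => //; exact: ltnW.
have cge0 j : (j <= n)%N -> 0 <= c j.
  by move=> jn; apply: le_trans c0 _; apply: cle.
have mH j : (j < n)%N -> measurable_fun [set: T] (H j).
  by move=> jn; apply: measurable_wrt_fun (filtration_sub (cge0 _ (ltnW jn))) (hH _ jn).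
have hL j : (j < n)%N -> L2 P (fun w => H j w * (W (c j.+1) w - W (c j) w)).
  move=> jn; have [C HC] := hC _ jn.
  apply: (L2Mb (C := C)) => //; last exact: mH.
  by apply: L2_increment; [exact/cge0/ltnW|exact: cS].
split => //.
rewrite (Ex_orth_sum (U := fun j w => H j w * (W (c j.+1) w - W (c j) w))) //; last first.
  move=> i j /andP[ij jn]; have iln := ltn_trans ij jn.
  have [C HC] := hC _ jn.
  under [X in Ex _ X]funext do rewrite mulrA.
  apply: (L1_mul_increment _ _ _ _).2; [exact/cge0/ltnW|exact: cS| |].
  - have c0j := cge0 _ (ltnW jn).
    apply: measurable_wrtM; [exact: filtration_sigma| |exact: hH].
    have ij1 : c i.+1 <= c j by apply: cle; rewrite ij ltnW.
    apply: measurable_wrtM; first exact: filtration_sigma.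
      apply: measurable_wrt_sub (hH _ iln); apply: filtration_le; first exact/cge0/ltnW.
      by apply: cle; apply/andP; split; exact: ltnW.
    apply: measurable_wrt_sub (filtration_le (cge0 _ iln) ij1) _.
    by apply: increment_wrt; [exact/cge0/ltnW|exact: cS].
  - apply: L2M; first exact: hL.
    by apply: L2_bounded HC; exact: mH.
rewrite mulr_sumr; apply: eq_bigr => j _; have jn := ltn_ord j.
under [X in Ex _ X]funext do rewrite exprMn.
have [C HC] := hC _ jn.
rewrite (L1_mul_increment_sqr _ _ _ _).2; first by ring.
- exact/cge0/ltnW.
- exact: cS.
- apply: (measurable_wrt_comp (f := fun x => x ^+ 2)); first exact: exprn_measurable.
  exact: hH.
- have := L2_bounded P (mH _ jn) HC; by case.
Qed.

End brownian.

(** * Outer probability and domination *)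

Section outer_probability.
Context d (T : measurableType d) (R : realType) (P : probability T R).
Local Open Scope ereal_scope.

Lemma outer_le (A B : set T) : A `<=` B -> mu_ext P A <= mu_ext P B.
Proof. exact: le_mu_ext. Qed.

Lemma outerU (A B : set T) : mu_ext P (A `|` B) <= mu_ext P A + mu_ext P B.
Proof. exact: outer_measureU2. Qed.

Lemma outerE (A : set T) : measurable A -> mu_ext P A = P A.
Proof. exact: measurable_mu_extE. Qed.

(** The exceptional null set is added to [B] at no cost, by subadditivity. Almost sure hypotheses
    enter the estimates in outer probability this way. *)
Lemma outer_ae (Q : T -> Prop) (A B : set T) : {ae P, forall w, Q w} ->
  (forall w, Q w -> A w -> B w) -> mu_ext P A <= mu_ext P B.
Proof.
move=> [N [mN N0 QN]] AB.
apply: (@le_trans _ _ (mu_ext P (B `|` N))).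
  apply: outer_le => w Aw; have [Qw|nQw] := pselect (Q w); first by left; exact: AB.
  by right; exact: QN.
by apply: le_trans (outerU _ _) _; rewrite (outerE mN) N0 adde0.
Qed.

Lemma cvg0_in_probability_near (Z : nat -> T -> \bar R) (e eta : R) :
  cvg0_in_probability P Z -> (0 < e)%R -> (0 < eta)%R ->
  exists K, forall k, (K <= k)%N -> (mu_ext P [set w | (e%:E < Z k w)%E] <= eta%:E)%E.
Proof.
move=> hZ e0 eta0; have := hZ e e0 => h.
have nb : nbhs (0%E : \bar R) [set x | (x <= eta%:E)%E].
  by near=> x; apply: ltW; near: x; apply: open_ereal_lt'; rewrite lte_fin.
have [K _ HK] := h _ nb.
by exists K => k /HK.
Unshelve. all: by end_near.
Qed.

Lemma outer_sub2 (A B C : set T) (a b : \bar R) :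
  A `<=` B `|` C -> mu_ext P B <= a -> mu_ext P C <= b -> mu_ext P A <= a + b.
Proof.
move=> ABC Ba Cb; apply: le_trans (outer_le ABC) _.
by apply: le_trans (outerU _ _) _; exact: leeD.
Qed.

End outer_probability.

Lemma ler_sum_ord (R : realType) (b : nat -> R) (n m : nat) :
  (forall i, 0 <= b i) -> (n <= m)%N -> \sum_(i < n) b i <= \sum_(i < m) b i.
Proof.
move=> b0; elim: m => [|m ih]; first by rewrite leqn0 => /eqP->.
rewrite leq_eqVlt => /predU1P[->//|nm].
by rewrite big_ord_recr/= (le_trans (ih nm))// lerDl.
Qed.

Section lenglart.
Context d (T : measurableType d) (R : realType) (P : probability T R)
  (F : R -> set (set T)) (W : R -> T -> R).
Hypotheses (hF : filtration F) (hW : brownian_motion P F W).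

(** A term is kept only while the untruncated running total, itself included, stays below [delta].
    The truncated total is dominated by the untruncated one, so adding a kept term cannot cross
    [delta]; this is why both bounds are proved together. [B] and [S] are the untruncated and
    truncated totals of the earlier blocks. *)
Lemma truncated_sum (a : nat -> R) (B S delta : R) (n : nat) :
  (forall j, 0 <= a j) -> S <= delta -> S <= B ->
  let S' := S + \sum_(j < n) a j * (B + \sum_(i < j.+1) a i <= delta)%R%:R in
  S' <= delta /\ S' <= B + \sum_(j < n) a j.
Proof.
move=> a0 Sd SB /=; elim: n => [|n [ih1 ih2]]; first by rewrite !big_ord0 !addr0.
rewrite !big_ord_recr/=.
set X := \sum_(j < n) a j * _ in ih1 ih2 *; set Y := \sum_(j < n) a j in ih2 *.
have an := a0 n.
by case: (leP (B + (Y + a n)) delta) => h /=; rewrite ?mulr1 ?mulr0; split; lra.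
Qed.

(* Lenglart's domination: stopping the integrand as soon as its quadratic
   variation exceeds [delta] leaves an integrand to which the isometry
   applies. *)
Lemma lenglart (M K : nat) (c : nat -> nat -> R) (H : nat -> nat -> T -> R)
    (e delta : R) :
  0 < e -> 0 <= delta -> 0 <= c 0%N 0%N ->
  (forall q j, (q < M)%N -> (j < K)%N -> c q j <= c q j.+1) ->
  (forall q, c q K <= c q.+1 0%N) ->
  (forall q j, (q < M)%N -> (j < K)%N -> c q j < c q j.+1 ->
    measurable_wrt (F (c q j)) (H q j)) ->
  (mu_ext P [set w | (e < \sum_(q < M) (\sum_(j < K)
      H q j w * (W (c q j.+1) w - W (c q j) w)) ^+ 2)%R] <=
   mu_ext P [set w | (delta < \sum_(q < M) \sum_(j < K)
      (c q j.+1 - c q j) * H q j w ^+ 2)%R] + (normal_var R * delta / e)%:E)%E.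
Proof.
move=> e0 d0 c0 cS cq hH.
have cle q i j : (q < M)%N -> (i <= j <= K)%N -> c q i <= c q j.
  move=> qM /andP[]; elim: j => [|j ih]; first by rewrite leqn0 => /eqP->.
  rewrite leq_eqVlt => /predU1P[->//|ij jn].
  by apply: le_trans (cS _ _ qM jn); apply: ih => //; exact: ltnW.
have cle0 p q : (p <= q)%N -> (q <= M)%N -> c p 0%N <= c q 0%N.
  elim: q => [|q ih]; first by rewrite leqn0 => /eqP->.
  rewrite leq_eqVlt => /predU1P[->//|pq qM].
  apply: le_trans (ih pq (ltnW qM)) _; apply: le_trans (cq q).
  by apply: cle => //=.
have cqq p q j i : (p < q)%N -> (q < M)%N -> (j <= K)%N -> (i <= K)%N -> c p j <= c q i.
  move=> pq qM jK iK; apply: (@le_trans _ _ (c p K)).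
    by apply: cle; [exact: ltn_trans pq qM|rewrite jK/=].
  apply: le_trans (cq p) _; apply: (@le_trans _ _ (c q 0%N)).
    by apply: cle0 => //; exact: ltnW.
  by apply: cle => //=.
have cge0 q j : (q < M)%N -> (j <= K)%N -> 0 <= c q j.
  move=> qM jK; apply: le_trans c0 _; apply: le_trans (cle0 0%N q _ (ltnW qM)) _ => //.
  by apply: cle => //=.
(* Cells of zero length get coefficient 0, since [H] is assumed measurable only on the others. *)
pose Hz q j w := if c q j < c q j.+1 then H q j w else 0.
pose a q w j := (c q j.+1 - c q j) * Hz q j w ^+ 2 *+ ((q < M)%N && (j < K)%N).
pose B q w := \sum_(p < q) \sum_(j < K) a p w j.
(* The test includes the current term: its length is deterministic and its coefficient is known at
   time [c q j], so [H'] still does not anticipate. *)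
pose H' q j w := Hz q j w * (B q w + \sum_(i < j.+1) a q w i <= delta)%R%:R.
have hHz q j : (q < M)%N -> (j < K)%N -> measurable_wrt (F (c q j)) (Hz q j).
  move=> qM jK; rewrite /Hz; case: (ltP (c q j) (c q j.+1)) => h; first exact: hH.
  exact: measurable_wrt_cst (filtration_sigma hF (cge0 _ _ qM (ltnW jK))) _.
have hsig q j : (q < M)%N -> (j < K)%N -> sigma_algebra [set: T] (F (c q j)).
  by move=> qM jK; apply: (filtration_sigma hF); apply: cge0 => //; exact: ltnW.
have ha q j p i : (q < M)%N -> (j < K)%N -> (p < M)%N -> (i < K)%N -> c p i <= c q j ->
    measurable_wrt (F (c q j)) (fun w => a p w i).
  move=> qM jK pM iK le; rewrite /a pM iK /=.
  under [X in measurable_wrt _ X]funext do rewrite mulr1n.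
  apply: measurable_wrtM; [exact: hsig|apply: measurable_wrt_cst; exact: hsig|].
  apply: (measurable_wrt_comp (f := fun x => x ^+ 2)); first exact: exprn_measurable.
  apply: measurable_wrt_sub (filtration_le hF _ le) _; last exact: hHz.
  by apply: cge0 => //; exact: ltnW.
have hH' q j : (q < M)%N -> (j < K)%N -> measurable_wrt (F (c q j)) (H' q j).
  move=> qM jK; apply: measurable_wrtM; [exact: hsig|exact: hHz|].
  apply: (measurable_wrt_le_indic (X := fun w => B q w + \sum_(i < j.+1) a q w i)).
  apply: measurable_wrtD; first exact: hsig.
    apply: measurable_wrt_sum => [|p _]; first exact: hsig.
    apply: measurable_wrt_sum => [|i _]; first exact: hsig.
    have pq := ltn_ord p; have iK := ltn_ord i.
    apply: ha => //; first exact: ltn_trans pq qM.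
    by apply: cqq => //; exact: ltnW.
  apply: measurable_wrt_sum => [|i _]; first exact: hsig.
  have ij := ltn_ord i; rewrite ltnS in ij.
  apply: ha => //; first exact: leq_ltn_trans ij jK.
  by apply: cle => //; rewrite ij/= ltnW.
have a0 q w j : 0 <= a q w j.
  rewrite /a; case: andP => [[qM jK]|_]; rewrite ?mulr0n// mulr1n mulr_ge0 ?sqr_ge0//.
  by rewrite subr_ge0 cS.
have trunc w n : (n <= M)%N ->
    \sum_(q < n) \sum_(j < K) (c q j.+1 - c q j) * H' q j w ^+ 2 <= delta /\
    \sum_(q < n) \sum_(j < K) (c q j.+1 - c q j) * H' q j w ^+ 2 <= B n w.
  elim: n => [|n ih] nM; first by rewrite /B !big_ord0.
  have [ih1 ih2] := ih (ltnW nM).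
  have /= := truncated_sum K (a0 n w) ih1 ih2.
  rewrite /B !big_ord_recr/= -/(B n w).
  suff -> : \sum_(j < K) a n w j * (B n w + \sum_(i < j.+1) a n w i <= delta)%R%:R =
    \sum_(j < K) (c n j.+1 - c n j) * H' n j w ^+ 2 by [].
  apply: eq_bigr => j _; rewrite /H' exprMn {1}/a nM ltn_ord mulr1n -mulrA.
  by congr (_ * (_ * _)); case: leP; rewrite /= ?expr1n ?expr0n.
(* Truncation provides the boundedness required by the isometry: a single term of the truncated sum
   is at most [delta], which bounds [H'] on each cell of positive length. *)
have bH' q j : (q < M)%N -> (j < K)%N -> exists C : R, forall w, `|H' q j w| <= C.
  move=> qM jK; exists (Num.sqrt (delta / (c q j.+1 - c q j))) => w.
  have [lt|nlt] := ltP (c q j) (c q j.+1); last first.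
    by rewrite /H' /Hz ltNge nlt/= mul0r normr0.
  rewrite -sqrtr_sqr ler_wsqrtr// ler_pdivlMr ?subr_gt0// mulrC.
  have [+ _] := trunc w _ qM.
  apply: le_trans; rewrite big_ord_recr/= (bigD1 (Ordinal jK))//=.
  have pos p i : (p <= q)%N -> (i < K)%N -> 0 <= (c p i.+1 - c p i) * H' p i w ^+ 2.
    by move=> pq iK; rewrite mulr_ge0 ?sqr_ge0// subr_ge0 cS//; exact: leq_ltn_trans pq qM.
  rewrite addrCA lerDl addr_ge0//.
    by apply: sumr_ge0 => p _; apply: sumr_ge0 => i _; apply: pos => //; exact: ltnW.
  by apply: sumr_ge0 => i _; exact: pos.
pose X q w := \sum_(j < K) H' q j w * (W (c q j.+1) w - W (c q j) w).
have iso q : (q < M)%N -> L2 P (X q) /\ Ex P (fun w => X q w ^+ 2) =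
    normal_var R * \sum_(j < K) (c q j.+1 - c q j) * Ex P (fun w => H' q j w ^+ 2).
  move=> qM; have [h1 h2] := ito_isometry hF hW (c := c q) (H := H' q) (n := K)
    (cge0 _ _ qM (leq0n _)) (fun j jK => cS q j qM jK) (fun j jK => hH' q j qM jK)
    (fun j jK => bH' q j qM jK).
  by split => //; apply: L2_sum => j _; exact: h1.
have mH' q j : (q < M)%N -> (j < K)%N -> L1 P (fun w => H' q j w ^+ 2).
  move=> qM jK; have [C HC] := bH' q j qM jK.
  have mm : measurable_fun [set: T] (H' q j).
    by apply: measurable_wrt_fun (filtration_sub hF (cge0 _ _ qM (ltnW jK))) (hH' q j qM jK).
  by have [] := L2_bounded P mm HC.
have iX : L1 P (fun w => \sum_(q < M) X q w ^+ 2).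
  by apply: L1_sum => q _; have [[]] := iso q (ltn_ord q).
have EX : Ex P (fun w => \sum_(q < M) X q w ^+ 2) <= normal_var R * delta.
  rewrite Ex_sum; last by move=> q _; have [[]] := iso q (ltn_ord q).
  under eq_bigr => q _ do rewrite (iso q (ltn_ord q)).2.
  rewrite -mulr_sumr ler_wpM2l ?normal_var_ge0//.
  rewrite [leLHS](_ : _ = Ex P (fun w => \sum_(q < M) \sum_(j < K)
     (c q j.+1 - c q j) * H' q j w ^+ 2)); last first.
    rewrite Ex_sum; last first.
      by move=> q _; apply: L1_sum => j _; apply: L1Z; exact: mH'.
    apply: eq_bigr => q _; rewrite Ex_sum; last first.
      by move=> j _; apply: L1Z; exact: mH'.
    by apply: eq_bigr => j _; rewrite ExZ//; exact: mH'.
  rewrite -[leRHS](Ex_cst P delta); apply: le_Ex.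
  - by apply: L1_sum => q _; apply: L1_sum => j _; apply: L1Z; exact: mH'.
  - exact: L1_cst.
  - by move=> w; exact: (trunc w M (leqnn _)).1.
apply: (outer_sub2 (B := [set w | (delta < \sum_(q < M) \sum_(j < K)
      (c q j.+1 - c q j) * H q j w ^+ 2)%R])
    (C := [set w | (e < \sum_(q < M) X q w ^+ 2)%R])) => //.
(* As long as the whole quadratic variation is at most [delta], the truncation never acts and both
   sums of squares coincide. *)
- move=> w /= hw.
  have [le|lt] := leP (\sum_(q < M) \sum_(j < K) (c q j.+1 - c q j) * H q j w ^+ 2) delta;
    last by left.
  right; rewrite (_ : \sum_(q < M) X q w ^+ 2 = \sum_(q < M) (\sum_(j < K)
      H q j w * (W (c q j.+1) w - W (c q j) w)) ^+ 2)//.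
  apply: eq_bigr => q _; congr (_ ^+ 2); apply: eq_bigr => j _.
  have qM := ltn_ord q; have jK := ltn_ord j.
  have [lt|ge] := ltP (c q j) (c q j.+1); last first.
    have -> : c q j.+1 = c q j by apply/eqP; rewrite eq_le ge cS.
    by rewrite subrr !mulr0.
  congr (_ * _); rewrite /H' /Hz lt (_ : _ <= delta) ?mulr1//.
  have aE p i : (p < M)%N -> (i < K)%N -> a p w i = (c p i.+1 - c p i) * H p i w ^+ 2.
    move=> pM iK; rewrite /a pM iK mulr1n /Hz; case: ltP => // ge.
    have -> : c p i.+1 = c p i by apply/eqP; rewrite eq_le ge cS.
    by rewrite subrr !mul0r.
  apply: le_trans le.
  have -> : \sum_(q < M) \sum_(j < K) (c q j.+1 - c q j) * H q j w ^+ 2 =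
      \sum_(q < M) \sum_(j < K) a q w j.
    by apply: eq_bigr => p _; apply: eq_bigr => i _; rewrite aE.
  apply: (@le_trans _ _ (B q.+1 w)).
    by rewrite /B [leRHS]big_ord_recr/= lerD2l; exact: (ler_sum_ord (a0 q w) jK).
  by apply: (ler_sum_ord (b := fun p => \sum_(i < K) a p w i)) => // p; exact: sumr_ge0.
- have mS : measurable [set w | (e < \sum_(q < M) X q w ^+ 2)%R].
    rewrite -[Y in measurable Y]setTI; apply: measurable_fun_ltr => //; exact: L1_meas iX.
  rewrite outerE//; apply: le_trans (Ex_markov e0 iX _) _.
    by move=> w; apply: sumr_ge0 => q _; exact: sqr_ge0.
  by rewrite lee_fin ler_wpM2r// invr_ge0 ltW.
Qed.

End lenglart.

(** * Ito integrals along a grid *)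

Section step_integrals.
Context (R : realType).
Local Notation mu := (@lebesgue_measure R).

Lemma ge0_integral_chain (x : nat -> R) (n : nat) (f : R -> \bar R) :
  (forall i, (i < n)%N -> x i <= x i.+1) -> measurable_fun [set: R] f ->
  (forall u, (0 <= f u)%E) ->
  (\int[mu]_(u in `]x 0%N, x n]) f u =
   \sum_(i < n) \int[mu]_(u in `]x i, x i.+1]) f u)%E.
Proof.
move=> xS mf f0; elim: n xS => [|n ih] xS.
  by rewrite big_ord0 set_itvoc0 integral_set0.
rewrite big_ord_recr/= -ih; last by move=> i i_n; apply: xS; exact: ltnW.
have x0n : x 0%N <= x n.
  elim: n {ih} xS => // n ih xS; apply: le_trans (xS n _) => //.
  by apply: ih => i i_n; apply: xS; exact: ltnW.
have -> : `]x 0%N, x n.+1]%classic = `]x 0%N, x n]%classic `|` `]x n, x n.+1]%classic.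
  have xnS := xS n (ltnSn n).
  apply/seteqP; split => u /=; rewrite !in_itv/=.
    by move=> /andP[-> ->]; case: leP => _; [left|right].
  move=> [/andP[-> /le_trans->//]|/andP[h ->]]; rewrite andbT.
  exact: le_lt_trans h.
rewrite ge0_integral_setU//=.
- exact: measurable_funTS.
- apply/disj_setPRL => u /=; rewrite !in_itv/= => /andP[h _]; apply/negP.
  by rewrite negb_and -ltNge h orbT.
Qed.

Lemma integral_itv_cst (x y : R) (k : \bar R) (f : R -> \bar R) : x <= y ->
  (forall u, x < u -> u <= y -> f u = k) ->
  (\int[mu]_(u in `]x, y]) f u = k * (y - x)%:E)%E.
Proof.
move=> xy fk; rewrite (@eq_integral _ _ _ _ _ (cst k)); last first.
  by move=> u /set_mem/=; rewrite in_itv/= => /andP[h1 h2]; exact: fk.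
rewrite integral_cst//= lebesgue_measure_itv/= lte_fin.
case: ltP => // yx; rewrite mule0.
have -> : y = x by apply/eqP; rewrite eq_le xy yx.
by rewrite subrr mule0.
Qed.

End step_integrals.

Section simple_process.
Context d (T : measurableType d) (R : realType) (P : probability T R)
  (F : R -> set (set T)) (W : R -> T -> R).
Hypotheses (hF : filtration F) (hW : brownian_motion P F W).
Local Notation mu := (@lebesgue_measure R).

(** For [a <= b], the projection on the segment from [a] to [b]. Projecting the partition of a
    simple process on each grid cell yields a common refinement without sorting any points. *)
Definition clip (a b x : R) : R := Num.max a (Num.min b x).

Lemma clip_le a b x y : x <= y -> clip a b x <= clip a b y.
Proof. by move=> xy; rewrite /clip le_max2// le_min2. Qed.

Lemma clip_increment a b x (w : T) : a <= b ->
  W (Num.min b x) w - W (Num.min a x) w = W (clip a b x) w - W a w.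
Proof.
move=> ab; rewrite /clip; have [xa|ax] := leP x a.
  by rewrite (min_r (le_trans xa ab)) max_l// !subrr.
have [xb|bx] := leP x b; first by rewrite max_r// ltW.
by rewrite max_r.
Qed.

Definition grid_process (M : nat) (v : nat -> T -> R) : simple_process T R :=
  SimpleProcess M (fun q => q%:R / M%:R) v.

Variables (S : simple_process T R).
Hypothesis hS : sp_predictable F S.
Local Notation K := (sp_size S).

(* The partition of the time axis carried by [S], completed by [0] on the left
   and by a point beyond [1] on the right, with null coefficients there. *)
Definition ext_time (j : nat) : R :=
  if j is j'.+1 then if (j' <= K)%N then sp_time S j' else Num.max 1 (sp_time S K) else 0.

Definition ext_coef (j : nat) (w : T) : R :=
  if j is j'.+1 then if (j' < K)%N then sp_coef S j' w else 0 else 0.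

Lemma sp_time_le i j : (i <= j <= K)%N -> sp_time S i <= sp_time S j.
Proof.
move=> /andP[]; elim: j => [|j ih]; first by rewrite leqn0 => /eqP->.
rewrite leq_eqVlt => /predU1P[->//|ij jK].
apply: le_trans (ih ij (ltnW jK)) _.
by have [_ /(_ j jK)[]] := hS.
Qed.

Lemma sp_time_ge0 j : (j <= K)%N -> 0 <= sp_time S j.
Proof. by move=> jK; have [h _] := hS; apply: le_trans h _; apply: sp_time_le. Qed.

Lemma ext_timeS j : ext_time j <= ext_time j.+1.
Proof.
rewrite /ext_time; case: j => [|j]; first exact: sp_time_ge0.
have [jK|Kj] := leqP j.+1 K.
  by rewrite (ltnW jK); have [_ /(_ j jK)[]] := hS.
case: ifPn => // jK; have -> : j = K by lia.
by rewrite le_max lexx orbT.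
Qed.

Lemma sp_val_ext j u (w : T) : (j < K.+2)%N ->
  ext_time j < u -> u <= ext_time j.+1 -> sp_val S u w = ext_coef j w.
Proof.
move=> jK h1 h2; rewrite /sp_val.
have off (i : 'I_K) : (j <= i)%N || (i.+1 < j)%N ->
    \1_(`]sp_time S i, sp_time S i.+1]%classic) u = 0 :> R.
  move=> h; rewrite indicE mem_setE in_itv/=; have iK := ltn_ord i.
  suff -> : (sp_time S i < u <= sp_time S i.+1)%R = false by [].
  apply/negP => /andP[g1 g2]; move/orP: h => [ji|ij].
  - move: g1; rewrite ltNge => /negP; apply; apply: le_trans h2 _.
    have -> /= : ext_time j.+1 = sp_time S j by rewrite /= (leq_trans ji) // ltnW.
    by apply: sp_time_le; rewrite ji ltnW.
  - move: g2; rewrite leNgt => /negP; apply; apply: le_lt_trans h1.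
    case: j jK {h2} ij => // j jK ij /=; rewrite (_ : (j <= K)%N); last by lia.
    by apply: sp_time_le; lia.
case: j jK h1 h2 off => [|j] jK h1 h2 off.
  by rewrite big1// => i _; rewrite off ?mulr0.
have [jK'|Kj] := ltnP j K; last first.
  rewrite /= ltnNge Kj/= big1// => i _; have iK := ltn_ord i.
  by rewrite off ?mulr0//; apply/orP; right; lia.
rewrite /= jK' (bigD1 (Ordinal jK'))//= big1 ?addr0; last first.
  move=> i /eqP ij; rewrite off ?mulr0//.
  have : (i : nat) <> j by move=> e; apply: ij; apply: val_inj.
  lia.
rewrite indicE mem_setE in_itv/=.
move: h1 h2; rewrite /= (ltnW jK') jK' => -> ->; by rewrite mulr1.
Qed.

Lemma measurable_sp_val (w : T) : measurable_fun [set: R] (fun u => sp_val S u w).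
Proof.
rewrite /sp_val; apply: measurable_sum => j; apply: measurable_funM => //.
Qed.

Variables (M : nat) (v : nat -> T -> R).
Hypothesis M0 : (0 < M)%N.
Local Notation g := (sp_val (grid_process M v)).
Local Notation gt q := (q%:R / M%:R : R).

Lemma grid_ge0 q : 0 <= gt q.
Proof. by rewrite divr_ge0. Qed.

Lemma grid_le p q : (p <= q)%N -> gt p <= gt q.
Proof. by move=> pq; rewrite ler_wpM2r ?invr_ge0// ler_nat. Qed.

Lemma grid_process_val q u w : (q < M)%N -> gt q < u -> u <= gt q.+1 -> g u w = v q w.
Proof.
move=> qM h1 h2; rewrite /sp_val /= (bigD1 (Ordinal qM))//= big1 ?addr0; last first.
  move=> i /eqP iq; rewrite indicE mem_setE in_itv/=.
  have {}iq : (i : nat) <> q by move=> e; apply: iq; apply: val_inj.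
  suff -> : (gt i < u <= gt i.+1)%R = false by rewrite mulr0.
  apply/negP => /andP[g1 g2].
  have [iq'|qi] := ltnP i q.
    by have := lt_le_trans h1 (le_trans g2 (grid_le iq')); rewrite ltxx.
  have iq'' : (q.+1 <= i)%N by lia.
  by have := le_lt_trans (le_trans h2 (grid_le iq'')) g1; rewrite ltxx.
by rewrite indicE mem_setE in_itv/= h1 h2 mulr1.
Qed.

Local Notation c := (fun q j => clip (gt q) (gt q.+1) (ext_time j)).

Lemma clip_grid0 q : c q 0%N = gt q.
Proof.
by rewrite /clip /= max_l// ge_min grid_ge0 orbT.
Qed.

Lemma clip_gridK q : (q < M)%N -> c q K.+2 = gt q.+1.
Proof.
move=> qM; rewrite /clip /= ltnn.
have h : gt q.+1 <= Num.max 1 (sp_time S K).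
  by rewrite le_max ler_pdivrMr ?ltr0n// mul1r ler_nat qM.
by rewrite (min_l h) max_r// grid_le.
Qed.

(** Both integrals are written on the common refinement. The constant coefficient [v q] telescopes
    over the clipped points, so the difference is an integral with coefficients
    [ext_coef j - v q]. *)
Lemma sp_integral_grid q w : (q < M)%N ->
  sp_integral S W (gt q.+1) w - sp_integral S W (gt q) w - v q w * (W (gt q.+1) w - W (gt q) w) =
  \sum_(j < K.+2) (ext_coef j w - v q w) * (W (c q j.+1) w - W (c q j) w).
Proof.
move=> qM; under [RHS]eq_bigr do rewrite mulrBl.
rewrite [RHS]sumrB; congr (_ - _); last first.
  rewrite -mulr_sumr -(big_mkord predT (fun j => W (c q j.+1) w - W (c q j) w)).
  by rewrite telescope_sumr// clip_grid0 clip_gridK.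
rewrite big_ord_recl/= mul0r add0r big_ord_recr/= ltnn mul0r addr0.
rewrite /sp_integral -sumrB; apply: eq_bigr => j _.
have jK := ltn_ord j; rewrite /bump /= !add1n jK ltnW// -mulrBr; congr (_ * _).
have ab : gt q <= gt q.+1 by exact: grid_le.
have := clip_increment (sp_time S j.+1) w ab.
have := clip_increment (sp_time S j) w ab.
by move: (W _ w) (W _ w) (W _ w) (W _ w) (W _ w) (W _ w) (W _ w) => *; lra.
Qed.

(** Both integrands are constant on each cell of the common refinement, so their squared distance in
    time is exactly the quadratic variation appearing in [lenglart]. *)
Lemma integral_sp_val_grid w :
  (\int[mu]_(u in `[0%R, 1%R]) ((sp_val S u w - g u w) ^+ 2)%:E =
  (\sum_(q < M) \sum_(j < K.+2) (c q j.+1 - c q j) * (ext_coef j w - v q w) ^+ 2)%:E)%E.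
Proof.
have mf : measurable_fun [set: R] (fun u => (sp_val S u w - g u w) ^+ 2).
  apply: measurable_funX; apply: measurable_funB; first exact: measurable_sp_val.
  rewrite /sp_val; apply: measurable_sum => j; apply: measurable_funM => //.
rewrite -integral_itv_obnd_cbnd//; last first.
  by apply: measurable_funTS; exact: measurable_EFin_fun.
have x0 : 0 = gt 0%N by rewrite mul0r.
have x1 : 1 = gt M by rewrite divff// pnatr_eq0 -lt0n.
rewrite (_ : `]0%R, 1%R]%classic = `]gt 0%N, gt M]%classic); last by rewrite -x0 -x1.
pose f u := ((sp_val S u w - g u w) ^+ 2)%:E.
transitivity (\sum_(q < M) \int[mu]_(u in `]gt q, gt q.+1]) f u)%E.
  apply: (@ge0_integral_chain _ (fun q => gt q)).
  - by move=> q _; exact: grid_le.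
  - exact: measurable_EFin_fun.
  - by move=> u; rewrite lee_fin sqr_ge0.
rewrite -sumEFin; apply: eq_bigr => q _; have qM := ltn_ord q.
rewrite (_ : `]gt q, gt q.+1]%classic = `]c q 0%N, c q K.+2]%classic); last first.
  by rewrite clip_grid0 clip_gridK.
transitivity (\sum_(j < K.+2) \int[mu]_(u in `]c q j, c q j.+1]) f u)%E.
  apply: (@ge0_integral_chain _ (c q)).
  - by move=> j _; apply: clip_le; exact: ext_timeS.
  - exact: measurable_EFin_fun.
  - by move=> u; rewrite lee_fin sqr_ge0.
rewrite -sumEFin; apply: eq_bigr => j _; have jK := ltn_ord j.
rewrite (@integral_itv_cst _ _ _ ((ext_coef j w - v q w) ^+ 2)%:E).
- by rewrite -EFinM mulrC.
- by apply: clip_le; exact: ext_timeS.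
- move=> u u1 u2; rewrite /f; have u1' : gt q < u.
        by apply: le_lt_trans u1; rewrite /clip le_max lexx.
      have u2' : u <= gt q.+1.
        by apply: le_trans u2 _; rewrite /clip ge_max grid_le//= ge_min lexx.
      rewrite (grid_process_val w qM u1' u2') (sp_val_ext w jK)//.
  + by move: u1; rewrite /clip gt_max gt_min (ltNge (gt q.+1)) u2' => /andP[_].
  + by move: u2; rewrite /clip le_max leNgt u1'/= le_min => /andP[].
Qed.

Hypothesis hv : forall q, (q < M)%N -> measurable_wrt (F (gt q)) (v q).

Lemma lenglart_simple (e delta : R) : 0 < e -> 0 <= delta ->
  (mu_ext P [set w | (e < \sum_(q < M)
     (sp_integral S W (gt q.+1) w - sp_integral S W (gt q) w
      - v q w * (W (gt q.+1) w - W (gt q) w)) ^+ 2)%R] <=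
   mu_ext P [set w | delta%:E <
     \int[mu]_(u in `[0%R, 1%R]) ((sp_val S u w - g u w) ^+ 2)%:E]
   + (normal_var R * delta / e)%:E)%E.
Proof.
move=> e0 d0.
have -> : [set w | (delta%:E <
     \int[mu]_(u in `[0%R, 1%R]) ((sp_val S u w - g u w) ^+ 2)%:E)%E] =
    [set w | delta < \sum_(q < M) \sum_(j < K.+2)
      (c q j.+1 - c q j) * (ext_coef j w - v q w) ^+ 2].
  by apply/seteqP; split => w /=; rewrite integral_sp_val_grid lte_fin.
have -> : [set w | e < \sum_(q < M)
     (sp_integral S W (gt q.+1) w - sp_integral S W (gt q) w
      - v q w * (W (gt q.+1) w - W (gt q) w)) ^+ 2] =
    [set w | e < \sum_(q < M) (\sum_(j < K.+2)
      (ext_coef j w - v q w) * (W (c q j.+1) w - W (c q j) w)) ^+ 2].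
  have E w : \sum_(q < M)
     (sp_integral S W (gt q.+1) w - sp_integral S W (gt q) w
      - v q w * (W (gt q.+1) w - W (gt q) w)) ^+ 2 = \sum_(q < M) (\sum_(j < K.+2)
      (ext_coef j w - v q w) * (W (c q j.+1) w - W (c q j) w)) ^+ 2.
    by apply: eq_bigr => q _; rewrite sp_integral_grid.
  by apply/seteqP; split => w; rewrite /= E.
apply: (lenglart hF hW (c := c) (H := fun q j w => ext_coef j w - v q w)) => //.
- by rewrite clip_grid0 grid_ge0.
- by move=> q j _ _; apply: clip_le; exact: ext_timeS.
- by move=> q; rewrite clip_grid0 /clip ge_max grid_le//= ge_min lexx.
- move=> q j qM jK lt.
  have cge : gt q <= c q j by rewrite /clip le_max lexx.
  have c0 : 0 <= c q j by apply: le_trans cge; exact: grid_ge0.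
  apply: measurable_wrtB; first exact: filtration_sigma.
    case: j jK lt c0 {cge} => [|j] jK lt c0.
      exact: measurable_wrt_cst (filtration_sigma hF c0) 0.
    rewrite /ext_coef; case: ltnP => jK'; last first.
      exact: measurable_wrt_cst (filtration_sigma hF c0) 0.
    have [_ /(_ j jK')[_ hm _]] := hS.
    apply: measurable_wrt_sub (filtration_le hF _ _) hm; first exact/sp_time_ge0/ltnW.
    (* If [sp_time S j] were beyond [c q j], clipping would have moved it to the right end of the
       grid cell; the next point would be clipped there too and the cell would have length zero. *)
    have tE : ext_time j.+1 = sp_time S j by rewrite /= ltnW.
    rewrite -tE leNgt; apply/negP => h; move: lt; rewrite ltNge => /negP; apply.
    have h2 : gt q.+1 <= ext_time j.+1.
      rewrite leNgt; apply/negP => h3; move: h; rewrite ltNge => /negP; apply.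
      by rewrite /clip (min_r (ltW h3)) le_max lexx orbT.
    by rewrite /clip (min_l h2) (min_l (le_trans h2 (ext_timeS _))).
  by apply: measurable_wrt_sub (filtration_le hF (grid_ge0 q) cge) _; exact: hv.
Qed.

End simple_process.

Section ito_grid.
Context d (T : measurableType d) (R : realType) (P : probability T R)
  (F : R -> set (set T)) (W sigma I : R -> T -> R).
Hypotheses (hF : filtration F) (hW : brownian_motion P F W)
  (hsm : {ae P, forall w, measurable_fun `[0 : R, 1] (sigma ^~ w)})
  (hI : ito_integral P F W sigma I).
Local Notation mu := (@lebesgue_measure R).

Lemma integral_sqrB_le (D : set R) (f g h : R -> R) : measurable D ->
  measurable_fun D f -> measurable_fun D g -> measurable_fun D h ->
  (\int[mu]_(u in D) ((f u - h u) ^+ 2)%:E <=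
   2%:E * (\int[mu]_(u in D) ((f u - g u) ^+ 2)%:E) +
   2%:E * (\int[mu]_(u in D) ((g u - h u) ^+ 2)%:E))%E.
Proof.
move=> mD mf mg mh.
have m2 (a b : R -> R) : measurable_fun D a -> measurable_fun D b ->
    measurable_fun D (fun u => ((a u - b u) ^+ 2)%:E).
  by move=> ma mb; apply/measurable_EFinP; apply: measurable_funX; exact: measurable_funB.
rewrite -!ge0_integralZl//=; last 4 first.
- exact: m2.
- by move=> u _; rewrite lee_fin sqr_ge0.
- exact: m2.
- by move=> u _; rewrite lee_fin sqr_ge0.
rewrite -ge0_integralD//=; last 4 first.
- by move=> u _; rewrite -EFinM lee_fin mulr_ge0 ?sqr_ge0.
- by apply: measurable_funeM; exact: m2.
- by move=> u _; rewrite -EFinM lee_fin mulr_ge0 ?sqr_ge0.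
- by apply: measurable_funeM; exact: m2.
apply: ge0_le_integral => //=.
- by move=> u _; rewrite lee_fin sqr_ge0.
- exact: m2.
- by apply: emeasurable_funD; apply: measurable_funeM; exact: m2.
- move=> u _; rewrite -!EFinM -EFinD lee_fin.
  by have := sqr_ge0 ((f u - g u) - (g u - h u)); nra.
Qed.

Variables (M : nat) (v : nat -> T -> R).
Hypothesis M0 : (0 < M)%N.
Local Notation g := (sp_val (grid_process M v)).
Local Notation gt q := (q%:R / M%:R : R).
Hypothesis hv : forall q, (q < M)%N -> measurable_wrt (F (gt q)) (v q).

(** The integral [I] is accessible only as a limit, so Lenglart is applied to the simple integrals
    with [k] large for the given grid, and [k] then disappears from the bound. The factor 16 is 4 *
    4: passing from [I] to the simple integrals turns [e] into [e / 4], and passing from the simple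
    integrands to [sigma] turns [delta] into [4 * delta]. *)
Lemma ito_grid (e delta : R) : 0 < e -> 0 < delta ->
  (mu_ext P [set w | (e < \sum_(q < M)
     (I (gt q.+1) w - I (gt q) w - v q w * (W (gt q.+1) w - W (gt q) w)) ^+ 2)%R] <=
   mu_ext P [set w | delta%:E <
     \int[mu]_(u in `[0%R, 1%R]) ((g u w - sigma u w) ^+ 2)%:E]
   + (16 * normal_var R * delta / e)%:E)%E.
Proof.
move=> e0 d0; have [_ [S [hS /(_ 1 ltr01)[hs hsup]]]] := hI.
have M0' : 0 < M%:R :> R by rewrite ltr0n.
(* A uniform error [r] changes each of the [M] increments by at most 2r. Through (x + y)^2 <= 2 x^2
   + 2 y^2 this costs 8 r^2 per cell, that is [e / 2] altogether. *)
pose r : R := Num.sqrt (e / (16 * M%:R)).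
have r0 : 0 < r by rewrite sqrtr_gt0 divr_gt0// mulr_gt0.
have r2 : r ^+ 2 = e / (16 * M%:R).
  by rewrite sqr_sqrtr// divr_ge0 ?mulr_ge0// ltW.
apply/lee_addgt0Pr => eta eta0.
have h2 : (0 < eta / 2)%R by rewrite divr_gt0.
have [K1 HK1] := cvg0_in_probability_near hs d0 h2.
have [K2 HK2] := cvg0_in_probability_near hsup r0 h2.
pose k := maxn K1 K2; have k1 := HK1 k (leq_maxl _ _); have k2 := HK2 k (leq_maxr _ _).
have step1 : (mu_ext P [set w | (e < \sum_(q < M)
     (I (gt q.+1) w - I (gt q) w - v q w * (W (gt q.+1) w - W (gt q) w)) ^+ 2)%R] <=
   mu_ext P [set w | (e / 4 < \sum_(q < M)
     (sp_integral (S k) W (gt q.+1) w - sp_integral (S k) W (gt q) w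
      - v q w * (W (gt q.+1) w - W (gt q) w)) ^+ 2)%R] + (eta / 2)%:E)%E.
  apply: (outer_sub2 _ (lexx _) k2) => w /= hw.
  have [lt|ge] := ltP r%:E (ereal_sup [set `|sp_integral (S k) W u w - I u w|%:E |
        u in `[0%R, 1%R]])%E; first by right.
  left; rewrite ltNge; apply/negP => h4; move: hw; rewrite ltNge => /negP; apply.
  have hb q : (q <= M)%N -> `|sp_integral (S k) W (gt q) w - I (gt q) w| <= r.
    move=> qM; rewrite -lee_fin; apply: le_trans ge; apply: ereal_sup_ubound.
    exists (gt q) => //=; rewrite in_itv/= divr_ge0//=.
    by rewrite ler_pdivrMr// mul1r ler_nat.
  apply: (@le_trans _ _ (\sum_(q < M) (2 * (sp_integral (S k) W (gt q.+1) w -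
      sp_integral (S k) W (gt q) w - v q w * (W (gt q.+1) w - W (gt q) w)) ^+ 2 +
      8 * r ^+ 2))).
    apply: ler_sum => q _; have := hb q (ltnW (ltn_ord q)); have := hb q.+1 (ltn_ord q).
    set a := sp_integral _ _ _ _; set b := sp_integral _ _ _ _.
    set x := I _ _; set y := I _ _; set z := v q w * _.
    rewrite !ler_norml => /andP[p1 p2] /andP[p3 p4].
    have hd : ((x - y) - (a - b)) ^+ 2 <= 4 * r ^+ 2.
      have : 0 <= (2 * r - ((x - y) - (a - b))) * (2 * r + ((x - y) - (a - b))).
        by apply: mulr_ge0; lra.
      by nra.
    by have := sqr_ge0 (((x - y) - (a - b)) - (a - b - z)); nra.
  rewrite big_split/= -mulr_sumr sumr_const card_ord r2 -[8 * _ *+ M]mulr_natr.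
  have -> : 8 * (e / (16 * M%:R)) * M%:R = e / 2 by field; rewrite gt_eqF.
  by lra.
have step2 : (mu_ext P [set w | (e / 4 < \sum_(q < M)
     (sp_integral (S k) W (gt q.+1) w - sp_integral (S k) W (gt q) w
      - v q w * (W (gt q.+1) w - W (gt q) w)) ^+ 2)%R] <=
   mu_ext P [set w | (4 * delta)%:E <
     \int[mu]_(u in `[0%R, 1%R]) ((sp_val (S k) u w - g u w) ^+ 2)%:E]
   + (16 * normal_var R * delta / e)%:E)%E.
  have := lenglart_simple hF hW (hS k) M0 hv (e := e / 4) (delta := 4 * delta).
  have -> : normal_var R * (4 * delta) / (e / 4) = 16 * normal_var R * delta / e.
    by field; rewrite gt_eqF.
  by apply; lra.
have step3 : (mu_ext P [set w | (4 * delta)%:E <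
     \int[mu]_(u in `[0%R, 1%R]) ((sp_val (S k) u w - g u w) ^+ 2)%:E] <=
   (eta / 2)%:E + mu_ext P [set w | delta%:E <
     \int[mu]_(u in `[0%R, 1%R]) ((g u w - sigma u w) ^+ 2)%:E])%E.
  apply: le_trans (leeD k1 (lexx _)).
  apply: le_trans (outerU _ _ _).
  apply: (outer_ae hsm) => w ms; rewrite /setU /=.
  move=> h0; apply: contrapT => /not_orP[/negP h1 /negP h2'].
  move: h1 h2'; rewrite -!leNgt => h1 h2'; move: h0; rewrite ltNge => /negP; case.
  have msp (S' : simple_process T R) : measurable_fun `[0 : R, 1] (fun u => sp_val S' u w).
    by apply: measurable_funTS; exact: measurable_sp_val.
  apply: le_trans (integral_sqrB_le (g := sigma ^~ w) _ (msp _) ms (msp _)) _ => //.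
  rewrite [X in (_ + 2%:E * X)%E](_ : _ =
    \int[mu]_(u in `[0%R, 1%R]) ((g u w - sigma u w) ^+ 2)%:E)%E; last first.
    by apply: eq_integral => u _; congr (_%:E); ring.
  have -> : (4 * delta)%:E = (2%:E * delta%:E + 2%:E * delta%:E)%E.
    by rewrite -!EFinM -EFinD; congr (_%:E); ring.
  by apply: leeD; apply: lee_wpmul2l.
apply: le_trans step1 _; apply: le_trans (leeD step2 (lexx _)) _.
apply: le_trans (leeD (leeD step3 (lexx _)) (lexx _)) _.
have -> : eta%:E = ((eta / 2)%:E + (eta / 2)%:E)%E by rewrite -EFinD; congr (_%:E); lra.
by rewrite [((eta / 2)%:E + mu_ext _ _)%E]addeC -!addeA [X in (_ + X <= _)%E]addeCA.
Qed.

End ito_grid.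

(** * Ranges of sampled paths *)

(** Cauchy-Schwarz, read off from the nonnegativity of the empirical variance. *)
Lemma sqr_sum_le (R : realFieldType) (n : nat) (a : 'I_n -> R) :
  (\sum_(j < n) a j) ^+ 2 <= n%:R * \sum_(j < n) a j ^+ 2.
Proof.
case: n a => [|n] a; first by rewrite !big_ord0 expr0n mulr0.
set A := \sum_(j < n.+1) a j; set B := \sum_(j < n.+1) _.
have : 0 <= \sum_(j < n.+1) (n.+1%:R * a j - A) ^+ 2 by apply: sumr_ge0 => j _; exact: sqr_ge0.
have -> : \sum_(j < n.+1) (n.+1%:R * a j - A) ^+ 2 = n.+1%:R * (n.+1%:R * B - A ^+ 2).
  rewrite (eq_bigr (fun j => n.+1%:R ^+ 2 * a j ^+ 2 + - (2 * n.+1%:R * A) * a j + A ^+ 2)).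
    by rewrite !big_split/= -!mulr_sumr sumr_const card_ord -/A -/B -mulr_natl; ring.
  by move=> j _; ring.
by rewrite pmulr_rge0// subr_ge0.
Qed.

Section grid_range.
Context (R : realType) (m : nat).
Implicit Types y z : nat -> R.

Lemma grid_range_ge0 y : 0 <= grid_range m y.
Proof. exact: bigmax_ge_id. Qed.

Lemma grid_range_ub y s t : (s <= m)%N -> (t <= m)%N -> y t - y s <= grid_range m y.
Proof.
move=> sm tm; have sm' : (s < m.+1)%N by []; have tm' : (t < m.+1)%N by [].
apply: le_trans (le_bigmax 0 (fun s : 'I_m.+1 => \big[Num.max/0]_(t < m.+1) (y t - y s))
  (Ordinal sm')).
exact: (le_bigmax 0 (fun t : 'I_m.+1 => y t - y s) (Ordinal tm')).
Qed.

Lemma grid_range_le y (B : R) : 0 <= B ->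
  (forall s t, (s <= m)%N -> (t <= m)%N -> y t - y s <= B) -> grid_range m y <= B.
Proof.
move=> B0 yB; apply: bigmax_le => // s _; apply: bigmax_le => // t _.
by apply: yB; rewrite -ltnS ltn_ord.
Qed.

Lemma grid_range_abs y s t : (s <= m)%N -> (t <= m)%N -> `|y t - y s| <= grid_range m y.
Proof. by move=> sm tm; rewrite ler_norml lerNl opprB !grid_range_ub. Qed.

Lemma grid_range_dist y z (D : R) :
  (forall s t, (s <= m)%N -> (t <= m)%N -> `|(y t - y s) - (z t - z s)| <= D) ->
  `|grid_range m y - grid_range m z| <= D.
Proof.
move=> yzD.
have D0 : 0 <= D by apply: le_trans (yzD 0%N 0%N _ _).
have gz := grid_range_ge0 z; have gy := grid_range_ge0 y.
rewrite ler_distl; apply/andP; split.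
- rewrite lerBlDr; apply: grid_range_le => [|s t sm tm]; first exact: addr_ge0.
  have := yzD s t sm tm; rewrite ler_norml => /andP[h _].
  by have := grid_range_ub y sm tm; lra.
- apply: grid_range_le => [|s t sm tm]; first exact: addr_ge0.
  have := yzD s t sm tm; rewrite ler_norml => /andP[_ h].
  by have := grid_range_ub z sm tm; lra.
Qed.

Lemma eq_grid_range y z : (forall s t, (s <= m)%N -> (t <= m)%N -> y t - y s = z t - z s) ->
  grid_range m y = grid_range m z.
Proof.
move=> h; apply/eqP; rewrite -subr_eq0 -normr_le0; apply: grid_range_dist => s t sm tm.
by rewrite h// subrr normr0.
Qed.

(** A negative factor exchanges the two ends of the range, whence the absolute value. The upper
    bound applied to [c^-1] gives the reverse inequality. *)
Lemma grid_rangeZ (c : R) y : grid_range m (fun t => c * y t) = `|c| * grid_range m y.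
Proof.
have hle c' y' : grid_range m (fun t => c' * y' t) <= `|c'| * grid_range m y'.
  apply: grid_range_le => [|s t sm tm]; first by rewrite mulr_ge0// grid_range_ge0.
  rewrite -mulrBr (le_trans (ler_norm _))// normrM ler_wpM2l//.
  exact: grid_range_abs.
apply/eqP; rewrite eq_le hle/=.
have [->|c0] := eqVneq c 0; first by rewrite normr0 mul0r grid_range_ge0.
rewrite -ler_pdivlMl ?normr_gt0// -normfV.
have := hle c^-1 (fun t => c * y t).
by rewrite (_ : (fun t => c^-1 * (c * y t)) = y)//; apply/funext => t; rewrite mulKf.
Qed.

Lemma measurable_bigmax d (T : measurableType d) (I : Type) (s : seq I) (h : I -> T -> R) :
  (forall i, measurable_fun [set: T] (h i)) ->
  measurable_fun [set: T] (fun w => \big[Num.max/0]_(i <- s) h i w).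
Proof.
move=> mh; elim: s => [|a s ih].
  under [X in measurable_fun _ X]funext do rewrite big_nil.
  exact: measurable_cst.
under [X in measurable_fun _ X]funext do rewrite big_cons.
exact: measurable_maxr.
Qed.

Lemma measurable_grid_range d (T : measurableType d) (y : nat -> T -> R) :
  (forall t, (t <= m)%N -> measurable_fun [set: T] (y t)) ->
  measurable_fun [set: T] (fun w => grid_range m (fun t => y t w)).
Proof.
move=> my; apply: measurable_bigmax => s; apply: measurable_bigmax => t.
by apply: measurable_funB; apply: my; rewrite -ltnS ltn_ord.
Qed.

Definition cumsum (x : m.-tuple R) (t : nat) : R := \sum_(j < m) tnth x j *+ (j < t)%N.

(** Writing the range as a measurable function of the tuple of cell increments reduces every
    statement on its law to one on the law of that tuple. *)
Definition walk_range (x : m.-tuple R) : R := grid_range m (cumsum x).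

Lemma measurable_walk_range : measurable_fun [set: m.-tuple R] walk_range.
Proof.
apply: measurable_grid_range => t _; rewrite /cumsum.
apply: measurable_sum => j; case: (j < t)%N => //=; exact: measurable_tnth.
Qed.

Lemma walk_range_ge0 x : 0 <= walk_range x. Proof. exact: grid_range_ge0. Qed.

Lemma walk_range_sqr_le x : walk_range x ^+ 2 <= m%:R * \sum_(j < m) tnth x j ^+ 2.
Proof.
have h : walk_range x <= \sum_(j < m) `|tnth x j|.
  apply: grid_range_le => [|s t sm tm]; first exact: sumr_ge0.
  rewrite /cumsum -sumrB; apply: ler_sum => j _.
  case: (j < t)%N; case: (j < s)%N; rewrite ?subr0 ?subrr ?sub0r ?normr_ge0 ?ler_norm//=.
  by rewrite -normrN ler_norm.
apply: (@le_trans _ _ ((\sum_(j < m) `|tnth x j|) ^+ 2)).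
  by apply: lerXn2r h; rewrite nnegrE ?walk_range_ge0// sumr_ge0.
apply: le_trans (sqr_sum_le (fun j => `|tnth x j|)) _; rewrite ler_wpM2l//.
by apply: ler_sum => j _; rewrite real_normK// num_real.
Qed.

End grid_range.

Lemma sigma_algebra_setI d (T : measurableType d) (G : set (set T)) (A B : set T) :
  sigma_algebra [set: T] G -> G A -> G B -> G (A `&` B).
Proof.
move=> hG GA GB; have E : <<s G >> = G by exact: sigma_algebra_id.
have := @measurableI _ (g_sigma_algebraType G) A B.
by rewrite /measurable/= E; apply.
Qed.

Section brownian_windows.
Context d (T : measurableType d) (R : realType) (P : probability T R)
  (F : R -> set (set T)) (W : R -> T -> R) (m : nat).
Hypotheses (hF : filtration F) (hW : brownian_motion P F W) (m0 : (0 < m)%N).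
Local Notation nu := (normal_prob (0 : R) 1).

(* Time of the [q]-th observation when each of [n] windows has [m] cells. *)
Definition obs_time (n q : nat) : R := q%:R / (n * m)%:R.

Lemma obs_timeE n q : obs_time n q = q%:R / (n * m)%:R.
Proof. by []. Qed.

Lemma obs_time_ge0 n q : 0 <= obs_time n q.
Proof. by rewrite /obs_time divr_ge0. Qed.

Lemma obs_time_le n p q : (p <= q)%N -> obs_time n p <= obs_time n q.
Proof. by move=> pq; rewrite /obs_time ler_wpM2r ?invr_ge0// ler_nat. Qed.

Lemma obs_time_lt n q : (0 < n)%N -> obs_time n q < obs_time n q.+1.
Proof.
move=> n0; rewrite /obs_time ltr_pM2r ?ltr_nat// invr_gt0 ltr0n muln_gt0 n0//.
Qed.

Definition norm_incr (n q : nat) (w : T) : R :=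
  (W (obs_time n q.+1) w - W (obs_time n q) w) /
  Num.sqrt (obs_time n q.+1 - obs_time n q).

Definition window_incr (n i : nat) (w : T) : m.-tuple R :=
  [tuple norm_incr n (i * m + j)%N w | j < m].

Lemma norm_incr_wrt n q : measurable_wrt (F (obs_time n q.+1)) (norm_incr n q).
Proof.
apply: measurable_wrtM; first exact: (filtration_sigma hF (obs_time_ge0 n q.+1)).
  exact: (increment_wrt hF hW (obs_time_ge0 n q) (obs_time_le n (leqnSn q))).
exact: measurable_wrt_cst (filtration_sigma hF (obs_time_ge0 n q.+1)) _.
Qed.

Lemma measurable_norm_incr n q : measurable_fun [set: T] (norm_incr n q).
Proof.
apply: measurable_wrt_fun (norm_incr_wrt n q).
exact: (filtration_sub hF (obs_time_ge0 n q.+1)).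
Qed.

Lemma measurable_window_incr n i : measurable_fun [set: T] (window_incr n i).
Proof.
apply/measurable_fun_tnthP => j.
rewrite (_ : _ \o _ = norm_incr n (i * m + j)); first exact: measurable_norm_incr.
by apply/funext => w /=; rewrite tnth_mktuple.
Qed.

(** Conditions are imposed cell by cell, so that each new one concerns an increment independent of
    everything imposed before. *)
Fixpoint cells_set (n i : nat) (A : set T) (B : nat -> set R) (k : nat) : set T :=
  if k is k'.+1 then
    cells_set n i A B k' `&` norm_incr n (i * m + k') @^-1` B k'
  else A.

Lemma cells_set_wrt n i A B k : F (obs_time n (i * m)) A ->
  (forall j, measurable (B j)) -> F (obs_time n (i * m + k)) (cells_set n i A B k).
Proof.
move=> FA mB; elim: k => [|k ih] /=; first by rewrite addn0.
have le := filtration_le hF (obs_time_ge0 n (i * m + k))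
  (obs_time_le n (leqnSn (i * m + k))).
rewrite addnS; have sig := filtration_sigma hF (obs_time_ge0 n (i * m + k).+1).
apply: sigma_algebra_setI; first exact: sig.
- exact: le.
- exact: norm_incr_wrt.
Qed.

(** Each cell contributes a factor [nu (B k)] that depends neither on the mesh nor on the window;
    hence the comparison with window 0 for [n = 1], which serves as reference. *)
Lemma cells_set_prob n i A B k : (0 < n)%N -> F (obs_time n (i * m)) A ->
  (forall j, measurable (B j)) ->
  P (cells_set n i A B k) = (P A * P (cells_set 1 0 [set: T] B k))%E.
Proof.
move=> n0 FA mB; elim: k => [|k ih].
  by rewrite /= [P [set: T]]probability_setT mule1.
have h n' i' A' : (0 < n')%N -> F (obs_time n' (i' * m)) A' ->
    P (cells_set n' i' A' B k.+1) = (P (cells_set n' i' A' B k) * nu (B k))%E.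
  move=> n'0 FA'; rewrite /=.
  have := brownian_indep hW (obs_time_ge0 n' (i' * m + k)) (obs_time_lt (i' * m + k) n'0).
  by apply; [exact: cells_set_wrt|exact: mB].
have FT : F (obs_time 1 (0 * m)) [set: T].
  have [h0 hC _] := filtration_sigma hF (obs_time_ge0 1 (0 * m)).
  by have := hC _ h0; rewrite setD0.
rewrite (h n i A n0 FA) (h 1%N 0%N setT isT FT).
by rewrite ih muleA.
Qed.

Definition boxes : set (set (m.-tuple R)) :=
  [set D | exists B : nat -> set R, (forall k, measurable (B k)) /\
     D = [set x | forall j : 'I_m, B j (tnth x j)]].

Lemma measurable_boxes : boxes `<=` measurable.
Proof.
move=> D [B [mB ->]].
rewrite (_ : [set x | _] = \bigcap_(j in [set: 'I_m]) ((fun x => tnth x j) @^-1` B j)).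
  apply: fin_bigcap_measurable => // j _; rewrite -[X in measurable X]setTI.
  exact: (measurable_tnth j).
by apply/seteqP; split => x /= h j; [move=> _|]; exact: h.
Qed.

Lemma measurable_boxesE :
  (@measurable _ (m.-tuple R)) = <<s boxes >>.
Proof.
apply/seteqP; split; last first.
  by apply: smallest_sub => //; [exact: sigma_algebra_measurable|exact: measurable_boxes].
apply: smallest_sub; first exact: smallest_sigma_algebra.
move=> D; rewrite -bigcup_seq => -[i /= _ [B mB <-]].
apply: sub_sigma_algebra; exists (fun k : nat => if k == i :> nat then B else setT); split.
  by move=> k; case: eqP.
rewrite setTI; apply/seteqP; split => x /=.
  move=> h j; case: eqP => // ji.
  by have -> : j = i by exact: val_inj.
by move=> /(_ i); rewrite eqxx.
Qed.

(** Dynkin's lemma: the identity holds on the boxes, which are stable under intersection and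
    generate the product sigma-algebra. It expresses both independence from the past and
    stationarity of the window increments. *)
Lemma window_incr_law n i A D : (0 < n)%N -> F (obs_time n (i * m)) A ->
  measurable D ->
  P (A `&` window_incr n i @^-1` D) = (P A * P (window_incr 1 0 @^-1` D))%E.
Proof.
move=> n0 FA mD.
have mA : measurable A by apply: (filtration_sub hF (obs_time_ge0 n (i * m))).
have PAfin : P A \is a fin_num by exact: fin_num_measure.
have mpre n' i' D' : measurable D' -> measurable (window_incr n' i' @^-1` D').
  by move=> mD'; rewrite -[X in measurable X]setTI; exact: measurable_window_incr.
apply: (dynkin_induction (G := boxes)
  (P := fun D => P (A `&` window_incr n i @^-1` D) = (P A * P (window_incr 1 0 @^-1` D))%E)).
- exact: measurable_boxesE.
- move=> D1 D2 [B1 [mB1 ->]] [B2 [mB2 ->]].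
  exists (fun k => B1 k `&` B2 k); split; first by move=> k; exact: measurableI.
  apply/seteqP; split => x /=; first by move=> [h1 h2] j; split.
  by move=> h; split => j; have [] := h j.
- by rewrite !preimage_setT setIT [P [set: T]]probability_setT mule1.
- move=> _ [B [mB ->]]; have := cells_set_prob m n0 FA mB.
  have E n' i' A' : cells_set n' i' A' B m =
      A' `&` window_incr n' i' @^-1` [set x | forall j : 'I_m, B j (tnth x j)].
    have E' k : (k <= m)%N -> cells_set n' i' A' B k =
        A' `&` [set w | forall j, (j < k)%N -> B j (norm_incr n' (i' * m + j) w)].
      elim: k => [|k ih] km /=; first by apply/seteqP; split => w //= -[].
      rewrite ih ?(ltnW km)//; apply/seteqP; split => w /=.
        move=> [[Aw h1] h2]; split => // j; rewrite ltnS leq_eqVlt => /predU1P[->//|].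
        exact: h1.
      move=> [Aw h]; split; last exact: h.
      by split => // j jk; apply: h; exact: ltnW.
    rewrite E'//; congr (_ `&` _); apply/seteqP; split => w /= h.
      by move=> j; rewrite tnth_mktuple; exact: h.
    by move=> j jm; have := h (Ordinal jm); rewrite tnth_mktuple.
  by rewrite !E setTI.
- move=> S mS h; rewrite -!preimage_setC.
  have mw := mpre n i _ mS.
  have -> : A `&` ~` (window_incr n i @^-1` S) = A `\` (A `&` window_incr n i @^-1` S).
    by rewrite setDIr setDv set0U.
  rewrite measureD//; last 2 first.
    by apply: measurableI.
    by rewrite ltey_eq PAfin.
  transitivity (P A - P A * P (window_incr 1 0 @^-1` S))%E.
    by congr (_ - _)%E; rewrite setIA setIid; exact: h.
  transitivity (P A * (1 - P (window_incr 1 0 @^-1` S)))%E; last first.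
    by congr (_ * _)%E; apply/esym; exact: (probability_setC P (mpre 1%N 0%N _ mS)).
  by rewrite muleBr ?mule1// fin_num_adde_defl// fin_num_measure//; exact: mpre.
- move=> S mS tS h; rewrite !preimage_bigcup setI_bigcupr.
  have tP n' i' : trivIset setT (fun k => window_incr n' i' @^-1` S k).
    by move=> p q _ _ [w [h1 h2]]; apply: tS => //; exists (window_incr n' i' w).
  rewrite !measure_bigcup//; last 3 first.
  - by move=> k _; exact: mpre.
  - by move=> k _; apply: measurableI => //; exact: mpre.
  - exact: trivIset_setIl.
  transitivity (\sum_(0 <= k <oo | k \in [set: nat])
      (P A * P (window_incr 1 0 @^-1` S k)))%E; first by apply: eq_eseriesr => k _; exact: h.
  by rewrite -(fineK PAfin) nneseriesZl//.
- by rewrite -measurable_boxesE.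
Qed.

End brownian_windows.

(** * Moments of the Brownian range *)

Section range_moments.
Context d (T : measurableType d) (R : realType) (P : probability T R)
  (F : R -> set (set T)) (W : R -> T -> R) (m : nat).
Hypotheses (hF : filtration F) (hW : brownian_motion P F W) (m0 : (0 < m)%N).
Local Notation nu := (normal_prob (0 : R) 1).
Local Notation obs_time := (@obs_time R m).
Local Notation window_incr := (window_incr W m).

(* The range over window [i], rescaled to unit window length. *)
Definition norm_range (n i : nat) (w : T) : R :=
  walk_range (window_incr n i w) / Num.sqrt m%:R.

(** Brownian scaling: a cell has length 1 / (n m), so the standardised walk is the path multiplied
    by sqrt (n m), up to a constant that the range ignores. *)
Lemma norm_rangeE n i w : (0 < n)%N -> norm_range n i w =
  Num.sqrt n%:R * grid_range m (fun t => W (obs_time n (i * m + t)) w).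
Proof.
move=> n0; have m0' : 0 < m%:R :> R by rewrite ltr0n.
have n0' : 0 < n%:R :> R by rewrite ltr0n.
have nm0 : 0 < (n * m)%:R :> R by rewrite ltr0n muln_gt0 n0.
have dt q : obs_time n q.+1 - obs_time n q = (n * m)%:R^-1.
  by rewrite !obs_timeE -mulrBl -natrB// subSnn mul1r.
pose h := Num.sqrt (n * m)%:R^-1 : R.
have h0 : 0 < h by rewrite sqrtr_gt0 invr_gt0.
rewrite -[X in _ * X](@eq_grid_range _ _ (fun t => h * cumsum (window_incr n i w) t)).
  rewrite grid_rangeZ (gtr0_norm h0) /norm_range mulrA mulrC; congr (_ * _).
  rewrite -sqrtrV ?ler0n// -sqrtrM ?ler0n//; congr Num.sqrt.
  by rewrite natrM; field; rewrite !gt_eqF.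
have E t : (t <= m)%N -> h * cumsum (window_incr n i w) t =
    W (obs_time n (i * m + t)) w - W (obs_time n (i * m)) w.
  move=> tm; rewrite /cumsum mulr_sumr.
  rewrite -[X in W (obs_time n X) w - _ ]addnC.
  transitivity (\sum_(0 <= j < t) (W (obs_time n (i * m + j.+1)) w - W (obs_time n (i * m + j)) w)).
    rewrite big_mkord (big_ord_widen m (fun j => W (obs_time n (i * m + j.+1)) w -
      W (obs_time n (i * m + j)) w) tm) [RHS]big_mkcond; apply: eq_bigr => j _.
    rewrite tnth_mktuple /norm_incr dt -/h; case: ifP => _ /=; last by rewrite mulr0.
    by rewrite mulr1n -addnS; field; rewrite gt_eqF.
  by rewrite telescope_sumr// addn0 addnC.
move=> s t sm tm; rewrite !E//; ring.
Qed.

Lemma norm_range_ge0 n i w : 0 <= norm_range n i w.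
Proof. by rewrite divr_ge0// walk_range_ge0. Qed.

Lemma norm_range_wrt n i : (0 < n)%N ->
  measurable_wrt (F (obs_time n (i.+1 * m))) (norm_range n i).
Proof.
move=> n0; have sig := filtration_sigma hF (obs_time_ge0 R m n (i.+1 * m)).
rewrite (_ : norm_range n i = (fun w => Num.sqrt n%:R *
  grid_range m (fun t => W (obs_time n (i * m + t)) w))); last first.
  by apply/funext => w; exact: norm_rangeE.
apply: measurable_wrtM; [exact: sig|exact: measurable_wrt_cst|].
apply/(measurable_wrtP sig); apply: measurable_grid_range => t tm.
apply/(measurable_wrtP sig).
apply: measurable_wrt_sub (brownian_wrt hW (obs_time_ge0 R m n (i * m + t))).
apply: (filtration_le hF (obs_time_ge0 R m n _)); apply: obs_time_le.
by rewrite mulSn addnC leq_add2r.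
Qed.

Lemma norm_range_indep n i (X : T -> R) (h : R -> R) : (0 < n)%N ->
  measurable_fun [set: R] h -> L1 P (fun w => h (norm_range 1 0 w)) ->
  measurable_wrt (F (obs_time n (i * m))) X -> L1 P X ->
  L1 P (fun w => X w * h (norm_range n i w)) /\
  Ex P (fun w => X w * h (norm_range n i w)) =
    Ex P X * Ex P (fun w => h (norm_range 1 0 w)).
Proof.
move=> n0 mh ih hX iX.
have mZ n' i' := measurable_window_incr (m := m) hF hW n' i'.
pose Y : {RV P >-> (m.-tuple R)} :=
  HB.pack (window_incr 1 0) (isMeasurableFun.Build _ _ _ _ _ (mZ 1%N 0%N)).
pose f : m.-tuple R -> R := fun x => h (walk_range x / Num.sqrt m%:R).
have mf : measurable_fun [set: m.-tuple R] f.
  apply: (measurableT_comp mh).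
  by apply: measurable_funM => //; exact: measurable_walk_range.
have hind : indep_law P (distribution P Y) (F (obs_time n (i * m))) (window_incr n i).
  by move=> A B FA mB; apply: (window_incr_law hF hW m0 n0 FA mB).
have iY : P.-integrable [set: T] ((EFin \o f) \o Y) by exact: ih.
have if_ : L1 (distribution P Y) f.
  by apply: (integrable_pushforward (mZ 1%N 0%N)) => //; exact: measurable_EFin_fun.
have [i1 e1] := indep_lawM (filtration_sub hF (obs_time_ge0 R m n (i * m))) hind
  (mZ n i) hX iX if_.
split; first exact: i1.
rewrite e1; congr (_ * _); apply: EFin_inj; rewrite !ExE//.
by rewrite integral_distribution//; exact: measurable_EFin_fun.
Qed.

Lemma L2_norm_incr_sqr n q : (0 < n)%N -> L2 P (fun w => norm_incr W m n q w ^+ 2).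
Proof.
move=> n0; have q0 := obs_time_ge0 R m n q; have qS := obs_time_lt R m0 q n0.
have mX := measurable_norm_incr m hF hW n q.
have c1 := measurable_wrt_cst (filtration_sigma hF q0) (1 : R).
have [i1 _] := indep_lawM (filtration_sub hF q0) (brownian_indep hW q0 qS) mX c1
  (L1_cst P 1) (L2_normal_sqr R).2.
split; first exact: measurable_funX.
by move: i1; under [X in L1 _ X -> _]funext do rewrite mul1r.
Qed.

Lemma L2_norm_range_sqr : L2 P (fun w => norm_range 1 0 w ^+ 2).
Proof.
have mY : measurable_fun [set: T] (norm_range 1 0).
  apply: measurable_funM => //; apply: (measurableT_comp (@measurable_walk_range R m)).
  exact: (measurable_window_incr (m := m) hF hW).
split; first exact: measurable_funX.
have hs : L2 P (fun w => \sum_(j < m) norm_incr W m 1 j w ^+ 2).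
  by apply: L2_sum => j _; exact: L2_norm_incr_sqr.
apply: (L1_le _ hs.2); first by do 2 apply: measurable_funX.
move=> w; rewrite ger0_norm ?sqr_ge0//.
have s0 : 0 <= \sum_(j < m) norm_incr W m 1 j w ^+ 2 by apply: sumr_ge0 => j _; exact: sqr_ge0.
apply: lerXn2r; rewrite ?nnegrE ?sqr_ge0 ?s0//.
rewrite /norm_range expr_div_n sqr_sqrtr// ler_pdivrMr ?ltr0n// mulrC.
apply: le_trans (walk_range_sqr_le _) _; rewrite ler_wpM2l//.
by apply: ler_sum => j _; rewrite tnth_mktuple.
Qed.

(** A null expectation would force the range, hence its first cell increment, to vanish almost
    surely, while the normal law has no atom at 0. Both normalising constants of the estimators are
    nonzero for this reason. *)
Lemma Ex_norm_range_gt0 (h : R -> R) : measurable_fun [set: R] h ->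
  (forall x, 0 <= h x) -> (forall x, 0 < x -> 0 < h x) ->
  L1 P (fun w => h (norm_range 1 0 w)) -> 0 < Ex P (fun w => h (norm_range 1 0 w)).
Proof.
move=> mh h0 hpos ih; rewrite lt_neqAle Ex_ge0// andbT eq_sym; apply/eqP => E0.
have E : (\int[P]_w (h (norm_range 1 0 w))%:E = 0)%E by rewrite -ExE// E0.
have mhY := L1_meas ih.
have ae0 : {ae P, forall w, h (norm_range 1 0 w) = 0}.
  have E' : (\int[P]_w `|(h (norm_range 1 0 w))%:E| = 0)%E.
    by rewrite -[RHS]E; apply: eq_integral => w _; rewrite /= ger0_norm.
  have := (ae_eq_integral_abs P measurableT (measurable_EFin_fun mhY)).1 E'.
  by apply: filterS => w /(_ I) /= [].
have q0 := obs_time_ge0 R m 1 0; have qS := obs_time_lt R m0 0 (ltn0Sn 0).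
have FT : F (obs_time 1 0) [set: T].
  have [h0' hC _] := filtration_sigma hF q0.
  by have := hC _ h0'; rewrite setD0.
have := brownian_indep hW q0 qS FT (measurable_set1 (0 : measurableTypeR R)).
have -> : (nu : probability (measurableTypeR R) R) [set 0] = 0%E by exact: normal_prob_set1.
rewrite setTI mule0 => P0.
set D := (_ @^-1` _) in P0.
have mD : measurable D.
  have := measurable_norm_incr m hF hW 1 0 measurableT (measurable_set1 (0 : R)).
  by rewrite setTI.
have : (mu_ext P [set: T] <= mu_ext P D)%E.
  apply: (outer_ae ae0) => w hw _; rewrite /D /=.
  change (norm_incr W m 1 0 w = 0); apply: contrapT => /eqP x0.
  have : 0 < norm_range 1 0 w; last by move=> /hpos; rewrite hw ltxx.
  rewrite divr_gt0 ?sqrtr_gt0 ?ltr0n//.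
  apply: (@lt_le_trans _ _ `|norm_incr W m 1 0 w|); first by rewrite normr_gt0.
  apply: le_trans (grid_range_abs (cumsum (window_incr 1 0 w)) (leq0n m) m0).
  rewrite /cumsum [X in _ - X]big1 ?subr0//.
  by rewrite (bigD1 (Ordinal m0))//= big1 ?addr0 ?tnth_mktuple// => -[[|j] jm].
rewrite (outerE _ mD) outerE// [X in (_ <= X)%E]P0.
have -> : P [set: T] = 1%E by exact: probability_setT.
by rewrite lee_fin ler10.
Qed.

Lemma lambdaE (r : R) : lambda P W r m = Ex P (fun w => norm_range 1 0 w `^ r).
Proof.
rewrite /lambda /Ex /Rintegral unlock; congr fine; apply: eq_integral => w _.
rewrite norm_rangeE// sqrtr1 mul1r; congr ((grid_range _ _) `^ _)%:E.
by apply/funext => t; rewrite !obs_timeE mul0n add0n mul1n.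
Qed.

(** The bridge that turns inequalities on two-thirds powers into polynomial ones. *)
Lemma powR_third_cube (x : R) : 0 <= x -> (x `^ (2 / 3)) ^+ 3 = x ^+ 2.
Proof.
move=> x0; rewrite -[LHS]powR_mulrn ?powR_ge0// -powRrM -[RHS]powR_mulrn//.
by congr (_ `^ _); field.
Qed.

Lemma powR_third_sqr_le (x : R) : 0 <= x -> (x `^ (2 / 3)) ^+ 2 <= 1 + x ^+ 2.
Proof.
move=> x0; rewrite -(powR_third_cube x0); set y := _ `^ _.
have y0 : 0 <= y by exact: powR_ge0.
have [y1|y1] := leP y 1; first by have : 0 <= y ^+ 3 by [exact: exprn_ge0]; nra.
by rewrite exprS; have : 0 <= y ^+ 2 by [exact: sqr_ge0]; nra.
Qed.

Lemma L2_norm_range_powR : L2 P (fun w => norm_range 1 0 w `^ (2 / 3)).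
Proof.
have mY : measurable_fun [set: T] (norm_range 1 0).
  apply: measurable_funM => //; apply: (measurableT_comp (@measurable_walk_range R m)).
  exact: (measurable_window_incr (m := m) hF hW).
have mP : measurable_fun [set: T] (fun w => norm_range 1 0 w `^ (2 / 3)).
  exact: (measurableT_comp (measurable_powR (2 / 3))).
split => //; apply: (L1_le _ (L1D (L1_cst P 1) (L2_L1 L2_norm_range_sqr))).
  exact: measurable_funX.
by move=> w; rewrite ger0_norm ?sqr_ge0// powR_third_sqr_le// norm_range_ge0.
Qed.

Lemma lambda2E : lambda P W 2 m = Ex P (fun w => norm_range 1 0 w ^+ 2).
Proof.
rewrite lambdaE; congr Ex; apply/funext => w.
by rewrite -powR_mulrn ?norm_range_ge0.
Qed.

Lemma lambda2_gt0 : 0 < lambda P W 2 m.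
Proof.
rewrite lambda2E; apply: (Ex_norm_range_gt0 (h := fun x => x ^+ 2)).
- exact: exprn_measurable.
- by move=> x; exact: sqr_ge0.
- by move=> x x0; rewrite exprn_gt0.
- exact: L2_L1 L2_norm_range_sqr.
Qed.

Lemma lambda23_gt0 : 0 < lambda P W (2 / 3) m.
Proof.
rewrite lambdaE; apply: (Ex_norm_range_gt0 (h := fun x => x `^ (2 / 3))).
- exact: measurable_powR.
- by move=> x; exact: powR_ge0.
- by move=> x x0; rewrite powR_gt0.
- exact: L2_L1 L2_norm_range_powR.
Qed.

End range_moments.

(** * Laws of large numbers for ranges *)

Section law_of_large_numbers.
Context d (T : measurableType d) (R : realType) (P : probability T R)
  (F : R -> set (set T)) (W : R -> T -> R) (m : nat).
Hypotheses (hF : filtration F) (hW : brownian_motion P F W) (m0 : (0 < m)%N).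
Local Notation obs_time := (@obs_time R m).
Local Notation Y := (norm_range W m).

Lemma obs_sigma n i : sigma_algebra [set: T] (F (obs_time n i)).
Proof. exact: (filtration_sigma hF (obs_time_ge0 R m n i)). Qed.

Lemma obs_wrt_le n i j (X : T -> R) : (i <= j)%N ->
  measurable_wrt (F (obs_time n i)) X -> measurable_wrt (F (obs_time n j)) X.
Proof.
move=> ij; apply: measurable_wrt_sub.
exact: (filtration_le hF (obs_time_ge0 R m n i) (obs_time_le R m n ij)).
Qed.

Lemma obs_wrt_fun n i (X : T -> R) :
  measurable_wrt (F (obs_time n i)) X -> measurable_fun [set: T] X.
Proof. exact: (measurable_wrt_fun (filtration_sub hF (obs_time_ge0 R m n i))). Qed.

(* [Z i] depends on three windows starting with [i], and has mean [z] and second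
   moment [z2] given the past. *)
Lemma three_window_lln n N (a Z : nat -> T -> R) (C z z2 : R) : 0 <= C ->
  (forall i, measurable_wrt (F (obs_time n (i * m))) (a i)) ->
  (forall i w, `|a i w| <= C) ->
  (forall i, measurable_wrt (F (obs_time n ((i + 3) * m))) (Z i)) ->
  (forall i X, measurable_wrt (F (obs_time n (i * m))) X -> L1 P X ->
     L1 P (fun w => X w * Z i w) /\ Ex P (fun w => X w * Z i w) = Ex P X * z) ->
  (forall i, L1 P (fun w => Z i w ^+ 2) /\ Ex P (fun w => Z i w ^+ 2) = z2) ->
  Ex P (fun w => (\sum_(i < N) a i w * (Z i w - z)) ^+ 2) <= 5 * (C ^+ 2 * z2) * N%:R.
Proof.
move=> C0 ha aC hZ hXZ hZ2.
have mZ i := obs_wrt_fun (hZ i); have ma i := obs_wrt_fun (ha i).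
have LZ i : L2 P (Z i) by split; [exact: mZ|exact: (hZ2 i).1].
have EZ i : Ex P (Z i) = z.
  have := (hXZ i (fun=> 1) (measurable_wrt_cst (obs_sigma n (i * m)) 1) (L1_cst P 1)).2.
  by rewrite Ex_cst mul1r => <-; congr Ex; apply/funext => w; rewrite mul1r.
have LZz i : L2 P (fun w => Z i w - z) by apply: L2B (LZ i) (L2_cst P z).
have LU i : L2 P (fun w => a i w * (Z i w - z)) by apply: (L2Mb (C := C)).
have z20 : 0 <= z2 by have [_ <-] := hZ2 0%N; apply: Ex_ge0 => w; exact: sqr_ge0.
apply: (Ex_3orth_sum (U := fun i w => a i w * (Z i w - z))).
- by rewrite mulr_ge0// sqr_ge0.
- move=> i _; split; first exact: LU.
  apply: (@le_trans _ _ (Ex P (fun w => C ^+ 2 * (Z i w - z) ^+ 2))).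
    apply: le_Ex; [exact: (LU i).2|exact: L1Z (LZz i).2|move=> w].
    rewrite exprMn ler_wpM2r ?sqr_ge0// -real_normK ?num_real//.
    by apply: lerXn2r (aC i w); rewrite nnegrE.
  rewrite ExZ ?ler_wpM2l ?sqr_ge0//; last exact: (LZz i).2.
  rewrite (_ : (fun w => (Z i w - z) ^+ 2) =
    (fun w => (Z i w ^+ 2 - (2 * z) * Z i w) + z ^+ 2)); last by apply/funext => w; ring.
  have l1 := (hZ2 i).1; have l2 := L1Z (2 * z) (L2_L1 (LZ i)).
  rewrite ExD; [|exact: L1B l1 l2|exact: L1_cst].
  rewrite (ExB l1 l2) (ExZ _ (L2_L1 (LZ i))) Ex_cst EZ (hZ2 i).2.
  by have := sqr_ge0 z; nra.
(* As [i + 3 <= j], the factor [a i * (Z i - z) * a j] is known at the beginning of window [j],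
   where [Z j - z] has mean zero given the past. *)
- move=> i j ij _.
  have hUa : measurable_wrt (F (obs_time n (j * m))) (fun w => a i w * (Z i w - z) * a j w).
    apply: measurable_wrtM (ha j); first exact: obs_sigma.
    apply: measurable_wrtM; first exact: obs_sigma.
      by apply: obs_wrt_le (ha i); rewrite leq_mul2r; apply/orP; right; lia.
    apply: measurable_wrtB; first exact: obs_sigma.
      by apply: obs_wrt_le (hZ i); rewrite leq_mul2r; apply/orP; right; lia.
    exact: measurable_wrt_cst (obs_sigma _ _) _.
  have lUa : L1 P (fun w => a i w * (Z i w - z) * a j w).
    by apply: L2M (LU i) (L2_bounded P (ma j) (aC j)).
  have [l1 e1] := hXZ j _ hUa lUa.
  rewrite (_ : (fun w => _ * _) = (fun w => a i w * (Z i w - z) * a j w * Z j w -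
    z * (a i w * (Z i w - z) * a j w))); last by apply/funext => w; ring.
  by rewrite ExB// ?ExZ// ?e1; [ring|exact: L1Z].
Qed.

Lemma three_window_lln_outer n N (a Z : nat -> T -> R) (C z z2 e : R) : 0 <= C ->
  (forall i, measurable_wrt (F (obs_time n (i * m))) (a i)) ->
  (forall i w, `|a i w| <= C) ->
  (forall i, measurable_wrt (F (obs_time n ((i + 3) * m))) (Z i)) ->
  (forall i X, measurable_wrt (F (obs_time n (i * m))) X -> L1 P X ->
     L1 P (fun w => X w * Z i w) /\ Ex P (fun w => X w * Z i w) = Ex P X * z) ->
  (forall i, L1 P (fun w => Z i w ^+ 2) /\ Ex P (fun w => Z i w ^+ 2) = z2) ->
  0 < e -> (0 < n)%N -> (N <= n)%N ->
  (mu_ext P [set w | (e < `|n%:R^-1 * \sum_(i < N) a i w * (Z i w - z)|)%R] <=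
   (5 * (C ^+ 2 * z2) / e ^+ 2 / n%:R)%:E)%E.
Proof.
move=> C0 ha aC hZ hXZ hZ2 e0 n0 Nn.
have n0' : 0 < n%:R :> R by rewrite ltr0n.
have LZ i : L2 P (Z i) by split; [exact: obs_wrt_fun (hZ i)|exact: (hZ2 i).1].
have LU : L2 P (fun w => \sum_(i < N) a i w * (Z i w - z)).
  apply: L2_sum => i _; apply: (L2Mb (C := C)) (obs_wrt_fun (ha i)) (aC i).
  exact: L2B (LZ i) (L2_cst P z).
have z20 : 0 <= z2 by have [_ <-] := hZ2 0%N; apply: Ex_ge0 => w; exact: sqr_ge0.
set U := (fun w => \sum_(i < N) _) in LU *.
have -> : [set w | e < `|n%:R^-1 * U w|] = [set w | (e * n%:R) ^+ 2 < U w ^+ 2].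
  apply/seteqP; split => w /=; rewrite normrM gtr0_norm ?invr_gt0// ltr_pdivlMl//;
    rewrite -[U w ^+ 2]real_normK ?num_real// [e * _]mulrC;
    by rewrite ltr_pXn2r ?nnegrE// mulr_ge0// ltW.
have mS : measurable [set w | (e * n%:R) ^+ 2 < U w ^+ 2].
  rewrite -[X in measurable X]setTI; apply: measurable_fun_ltr => //.
  by apply: measurable_funX; exact: LU.1.
rewrite outerE//; apply: le_trans (Ex_markov _ LU.2 _) _.
- by rewrite exprn_gt0// mulr_gt0.
- by move=> w; exact: sqr_ge0.
have h := three_window_lln N C0 ha aC hZ hXZ hZ2.
rewrite lee_fin ler_pdivrMr ?exprn_gt0 ?mulr_gt0//; apply: le_trans h _.
rewrite (_ : _ / e ^+ 2 / n%:R * _ = 5 * (C ^+ 2 * z2) * n%:R); last first.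
  by field; rewrite !gt_eqF.
by rewrite ler_wpM2l ?ler_nat// !mulr_ge0// sqr_ge0.
Qed.

(** The windows are removed from the last to the first, each range being independent of the product
    of what precedes it. *)
Lemma norm_range_triple n i (q : R -> R) X : (0 < n)%N -> measurable_fun [set: R] q ->
  L1 P (fun w => q (Y 1 0 w)) ->
  measurable_wrt (F (obs_time n (i * m))) X -> L1 P X ->
  let Z w := q (Y n i w) * q (Y n i.+1 w) * q (Y n i.+2 w) in
  L1 P (fun w => X w * Z w) /\
  Ex P (fun w => X w * Z w) = Ex P X * Ex P (fun w => q (Y 1 0 w)) ^+ 3.
Proof.
move=> n0 mq iq hX iX /=.
have hq k : measurable_wrt (F (obs_time n (k.+1 * m))) (fun w => q (Y n k w)).
  exact: measurable_wrt_comp mq (norm_range_wrt hF hW m0 k n0).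
have [l1 e1] := norm_range_indep hF hW m0 n0 mq iq hX iX.
have h1 : measurable_wrt (F (obs_time n (i.+1 * m))) (fun w => X w * q (Y n i w)).
  apply: measurable_wrtM (hq i); first exact: obs_sigma.
  by apply: obs_wrt_le hX; rewrite leq_mul2r leqnSn orbT.
have [l2 e2] := norm_range_indep hF hW m0 n0 mq iq h1 l1.
have h2 : measurable_wrt (F (obs_time n (i.+2 * m)))
    (fun w => X w * q (Y n i w) * q (Y n i.+1 w)).
  apply: measurable_wrtM (hq i.+1); first exact: obs_sigma.
  by apply: obs_wrt_le h1; rewrite leq_mul2r leqnSn orbT.
have [l3 e3] := norm_range_indep hF hW m0 n0 mq iq h2 l2.
rewrite (_ : (fun w => X w * (q (Y n i w) * q (Y n i.+1 w) * q (Y n i.+2 w))) =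
  (fun w => X w * q (Y n i w) * q (Y n i.+1 w) * q (Y n i.+2 w))); last first.
  by apply/funext => w; ring.
split; first exact: l3.
by rewrite e3 e2 e1; ring.
Qed.

Variables (C : R) (C0 : 0 <= C).

Lemma range_sqr_lln n (v : nat -> T -> R) (e : R) :
  (forall i, measurable_wrt (F (obs_time n (i * m))) (v i)) ->
  (forall i w, `|v i w| <= C) -> 0 < e -> (0 < n)%N ->
  (mu_ext P [set w | (e < `|n%:R^-1 * \sum_(i < n)
      v i w ^+ 2 * (Y n i w ^+ 2 - lambda P W 2 m)|)%R] <=
   (5 * ((C ^+ 2) ^+ 2 * Ex P (fun w => (Y 1 0 w ^+ 2) ^+ 2)) / e ^+ 2 / n%:R)%:E)%E.
Proof.
move=> hv vC e0 n0.
apply: (three_window_lln_outer (a := fun i w => v i w ^+ 2) (Z := fun i w => Y n i w ^+ 2)).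
- exact: sqr_ge0.
- by move=> i; apply: (measurable_wrt_comp (f := fun x => x ^+ 2)) (hv i);
    exact: exprn_measurable.
- move=> i w; rewrite normrX; apply: lerXn2r (vC i w); rewrite nnegrE//.
- move=> i; apply: (measurable_wrt_comp (f := fun x => x ^+ 2)); first exact: exprn_measurable.
  apply: obs_wrt_le (norm_range_wrt hF hW m0 i n0).
  by rewrite leq_mul2r; apply/orP; right; lia.
- move=> i X hX iX; rewrite lambda2E//.
  apply: (norm_range_indep hF hW m0 n0 (h := fun x => x ^+ 2)) hX iX.
    exact: exprn_measurable.
  exact: L2_L1 (L2_norm_range_sqr hF hW m0).
- move=> i; have mh : measurable_fun [set: R] (fun x : R => (x ^+ 2) ^+ 2).
    by apply: measurable_funX; exact: exprn_measurable.
  have := norm_range_indep hF hW m0 n0 mh (L2_norm_range_sqr hF hW m0).2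
    (measurable_wrt_cst (obs_sigma n (i * m)) 1) (L1_cst P 1).
  rewrite Ex_cst mul1r.
  by rewrite (_ : (fun w => 1 * _) = (fun w => (Y n i w ^+ 2) ^+ 2))//; apply/funext => w; rewrite mul1r.
- exact: e0.
- exact: n0.
- exact: leqnn.
Qed.

Lemma range_powR_lln n (v : nat -> T -> R) (e : R) :
  (forall i, measurable_wrt (F (obs_time n (i * m))) (v i)) ->
  (forall i w, `|v i w| <= C) -> 0 < e -> (0 < n)%N ->
  (mu_ext P [set w | (e < `|n%:R^-1 * \sum_(i < n - 2)
      v i w ^+ 2 * (Y n i w `^ (2 / 3) * Y n i.+1 w `^ (2 / 3) * Y n i.+2 w `^ (2 / 3)
       - lambda P W (2 / 3) m ^+ 3)|)%R] <=
   (5 * ((C ^+ 2) ^+ 2 * Ex P (fun w => (Y 1 0 w `^ (2 / 3)) ^+ 2) ^+ 3) / e ^+ 2 / n%:R)%:E)%E.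
Proof.
move=> hv vC e0 n0.
have mp : measurable_fun [set: R] (fun x : R => x `^ (2 / 3)) by exact: measurable_powR.
have LY := L2_norm_range_powR hF hW m0.
have hq n' k : (0 < n')%N -> measurable_wrt (F (obs_time n' (k.+1 * m))) (fun w => Y n' k w `^ (2 / 3)).
  by move=> n'0; exact: measurable_wrt_comp mp (norm_range_wrt hF hW m0 k n'0).
apply: (three_window_lln_outer (a := fun i w => v i w ^+ 2)
  (Z := fun i w => Y n i w `^ (2 / 3) * Y n i.+1 w `^ (2 / 3) * Y n i.+2 w `^ (2 / 3))).
- exact: sqr_ge0.
- by move=> i; apply: (measurable_wrt_comp (f := fun x => x ^+ 2)) (hv i);
    exact: exprn_measurable.
- move=> i w; rewrite normrX; apply: lerXn2r (vC i w); rewrite nnegrE//.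
- move=> i; apply: measurable_wrtM; [exact: obs_sigma|apply: measurable_wrtM; first exact: obs_sigma|].
  + by apply: obs_wrt_le (hq n i n0); rewrite leq_mul2r; apply/orP; right; lia.
  + by apply: obs_wrt_le (hq n i.+1 n0); rewrite leq_mul2r; apply/orP; right; lia.
  + by apply: obs_wrt_le (hq n i.+2 n0); rewrite leq_mul2r; apply/orP; right; lia.
- move=> i X hX iX; rewrite lambdaE//.
  exact: (norm_range_triple (q := fun x => x `^ (2 / 3)) n0 mp (L2_L1 LY) hX iX).
(* The second moment of the triple product is again a triple product, for the square of the power
   function. *)
- move=> i; have mh : measurable_fun [set: R] (fun x : R => (x `^ (2 / 3)) ^+ 2).
    by apply: measurable_funX.
  have := norm_range_triple n0 mh LY.2 (measurable_wrt_cst (obs_sigma n (i * m)) 1) (L1_cst P 1).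
  rewrite /= Ex_cst mul1r.
  move: (Y n i) (Y n i.+1) (Y n i.+2) => Y1 Y2 Y3.
  have -> : (fun w => 1 * (Y1 w `^ (2 / 3) ^+ 2 * Y2 w `^ (2 / 3) ^+ 2 * Y3 w `^ (2 / 3) ^+ 2)) =
      (fun w => (Y1 w `^ (2 / 3) * Y2 w `^ (2 / 3) * Y3 w `^ (2 / 3)) ^+ 2).
    by apply/funext => w; rewrite mul1r !exprMn.
  by [].
- exact: e0.
- exact: n0.
- by rewrite leq_subr.
Qed.

End law_of_large_numbers.

(** * Deterministic inequalities for ranges and their two-thirds powers *)

Section range_inequalities.
Context (R : realType).

(** Young's inequality: the slack is the square [eta * (|b| - t / eta)^2]. The small factor [eta]
    falls on [b^2], which need not be small, and the large one on the error. *)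
Lemma sqr_dist_le (a b t eta : R) : 0 < eta -> `|a - b| <= t ->
  `|a ^+ 2 - b ^+ 2| <= eta * b ^+ 2 + (1 + eta^-1) * t ^+ 2.
Proof.
move=> eta0 abt; rewrite subr_sqr normrM; apply: (@le_trans _ _ (t * (t + 2 * `|b|))).
  apply: ler_pM => //; rewrite (_ : a + b = (a - b) + 2 * b); last by ring.
  by apply: le_trans (ler_normD _ _) _; rewrite normrM normr_nat lerD2r.
rewrite -(real_normK (num_real b)) -subr_ge0.
have -> : eta * `|b| ^+ 2 + (1 + eta^-1) * t ^+ 2 - t * (t + 2 * `|b|) =
  eta * (`|b| - t / eta) ^+ 2 by field; rewrite gt_eqF.
by rewrite mulr_ge0 ?sqr_ge0// ltW.
Qed.

(** Subadditivity of the power 2/3. With A, B, D the powers of a, b, t, it amounts to (b + t)^2 <=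
    (B + D)^3, that is 2 b t <= 3 B D (B + D); squaring, 4 (B D)^3 <= 9 (B D)^2 (B + D)^2. *)
Lemma powR_third_dist_le (x y t : R) : 0 <= x -> 0 <= y -> `|x - y| <= t ->
  `|x `^ (2 / 3) - y `^ (2 / 3)| <= t `^ (2 / 3).
Proof.
move=> x0 y0 xyt; have t0 : 0 <= t by exact: le_trans xyt.
have key (a b : R) : 0 <= a -> 0 <= b -> a <= b + t -> a `^ (2 / 3) <= b `^ (2 / 3) + t `^ (2 / 3).
  move=> a0 b0 abt.
  have a3 := powR_third_cube a0; have b3 := powR_third_cube b0; have t3 := powR_third_cube t0.
  have pa := powR_ge0 a (2 / 3); have pb := powR_ge0 b (2 / 3); have pt := powR_ge0 t (2 / 3).
  move: (a `^ _) (b `^ _) (t `^ _) a3 b3 t3 pa pb pt => A B D a3 b3 t3 pa pb pt.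
  rewrite -(ler_pXn2r (n := 3)) ?nnegrE ?addr_ge0// a3.
  have bt : 2 * (b * t) <= 3 * (B * D) * (B + D).
    have BD : 0 <= B * D by exact: mulr_ge0.
    rewrite -(ler_pXn2r (n := 2)) ?nnegrE ?mulr_ge0 ?addr_ge0//.
    have -> : (2 * (b * t)) ^+ 2 = 4 * (B * D) ^+ 3.
      by rewrite exprMn [(b * t) ^+ 2]exprMn -b3 -t3; ring.
    have -> : (3 * (B * D) * (B + D)) ^+ 2 = 9 * (B * D) ^+ 2 * (B + D) ^+ 2 by ring.
    have : 0 <= (B * D) ^+ 2 * (B ^+ 2 + D ^+ 2) by rewrite mulr_ge0 ?sqr_ge0// addr_ge0// sqr_ge0.
    have : 0 <= (B * D) ^+ 3 by exact: exprn_ge0.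
    have -> : 9 * (B * D) ^+ 2 * (B + D) ^+ 2 = 9 * ((B * D) ^+ 2 * (B ^+ 2 + D ^+ 2)) +
      18 * (B * D) ^+ 3 by ring.
    by move: ((B * D) ^+ 3) ((B * D) ^+ 2 * _) => *; lra.
  have ab2 : a ^+ 2 <= (b + t) ^+ 2 by apply: lerXn2r; rewrite ?nnegrE ?addr_ge0.
  have -> : (B + D) ^+ 3 = B ^+ 3 + D ^+ 3 + 3 * (B * D) * (B + D) by ring.
  apply: le_trans ab2 _; rewrite b3 t3.
  have -> : (b + t) ^+ 2 = b ^+ 2 + t ^+ 2 + 2 * (b * t) by ring.
  by rewrite lerD2l.
move: xyt; rewrite ler_distl => /andP[h1 h2]; rewrite ler_distl.
by rewrite lerBlDr !key//; lra.
Qed.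

Lemma amgm3 (u v w : R) : 0 <= u -> 0 <= v -> 0 <= w -> 3 * (u * v * w) <= u ^+ 3 + v ^+ 3 + w ^+ 3.
Proof.
move=> u0 v0 w0; rewrite -subr_ge0.
have -> : u ^+ 3 + v ^+ 3 + w ^+ 3 - 3 * (u * v * w) =
  (u + v + w) * ((u - v) ^+ 2 + (v - w) ^+ 2 + (w - u) ^+ 2) / 2 by field.
by rewrite divr_ge0// mulr_ge0// !addr_ge0// sqr_ge0.
Qed.

(** AM-GM with weights k^-2, k, k, whose product is 1. For [k] small, the large weight falls on [x],
    which will be the small error, and the small weight on the two other factors. *)
Lemma weighted_amgm3 (k x y z : R) : 0 < k -> 0 <= x -> 0 <= y -> 0 <= z ->
  x `^ (2 / 3) * y `^ (2 / 3) * z `^ (2 / 3) <= k^-1 ^+ 6 * x ^+ 2 + k ^+ 3 * (y ^+ 2 + z ^+ 2).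
Proof.
move=> k0 x0 y0 z0.
have x3 := powR_third_cube x0; have y3 := powR_third_cube y0; have z3 := powR_third_cube z0.
have px := powR_ge0 x (2 / 3); have py := powR_ge0 y (2 / 3); have pz := powR_ge0 z (2 / 3).
move: (x `^ _) (y `^ _) (z `^ _) x3 y3 z3 px py pz => A B D <- <- <- A0 B0 D0.
have k0' : 0 <= k^-1 by rewrite invr_ge0 ltW.
have := amgm3 (u := k^-1 ^+ 2 * A) (v := k * B) (w := k * D).
have -> : 3 * (k^-1 ^+ 2 * A * (k * B) * (k * D)) = 3 * (A * B * D) by field; rewrite gt_eqF.
have -> : (k^-1 ^+ 2 * A) ^+ 3 + (k * B) ^+ 3 + (k * D) ^+ 3 =
   k^-1 ^+ 6 * A ^+ 3 + k ^+ 3 * (B ^+ 3 + D ^+ 3) by ring.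
have k6 : 0 <= k^-1 ^+ 6 * A ^+ 3 by rewrite mulr_ge0// exprn_ge0.
have k3 : 0 <= k ^+ 3 * (B ^+ 3 + D ^+ 3) by rewrite mulr_ge0 ?addr_ge0// exprn_ge0// ltW.
move=> /(_ (mulr_ge0 (exprn_ge0 _ k0') A0) (mulr_ge0 (ltW k0) B0) (mulr_ge0 (ltW k0) D0)).
by move: (A * B * D) (k^-1 ^+ 6 * _) (k ^+ 3 * _) k6 k3 => *; lra.
Qed.

(** Replacing one factor at a time leaves three products, each with exactly one error factor. Only
    [a3] and [b1] occur in two of them, whence the constant 2. *)
Lemma powR_triple_dist_le (k a1 a2 a3 b1 b2 b3 t1 t2 t3 : R) : 0 < k ->
  0 <= a1 -> 0 <= a2 -> 0 <= a3 -> 0 <= b1 -> 0 <= b2 -> 0 <= b3 ->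
  `|a1 - b1| <= t1 -> `|a2 - b2| <= t2 -> `|a3 - b3| <= t3 ->
  `|a1 `^ (2 / 3) * a2 `^ (2 / 3) * a3 `^ (2 / 3) - b1 `^ (2 / 3) * b2 `^ (2 / 3) * b3 `^ (2 / 3)| <=
  k^-1 ^+ 6 * (t1 ^+ 2 + t2 ^+ 2 + t3 ^+ 2) +
  2 * k ^+ 3 * (a1 ^+ 2 + a2 ^+ 2 + a3 ^+ 2 + b1 ^+ 2 + b2 ^+ 2 + b3 ^+ 2).
Proof.
move=> k0 a10 a20 a30 b10 b20 b30 h1 h2 h3.
have t10 : 0 <= t1 by exact: le_trans h1.
have t20 : 0 <= t2 by exact: le_trans h2.
have t30 : 0 <= t3 by exact: le_trans h3.
have w1 := weighted_amgm3 k0 t10 a20 a30.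
have w2 := weighted_amgm3 k0 t20 b10 a30.
have w3 := weighted_amgm3 k0 t30 b10 b20.
have p1 := powR_third_dist_le a10 b10 h1.
have p2 := powR_third_dist_le a20 b20 h2.
have p3 := powR_third_dist_le a30 b30 h3.
set A1 := a1 `^ _ in p1 *; set A2 := a2 `^ _ in w1 p2 *; set A3 := a3 `^ _ in w1 w2 p3 *.
set B1 := b1 `^ _ in w2 w3 p1 *; set B2 := b2 `^ _ in w3 p2 *; set B3 := b3 `^ _ in p3 *.
have -> : A1 * A2 * A3 - B1 * B2 * B3 =
  (A1 - B1) * (A2 * A3) + (A2 - B2) * (B1 * A3) + (A3 - B3) * (B1 * B2) by ring.
have k3 : 0 <= k ^+ 3 by rewrite exprn_ge0// ltW.
have q1 : `|(A1 - B1) * (A2 * A3)| <= t1 `^ (2 / 3) * A2 * A3.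
  by rewrite normrM -mulrA (ger0_norm (x := A2 * A3)) ?mulr_ge0 ?powR_ge0// ler_wpM2r// mulr_ge0 ?powR_ge0.
have q2 : `|(A2 - B2) * (B1 * A3)| <= t2 `^ (2 / 3) * B1 * A3.
  by rewrite normrM -mulrA (ger0_norm (x := B1 * A3)) ?mulr_ge0 ?powR_ge0// ler_wpM2r// mulr_ge0 ?powR_ge0.
have q3 : `|(A3 - B3) * (B1 * B2)| <= t3 `^ (2 / 3) * B1 * B2.
  by rewrite normrM -mulrA (ger0_norm (x := B1 * B2)) ?mulr_ge0 ?powR_ge0// ler_wpM2r// mulr_ge0 ?powR_ge0.
apply: le_trans (ler_normD _ _) _; apply: le_trans (lerD (ler_normD _ _) (lexx _)) _.
have := mulr_ge0 k3 (sqr_ge0 a1); have := mulr_ge0 k3 (sqr_ge0 a2); have := mulr_ge0 k3 (sqr_ge0 b1).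
have := mulr_ge0 k3 (sqr_ge0 b3); have := mulr_ge0 k3 (sqr_ge0 b2); have := mulr_ge0 k3 (sqr_ge0 a3).
rewrite -!(mulrA 2) !mulrDr; rewrite !mulrDr in w1 w2 w3.
move: (k ^+ 3 * _) (k ^+ 3 * _) (k ^+ 3 * _) (k ^+ 3 * _) (k ^+ 3 * _) (k ^+ 3 * _) w1 w2 w3.
move: (k^-1 ^+ 6 * _) (k^-1 ^+ 6 * _) (k^-1 ^+ 6 * _).
by move=> *; lra.
Qed.

Lemma grid_range_cells (m : nat) (y z : nat -> R) (v : R) :
  `|grid_range m y - `|v| * grid_range m z| <=
  \sum_(t < m) `|(y t.+1 - y t) - v * (z t.+1 - z t)|.
Proof.
rewrite -grid_rangeZ; apply: grid_range_dist => s t sm tm.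
pose x i := y i - v * z i.
have -> : y t - y s - (v * z t - v * z s) = x t - x s by rewrite /x; ring.
have key i j : (i <= j)%N -> (j <= m)%N -> `|x j - x i| <= \sum_(t < m) `|x t.+1 - x t|.
  move=> ij jm; rewrite -(telescope_sumr x ij); apply: le_trans (ler_norm_sum _ _ _) _.
  rewrite -(big_mkord predT (fun t => `|x t.+1 - x t|)).
  rewrite [leRHS](big_cat_nat (n := i))//=; last exact: leq_trans ij jm.
  rewrite [X in _ <= _ + X](big_cat_nat (n := j))//=.
  by rewrite addrCA lerDl addr_ge0// sumr_ge0.
have -> : \sum_(t0 < m) `|y t0.+1 - y t0 - v * (z t0.+1 - z t0)| = \sum_(t < m) `|x t.+1 - x t|.
  by apply: eq_bigr => i _; congr `|_|; rewrite /x; ring.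
by have [st|/ltnW ts] := leqP s t; [|rewrite distrC]; exact: key.
Qed.

Lemma sum_windows (n m : nat) (f : nat -> R) :
  \sum_(q < n * m) f q = \sum_(i < n) \sum_(t < m) f (i * m + t)%N.
Proof.
elim: n => [|n ih]; first by rewrite mul0n !big_ord0.
by rewrite big_ord_recr/= -ih mulSnr big_split_ord.
Qed.

End range_inequalities.

(** * Stability of the range sums *)

Section window_sums.
Context (R : realType) (m n : nat) (c z V : nat -> R).
Hypothesis m0 : (0 < m)%N.

Definition win_range (y : nat -> R) (i : nat) : R := grid_range m (fun t => y (i * m + t)%N).

(** The lag [j] is the position of the window within a triple: the cells of a window use the
    coefficient frozen [j] windows earlier. For the first windows the subtraction of naturals stops
    at 0. *)
Definition cell_error (j : nat) : R :=
  \sum_(q < n * m) ((c q.+1 - c q) - V (q %/ m - j) * (z q.+1 - z q)) ^+ 2.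

Local Notation a := (win_range c).
Local Notation s := (win_range z).
Local Notation D j i := (\sum_(t < m)
  `|(c (i * m + t).+1 - c (i * m + t)%N) - V (i - j)%N * (z (i * m + t).+1 - z (i * m + t)%N)|).

Lemma win_range_ge0 y i : 0 <= win_range y i.
Proof. exact: grid_range_ge0. Qed.

Lemma win_range_dist j i : `|a i - `|V (i - j)%N| * s i| <= D j i.
Proof.
have := grid_range_cells m (fun t => c (i * m + t)%N) (fun t => z (i * m + t)%N) (V (i - j)%N).
by under [X in _ <= X]eq_bigr do rewrite !addnS.
Qed.

Lemma win_dist_sum j : \sum_(i < n) D j i ^+ 2 <= m%:R * cell_error j.
Proof.
rewrite /cell_error (sum_windows n m (fun q => ((c q.+1 - c q) - V (q %/ m - j) * (z q.+1 - z q)) ^+ 2)).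
rewrite mulr_sumr; apply: ler_sum => i _; apply: le_trans (sqr_sum_le _) _.
rewrite ler_wpM2l//; apply: ler_sum => t _; rewrite real_normK ?num_real//.
by rewrite divnMDl// (divn_small (ltn_ord t)) addn0.
Qed.

Lemma ler_sum_shift (f : nat -> R) j : (forall i, 0 <= f i) -> (j <= 2)%N ->
  \sum_(i < n - 2) f (i + j)%N <= \sum_(i < n) f i.
Proof.
move=> f0 j2; have [n2|n2] := leqP 2 n; last first.
  by rewrite (_ : (n - 2)%N = 0%N) ?big_ord0; [exact: sumr_ge0|lia].
apply: (@le_trans _ _ (\sum_(i < j + (n - 2)) f i)); last by apply: ler_sum_ord => //; lia.
rewrite big_split_ord/= [leRHS]addrC -[leLHS]addr0 lerD ?sumr_ge0//.
by apply: ler_sum => i _; rewrite addnC.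
Qed.

Lemma sqr_range_sum_dist (eta : R) : 0 < eta ->
  `|\sum_(i < n) a i ^+ 2 - \sum_(i < n) V i ^+ 2 * s i ^+ 2| <=
  eta * \sum_(i < n) V i ^+ 2 * s i ^+ 2 + (1 + eta^-1) * (m%:R * cell_error 0).
Proof.
move=> eta0; rewrite -sumrB; apply: le_trans (ler_norm_sum _ _ _) _.
apply: (@le_trans _ _ (\sum_(i < n) (eta * (V i ^+ 2 * s i ^+ 2) + (1 + eta^-1) * D 0 i ^+ 2))).
  apply: ler_sum => i _.
  have -> : V i ^+ 2 * s i ^+ 2 = (`|V i| * s i) ^+ 2 by rewrite exprMn real_normK ?num_real.
  apply: sqr_dist_le => //.
  by have := win_range_dist 0 i; rewrite subn0.
rewrite big_split/= -!mulr_sumr lerD2l ler_wpM2l//; last exact: win_dist_sum.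
by rewrite addr_ge0// invr_ge0 ltW.
Qed.

Lemma powR_range_sum_dist (k : R) : 0 < k ->
  `|\sum_(i < n - 2) a i `^ (2 / 3) * a i.+1 `^ (2 / 3) * a i.+2 `^ (2 / 3) -
    \sum_(i < n - 2) V i ^+ 2 * (s i `^ (2 / 3) * s i.+1 `^ (2 / 3) * s i.+2 `^ (2 / 3))| <=
  (k^-1 ^+ 6 + 4 * k ^+ 3) * (m%:R * (cell_error 0 + cell_error 1 + cell_error 2)) +
  18 * k ^+ 3 * \sum_(i < n) a i ^+ 2.
Proof.
move=> k0; rewrite -sumrB; apply: le_trans (ler_norm_sum _ _ _) _.
pose G i := (k^-1 ^+ 6 + 4 * k ^+ 3) * (D 0 i ^+ 2 + D 1 (i + 1)%N ^+ 2 + D 2 (i + 2)%N ^+ 2) +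
  6 * k ^+ 3 * (a (i + 0)%N ^+ 2 + a (i + 1)%N ^+ 2 + a (i + 2)%N ^+ 2).
have k3 : 0 <= k ^+ 3 by rewrite exprn_ge0// ltW.
have k6 : 0 <= k^-1 ^+ 6 by rewrite exprn_ge0// invr_ge0 ltW.
apply: (@le_trans _ _ (\sum_(i < n - 2) G i)).
  apply: ler_sum => -[i /= _] _.
  have d0 := win_range_dist 0 i; have d1 := win_range_dist 1 (i + 1)%N.
  have d2 := win_range_dist 2 (i + 2)%N; rewrite !addnK subn0 in d0 d1 d2.
  have sg := win_range_ge0 z.
  have b0 x : 0 <= `|V i| * s x by rewrite mulr_ge0.
  have -> : V i ^+ 2 * (s i `^ (2 / 3) * s i.+1 `^ (2 / 3) * s i.+2 `^ (2 / 3)) =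
     (`|V i| * s i) `^ (2 / 3) * (`|V i| * s (i + 1)%N) `^ (2 / 3) * (`|V i| * s (i + 2)%N) `^ (2 / 3).
    rewrite addn1 addn2 !powRM//.
    have -> : V i ^+ 2 = (`|V i| `^ (2 / 3)) ^+ 3 by rewrite powR_third_cube// real_normK ?num_real.
    by move: (_ `^ _) (_ `^ _) (_ `^ _) (_ `^ _) => *; ring.
  have := powR_triple_dist_le k0 (win_range_ge0 c i) (win_range_ge0 c (i + 1))
    (win_range_ge0 c (i + 2)) (b0 i) (b0 (i + 1)%N) (b0 (i + 2)%N) d0 d1 d2.
  rewrite -(addn2 i) -(addn1 i) => /le_trans; apply.
  rewrite /G addn0 !addnK subn0.
  (* The ranges with frozen coefficients are eliminated in favour of those of [c]. This turns the
     weight 2 into 2 + 2 * 2 = 6 on squared ranges and adds 2 * 2 = 4 on squared errors; the three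
     shifts then give 18 = 3 * 6. *)
  have bsq (A B t : R) : `|A - B| <= t -> B ^+ 2 <= 2 * A ^+ 2 + 2 * t ^+ 2.
    move=> h; have t0 : 0 <= t by exact: le_trans h.
    have : (A - B) ^+ 2 <= t ^+ 2.
      by rewrite -real_normK ?num_real//; apply: lerXn2r; rewrite ?nnegrE.
    by have := sqr_ge0 (2 * A - B); nra.
  have e0 := bsq _ _ _ d0; have e1 := bsq _ _ _ d1; have e2 := bsq _ _ _ d2.
  move: e0 e1 e2.
  move: ((`|V i| * _) ^+ 2) ((`|V i| * _) ^+ 2) ((`|V i| * _) ^+ 2).
  move: (a i ^+ 2) (a (i + 1)%N ^+ 2) (a (i + 2)%N ^+ 2).
  move: ((\sum_(t < m) _) ^+ 2) ((\sum_(t < m) _) ^+ 2) ((\sum_(t < m) _) ^+ 2).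
  move=> x3 x2 x1 y1 y2 y3 b3 b2 b1 h1 h2 h3.
  have -> : (k^-1 ^+ 6 + 4 * k ^+ 3) * (x1 + x2 + x3) + 6 * k ^+ 3 * (y1 + y2 + y3) =
    k^-1 ^+ 6 * (x1 + x2 + x3) +
    2 * k ^+ 3 * (y1 + y2 + y3 + (2 * y1 + 2 * x1) + (2 * y2 + 2 * x2) + (2 * y3 + 2 * x3)) by ring.
  by rewrite lerD2l ler_wpM2l ?mulr_ge0//; lra.
rewrite big_split/= -!mulr_sumr !big_split/=.
have hD j : (j <= 2)%N -> \sum_(i < n - 2) D j (i + j)%N ^+ 2 <= m%:R * cell_error j.
  move=> j2; apply: le_trans (win_dist_sum j).
  by apply: (ler_sum_shift (f := fun i => D j i ^+ 2)) => // i; exact: sqr_ge0.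
have hA j : (j <= 2)%N -> \sum_(i < n - 2) a (i + j)%N ^+ 2 <= \sum_(i < n) a i ^+ 2.
  by move=> j2; apply: (ler_sum_shift (f := fun i => a i ^+ 2)) => // i; exact: sqr_ge0.
apply: lerD.
  apply: ler_wpM2l; first by rewrite addr_ge0// mulr_ge0.
  rewrite !mulrDr; apply: lerD; last exact: hD.
  apply: lerD; last exact: hD.
  by have := hD 0%N isT; under [X in X <= _ -> _]eq_bigr do rewrite addn0.
have -> : 18 * k ^+ 3 * \sum_(i < n) a i ^+ 2 = 6 * k ^+ 3 *
  (\sum_(i < n) a i ^+ 2 + \sum_(i < n) a i ^+ 2 + \sum_(i < n) a i ^+ 2) by ring.
apply: ler_wpM2l; first by rewrite mulr_ge0.
by apply: lerD; [apply: lerD|]; exact: hA.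
Qed.

End window_sums.

(** * Iterated limits in outer probability *)

Section iterated_limit.
Context d (T : measurableType d) (R : realType) (P : probability T R).
Implicit Types (Z : nat -> nat -> T -> R) (X : nat -> T -> R).

(* Convergence to 0 in outer probability, letting first [n] and then [k] tend
   to infinity. *)
Definition ilim0 Z := forall e eta : R, 0 < e -> 0 < eta ->
  exists K, forall k, (K <= k)%N -> exists N, forall n, (N <= n)%N ->
  (mu_ext P [set w | (e < Z k n w)%R] <= eta%:E)%E.

Definition prob0 X := forall e eta : R, 0 < e -> 0 < eta ->
  exists N, forall n, (N <= n)%N -> (mu_ext P [set w | (e < X n w)%R] <= eta%:E)%E.

Definition tight (Y : T -> R) := forall eta : R, 0 < eta ->
  exists M, 0 < M /\ (mu_ext P [set w | (M < Y w)%R] <= eta%:E)%E.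

Lemma ilim0D Z1 Z2 : ilim0 Z1 -> ilim0 Z2 -> ilim0 (fun k n w => Z1 k n w + Z2 k n w).
Proof.
move=> h1 h2 e eta e0 eta0.
have e20 : 0 < e / 2 by rewrite divr_gt0.
have eta20 : 0 < eta / 2 by rewrite divr_gt0.
have [K1 H1] := h1 _ _ e20 eta20; have [K2 H2] := h2 _ _ e20 eta20.
exists (maxn K1 K2) => k; rewrite geq_max => /andP[k1 k2].
have [N1 G1] := H1 k k1; have [N2 G2] := H2 k k2.
exists (maxn N1 N2) => n; rewrite geq_max => /andP[n1 n2].
have -> : eta%:E = ((eta / 2)%:E + (eta / 2)%:E)%E by rewrite -EFinD; congr (_%:E); lra.
apply: (outer_sub2 _ (G1 n n1) (G2 n n2)) => w /= hw.
by have [lt|ge] := ltP (e / 2) (Z1 k n w); [left|right; lra].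
Qed.

Lemma ilim0_le (Q : T -> Prop) (n0 : nat) Z1 Z2 : {ae P, forall w, Q w} -> ilim0 Z2 ->
  (forall k n w, Q w -> (n0 <= n)%N -> Z1 k n w <= Z2 k n w) -> ilim0 Z1.
Proof.
move=> aeQ h2 le e eta e0 eta0; have [K H] := h2 _ _ e0 eta0.
exists K => k Kk; have [N G] := H k Kk; exists (maxn n0 N) => n.
rewrite geq_max => /andP[n1 n2]; apply: le_trans (G n n2).
apply: (outer_ae aeQ) => w Qw /= /lt_le_trans; apply; exact: le.
Qed.

Lemma ilim0Z (c : R) Z : 0 <= c -> ilim0 Z -> ilim0 (fun k n w => c * Z k n w).
Proof.
move=> c0 h e eta e0 eta0.
have c1 : 0 < c + 1 by lra.
have ec : 0 < e / (c + 1) by rewrite divr_gt0.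
have [K H] := h _ _ ec eta0; exists K => k Kk; have [N G] := H k Kk; exists N => n Nn.
apply: le_trans (G n Nn); apply: outer_le => w /= hw.
rewrite ltr_pdivrMr//; have [z0|z0] := leP (Z k n w) 0; first by nra.
nra.
Qed.

(** An error proportional to a tight variable is harmless if the factor can be made arbitrarily
    small; the remainder may depend on that factor. This lets the Young and AM-GM parameters be
    fixed before the limits are taken. *)
Lemma ilim0_tight (Q : T -> Prop) (n0 : nat) Z (Y : T -> R) : {ae P, forall w, Q w} ->
  tight Y -> (forall w, 0 <= Y w) ->
  (forall c : R, 0 < c -> exists2 Z', ilim0 Z' &
     forall k n w, Q w -> (n0 <= n)%N -> Z k n w <= c * Y w + Z' k n w) ->
  ilim0 Z.
Proof.
move=> aeQ tY Y0 h e eta e0 eta0.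
have e20 : 0 < e / 2 by rewrite divr_gt0.
have eta20 : 0 < eta / 2 by rewrite divr_gt0.
have [M [M0 HM]] := tY _ eta20.
have [Z' hZ' le] := h (e / 2 / M) (divr_gt0 e20 M0).
have [K H] := hZ' _ _ e20 eta20; exists K => k Kk; have [N G] := H k Kk.
exists (maxn n0 N) => n; rewrite geq_max => /andP[n1 n2].
have -> : eta%:E = ((eta / 2)%:E + (eta / 2)%:E)%E by rewrite -EFinD; congr (_%:E); lra.
apply: le_trans (leeD HM (G n n2)); apply: le_trans (outerU _ _ _).
apply: (outer_ae aeQ) => w Qw /= hw.
have [lt|ge] := ltP M (Y w); [by left|right => /=].
have := le k n w Qw n1; have : e / 2 / M * Y w <= e / 2.
  by rewrite -[leRHS](divfK (lt0r_neq0 M0)) ler_wpM2l// divr_ge0// ltW.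
lra.
Qed.

Lemma ilim0_prob0 X : ilim0 (fun=> X) -> prob0 X.
Proof.
move=> h e eta e0 eta0; have [K H] := h _ _ e0 eta0; exact: H K (leqnn K).
Qed.

Lemma prob0_ilim0 X : prob0 X -> ilim0 (fun=> X).
Proof. by move=> h e eta e0 eta0; exists 0%N => k _; exact: h. Qed.

Lemma each_ilim0 Z : (forall k, prob0 (Z k)) -> ilim0 Z.
Proof. by move=> h e eta e0 eta0; exists 0%N => k _; exact: h. Qed.

Lemma prob0D X1 X2 : prob0 X1 -> prob0 X2 -> prob0 (fun n w => X1 n w + X2 n w).
Proof.
move=> /prob0_ilim0 h1 /prob0_ilim0 h2; apply: ilim0_prob0; exact: (ilim0D h1 h2).
Qed.

Lemma prob0Z (c : R) X : 0 <= c -> prob0 X -> prob0 (fun n w => c * X n w).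
Proof. by move=> c0 /prob0_ilim0 h; apply: ilim0_prob0; exact: ilim0Z. Qed.

Lemma prob0_le (Q : T -> Prop) (n0 : nat) X1 X2 : {ae P, forall w, Q w} -> prob0 X2 ->
  (forall n w, Q w -> (n0 <= n)%N -> X1 n w <= X2 n w) -> prob0 X1.
Proof.
move=> aeQ /prob0_ilim0 h le; apply: ilim0_prob0.
by apply: (ilim0_le aeQ h (n0 := n0)) => k n w; exact: le.
Qed.

Lemma prob0_tight (x : nat -> R) (Y : T -> R) : x @ \oo --> 0 -> (forall n, 0 <= x n) ->
  tight Y -> prob0 (fun n w => x n * Y w).
Proof.
move=> hx x0 tY e eta e0 eta0; have [M [M0 HM]] := tY _ eta0.
have [N _ HN] : \forall n \near \oo, `|0 - x n| < e / M.
  by move/cvgrPdist_lt : hx; apply; rewrite divr_gt0.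
exists N => n Nn; apply: le_trans HM; apply: outer_le => w /= hw.
rewrite ltNge; apply/negP => YM; have := HN n Nn; rewrite sub0r normrN ger0_norm// => h.
have : x n * M < e by rewrite -ltr_pdivlMr.
have : x n * Y w <= x n * M by exact: ler_wpM2l.
lra.
Qed.

Lemma prob0_cvg0 (X : nat -> T -> R) : prob0 X ->
  cvg0_in_probability P (fun n w => (X n w)%:E).
Proof.
move=> h e e0; apply/fine_cvgP.
have fin n : mu_ext P [set w | (e%:E < (X n w)%:E)%E] \is a fin_num.
  rewrite ge0_fin_numE ?mu_ext_ge0//; apply: (@le_lt_trans _ _ (mu_ext P [set: T])).
    exact: outer_le.
  by rewrite outerE// [X in (X < _)%E]probability_setT ltry.
split; first by apply: nearW.
apply/cvgrPdist_le => eta eta0; have [N HN] := h _ _ e0 eta0; exists N => // n /= Nn.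
rewrite sub0r normrN ger0_norm ?fine_ge0 ?mu_ext_ge0//.
by rewrite -lee_fin fineK//; exact: HN.
Qed.

End iterated_limit.

(** * Sampling simple integrands on a grid *)

Section simple_process_steps.
Context d (T : measurableType d) (R : realType) (F : R -> set (set T)).
Hypothesis hF : filtration F.
Local Notation mu := (@lebesgue_measure R).

Lemma sp_val_bounded (S : simple_process T R) : sp_predictable F S ->
  exists C : R, 0 <= C /\ forall u w, `|sp_val S u w| <= C.
Proof.
move=> [_ hS].
have [C hC] : exists C : nat -> R, forall j, (j < sp_size S)%N -> forall w, `|sp_coef S j w| <= C j.
  have H j : exists C : R, (j < sp_size S)%N -> forall w, `|sp_coef S j w| <= C.
    have [jK|nK] := boolP (j < sp_size S)%N; last by exists 0.
    by have [_ _ [C hC]] := hS j jK; exists C.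
  by have [C hC] := choice H; exists C.
exists (\sum_(j < sp_size S) `|C j|); split; first exact: sumr_ge0.
move=> u w; rewrite /sp_val; apply: le_trans (ler_norm_sum _ _ _) _.
apply: ler_sum => j _; rewrite normrM -[leRHS]mulr1; apply: ler_pM => //.
  by apply: le_trans (hC j (ltn_ord j) w) (ler_norm _).
by rewrite indicE; case: (_ \in _); rewrite ?normr1 ?normr0.
Qed.

(** The intervals are open on the left, so only coefficients known strictly before [u] contribute at
    time [u]. *)
Lemma sp_val_wrt (S : simple_process T R) u : sp_predictable F S -> 0 <= u ->
  measurable_wrt (F u) (sp_val S u).
Proof.
move=> hS u0; have sig := filtration_sigma hF u0.
apply: measurable_wrt_sum => // j _; have jK := ltn_ord j.
rewrite indicE mem_setE in_itv/=; have [tu|ut] := ltP (sp_time S j) u; last first.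
  by under [X in measurable_wrt _ X]funext do rewrite mulr0; exact: measurable_wrt_cst.
apply: measurable_wrtM => //; last exact: measurable_wrt_cst.
have [_ /(_ j jK)[_ hm _]] := hS.
apply: measurable_wrt_sub hm; apply: (filtration_le hF) (ltW tu).
exact: (sp_time_ge0 hS (ltnW jK)).
Qed.

Lemma sp_val0 (S : simple_process T R) (w : T) : sp_predictable F S -> sp_val S 0 w = 0.
Proof.
move=> hS; rewrite /sp_val big1// => j _; rewrite indicE mem_setE in_itv/=.
by rewrite ltNge (sp_time_ge0 hS (ltnW (ltn_ord j)))/= mulr0.
Qed.

Lemma grid_cell_exists (M N : nat) (u : R) : 0 < u -> u <= N%:R / M%:R ->
  exists2 q, (q < N)%N & (q%:R / M%:R < u) && (u <= q.+1%:R / M%:R).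
Proof.
move=> u0; elim: N => [|N ih]; first by rewrite mul0r leNgt u0.
have [uN _|Nu uN] := leP u (N%:R / M%:R).
  by have [q qN hq] := ih uN; exists q => //; exact: ltnW.
by exists N => //; rewrite Nu.
Qed.

(** The two values differ only if a partition point lies between [x] and [u], and [u] is then within
    [h] to the right of that point. The indicators make the bound integrable in [u] with a result
    proportional to [h]. *)
Lemma sp_val_near (S : simple_process T R) (C x h u : R) (w : T) : sp_predictable F S ->
  0 <= C -> (forall u w, `|sp_val S u w| <= C) -> x < u -> u <= x + h ->
  (sp_val S x w - sp_val S u w) ^+ 2 <=
  4 * C ^+ 2 * \sum_(l < (sp_size S).+1) \1_(`]sp_time S l, sp_time S l + h]%classic) u.
Proof.
move=> hS C0 hC xu uxh.
have [[l lx]|none] := pselect (exists l : 'I_(sp_size S).+1, (x <= sp_time S l) && (sp_time S l < u)).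
  have hle : (sp_val S x w - sp_val S u w) ^+ 2 <= 4 * C ^+ 2.
    have := hC x w; have := hC u w; rewrite !ler_norml => /andP[p1 p2] /andP[p3 p4].
    have : 0 <= (2 * C - (sp_val S x w - sp_val S u w)) * (2 * C + (sp_val S x w - sp_val S u w)).
      by apply: mulr_ge0; lra.
    by nra.
  apply: le_trans hle _; rewrite ler_peMr ?mulr_ge0 ?sqr_ge0//.
  rewrite (bigD1 l)//= indicE mem_setE in_itv/=.
  move/andP: lx => [xl lu]; rewrite lu (_ : u <= sp_time S l + h); last by lra.
  by rewrite lerDl sumr_ge0.
rewrite (_ : sp_val S x w = sp_val S u w); last first.
  rewrite /sp_val; apply: eq_bigr => j _; congr (_ * _); rewrite !indicE !mem_setE !in_itv/=.
  have nj l : (l <= sp_size S)%N -> (sp_time S l < u) = (sp_time S l < x).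
    move=> lK; apply/idP/idP => [lu|/lt_trans]; last by apply.
    rewrite ltNge; apply/negP => xl; apply: none.
    by exists (Ordinal (lK : (l < (sp_size S).+1)%N)); rewrite /= xl.
  have jK := ltn_ord j; rewrite nj ?(ltnW jK)//; congr ((_ && _)%:R).
  by rewrite !leNgt nj.
by rewrite subrr expr0n/= mulr_ge0 ?mulr_ge0 ?sqr_ge0 ?sumr_ge0.
Qed.

Lemma integral_grid_step_le (S : simple_process T R) (C : R) (M : nat) (x : nat -> R) (h : R) w :
  sp_predictable F S -> 0 <= C -> (forall u w, `|sp_val S u w| <= C) -> 0 <= h -> (0 < M)%N ->
  (forall q, (q < M)%N -> x q <= q%:R / M%:R /\ q.+1%:R / M%:R <= x q + h) ->
  (\int[mu]_(u in `[0%R, 1%R])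
     ((sp_val (grid_process M (fun q => sp_val S (x q))) u w - sp_val S u w) ^+ 2)%:E <=
   (4 * C ^+ 2 * (sp_size S).+1%:R * h)%:E)%E.
Proof.
move=> hS C0 hC h0 M0 hx.
set g := sp_val (grid_process M _).
pose B u : R := 4 * C ^+ 2 * \sum_(l < (sp_size S).+1) \1_(`]sp_time S l, sp_time S l + h]%classic) u.
have mB : measurable_fun [set: R] B.
  by apply: measurable_funM => //; apply: measurable_sum => l; exact: measurable_indic.
have mg : measurable_fun [set: R] (fun u => g u w) by exact: measurable_sp_val.
have mS : measurable_fun [set: R] (fun u => sp_val S u w) by exact: measurable_sp_val.
have C20 : 0 <= 4 * C ^+ 2 by rewrite mulr_ge0// sqr_ge0.
have B0 u : 0 <= B u by rewrite mulr_ge0// sumr_ge0.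
apply: (@le_trans _ _ (\int[mu]_(u in `[0%R, 1%R]) (B u)%:E)%E).
  apply: ge0_le_integral => //=.
  - by move=> u _; rewrite lee_fin sqr_ge0.
  - apply: measurable_funTS; apply: measurable_EFin_fun; apply: measurable_funX.
    exact: measurable_funB.
  - by apply: measurable_funTS; exact: measurable_EFin_fun.
  - move=> u; rewrite in_itv/= => /andP[u0 u1]; rewrite lee_fin.
    move: u0; rewrite le_eqVlt => /predU1P[<-|u0].
      rewrite (sp_val0 w hS) subr0.
      rewrite (_ : g 0 w = 0) ?expr0n//= /g /sp_val big1// => q _.
      by rewrite indicE mem_setE in_itv/= ltNge divr_ge0//= mulr0.
    have [q qM /andP[q1 q2]] : exists2 q, (q < M)%N & (q%:R / M%:R < u) && (u <= q.+1%:R / M%:R).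
      by apply: grid_cell_exists => //; rewrite divff// pnatr_eq0 -lt0n.
    rewrite /g (grid_process_val (fun q => sp_val S (x q)) M0 w qM q1 q2).
    have [xq1 xq2] := hx q qM.
    by apply: sp_val_near => //; [exact: le_lt_trans q1|exact: le_trans xq2].
apply: (@le_trans _ _ (\int[mu]_u (B u)%:E)%E).
  apply: ge0_subset_integral => //; first exact: measurable_EFin_fun.
  by move=> u _; rewrite lee_fin.
rewrite /B; under eq_integral do rewrite EFinM.
rewrite ge0_integralZl//=; last 2 first.
  by apply: measurable_EFin_fun; apply: measurable_sum => l; exact: measurable_indic.
  by move=> u _; rewrite lee_fin sumr_ge0.
under eq_integral do rewrite -sumEFin.
rewrite ge0_integral_sum//=; last first.
  by move=> l; apply: measurable_EFin_fun; exact: measurable_indic.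
under eq_bigr => l _ do rewrite integral_indic//= setIT lebesgue_measure_itv/=.
rewrite (eq_bigr (fun=> h%:E)); last first.
  move=> l _; rewrite lte_fin ltrDl; case: ltP => h1; first by rewrite -EFinB addrC addKr.
  by congr (_%:E); apply/eqP; rewrite eq_le h0 h1.
by rewrite sumEFin -EFinM lee_fin sumr_const card_ord -[h *+ _]mulr_natl mulrA.
Qed.

End simple_process_steps.

Section real_L2.
Context (R : realType).
Local Notation mu := (@lebesgue_measure R).
Local Notation D := (`[0, 1]%classic : set R).

(** [f] is bounded, whereas [g] is known to be square integrable only through its finite distance to
    [f]; that finiteness gives meaning to the real-valued integrals. *)
Lemma integral_sqr_close (f g : R -> R) (C eta : R) :
  measurable_fun D f -> measurable_fun D g -> (forall u, `|f u| <= C) -> 0 < eta ->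
  (\int[mu]_(u in D) ((f u - g u) ^+ 2)%:E < +oo)%E ->
  `|\int[mu]_(u in D) (f u ^+ 2) - \int[mu]_(u in D) (g u ^+ 2)| <=
  eta * \int[mu]_(u in D) (g u ^+ 2) + (1 + eta^-1) * \int[mu]_(u in D) ((f u - g u) ^+ 2) /\
  \int[mu]_(u in D) (g u ^+ 2) <= 2 * C ^+ 2 + 2 * \int[mu]_(u in D) ((f u - g u) ^+ 2).
Proof.
move=> mf mg fC eta0 fin.
have mD : @measurable _ (measurableTypeR R) D by [].
have m2 (a : R -> R) : measurable_fun D a -> measurable_fun D (fun u => (a u ^+ 2)%:E).
  by move=> ma; apply/measurable_EFinP; exact: measurable_funX.
have mfg : measurable_fun D (fun u => f u - g u) by exact: measurable_funB.
have ifg : mu.-integrable D (EFin \o (fun u => (f u - g u) ^+ 2)).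
  apply/integrableP; split; first exact: m2.
  by under eq_integral do rewrite /= ger0_norm ?sqr_ge0//.
have muD : mu D = 1%E by rewrite /= lebesgue_measure_itv/= lte01 -EFinB subr0.
have icst (x : R) : mu.-integrable D (EFin \o (fun=> x)).
  apply: measurable_bounded_integrable => //; first by rewrite [X in (X < _)%E]muD ltry.
  by exists `|x|; split; rewrite ?num_real// => M hM u _; apply: ltW.
have C20 : 0 <= C ^+ 2 by exact: sqr_ge0.
have f2C u : f u ^+ 2 <= C ^+ 2.
  have h := fC u; have C0 : 0 <= C by exact: le_trans h.
  by rewrite -real_normK ?num_real//; apply: lerXn2r; rewrite ?nnegrE.
have if2 : mu.-integrable D (EFin \o (fun u => f u ^+ 2)).
  apply: (le_integrable mD _ _ (icst (C ^+ 2))); first exact: m2.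
  by move=> u _ /=; rewrite lee_fin !ger0_norm ?sqr_ge0.
have ibig : mu.-integrable D (EFin \o (fun u => 2 * f u ^+ 2 + 2 * (f u - g u) ^+ 2)).
  by apply: (integrableD mD (integrableZl mD 2 if2) (integrableZl mD 2 ifg)).
have gle u : g u ^+ 2 <= 2 * f u ^+ 2 + 2 * (f u - g u) ^+ 2.
  by have := sqr_ge0 (2 * f u - g u); nra.
have ig2 : mu.-integrable D (EFin \o (fun u => g u ^+ 2)).
  apply: (le_integrable mD _ _ ibig); first exact: m2.
  move=> u _ /=; rewrite lee_fin ger0_norm ?sqr_ge0//.
  exact: le_trans (gle u) (ler_norm _).
split; last first.
  apply: le_trans (le_Rintegral mD ig2 ibig (fun u _ => gle u)) _.
  rewrite RintegralD//; [|exact: (integrableZl mD 2 if2)|exact: (integrableZl mD 2 ifg)].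
  rewrite !RintegralZl// lerD2r ler_wpM2l//.
  apply: le_trans (le_Rintegral mD if2 (icst _) (fun u _ => f2C u)) _.
  by rewrite Rintegral_cst//= lebesgue_measure_itv/= lte01 -EFinB subr0 mulr1.
rewrite -RintegralB//; apply: le_trans (le_normr_Rintegral mD _) _.
  exact: (integrableB mD if2 ig2).
rewrite -!RintegralZl// -RintegralD//;
  [|exact: (integrableZl mD _ ig2)|exact: (integrableZl mD _ ifg)].
apply: le_Rintegral => //.
- have := integrableB mD if2 ig2; move/integrable_norm; exact.
- by apply: (integrableD mD (integrableZl mD _ ig2) (integrableZl mD _ ifg)).
- move=> u _; have := sqr_dist_le eta0 (lexx `|f u - g u|).
  by rewrite (real_normK (num_real (f u - g u))).
Qed.

End real_L2.

(** * Range sums of the continuous part *)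

Section continuous_part.
Context d (T : measurableType d) (R : realType) (P : probability T R)
  (F : R -> set (set T)) (W sigma I c Dr : R -> T -> R) (m : nat).
Hypotheses (hF : filtration F) (hW : brownian_motion P F W) (m0 : (0 < m)%N)
  (hsm : {ae P, forall w, measurable_fun `[0 : R, 1] (sigma ^~ w)})
  (hI : ito_integral P F W sigma I).
Local Notation mu := (@lebesgue_measure R).
Local Notation obs_time := (@obs_time R m).
Local Notation Y := (norm_range W m).
Hypothesis hc : {ae P, forall w, forall t : R, 0 <= t -> c t w = Dr t w + I t w}.
Hypothesis hDr : prob0 P (fun n w =>
  \sum_(q < n * m) (Dr (obs_time n q.+1) w - Dr (obs_time n q) w) ^+ 2).

Variable S : nat -> simple_process T R.
Hypothesis hS : forall k, sp_predictable F (S k).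
Hypothesis hs : cvg0_in_probability P (fun k w =>
  \int[mu]_(u in `[0%R, 1%R]) ((sp_val (S k) u w - sigma u w) ^+ 2)%:E)%E.

Definition step_coef k n i (w : T) : R := sp_val (S k) (obs_time n (i * m)) w.

Lemma step_coef_wrt k n i : measurable_wrt (F (obs_time n (i * m))) (step_coef k n i).
Proof. by apply: sp_val_wrt => //; exact: obs_time_ge0. Qed.

(** For fixed [k] the sampling error is of order the delay, 1 / n. A delay of three windows covers a
    cell whose coefficient is frozen at the beginning of its triple. [M n] is the number of cells or
    of windows, according to the use. *)
Lemma grid_step_close (M : nat -> nat) (x : nat -> nat -> R) (delta eta : R) :
  (forall n, (0 < n)%N -> (0 < M n)%N) ->
  (forall n q, (0 < n)%N -> (q < M n)%N ->
     x n q <= q%:R / (M n)%:R /\ q.+1%:R / (M n)%:R <= x n q + 3 / n%:R) ->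
  0 < delta -> 0 < eta ->
  exists K, forall k, (K <= k)%N -> exists N, forall n, (N <= n)%N ->
  (mu_ext P [set w | delta%:E < \int[mu]_(u in `[0%R, 1%R])
     ((sp_val (grid_process (M n) (fun q => sp_val (S k) (x n q))) u w - sigma u w) ^+ 2)%:E]
   <= eta%:E)%E.
Proof.
move=> M0 hx d0 eta0.
have d40 : 0 < delta / 4 by rewrite divr_gt0.
have [K HK] := cvg0_in_probability_near hs d40 eta0.
exists K => k /HK Hk.
have [C [C0 hC]] := sp_val_bounded (hS k).
pose B := 4 * C ^+ 2 * (sp_size (S k)).+1%:R * 3.
have B0 : 0 <= B by rewrite !mulr_ge0// sqr_ge0.
exists (Num.truncn (B / (delta / 4))).+1 => n Nn.
have n0 : (0 < n)%N by exact: leq_trans Nn.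
have n0' : 0 < n%:R :> R by rewrite ltr0n.
have Bn : B / n%:R <= delta / 4.
  rewrite ler_pdivrMr// mulrC -ler_pdivrMr//; apply: ltW.
  by apply: lt_le_trans (truncnS_gt _) _; rewrite ler_nat.
apply: le_trans Hk; apply: (outer_ae hsm) => w ms /=.
apply: contraPP => /negP; rewrite -leNgt => h; apply/negP; rewrite -leNgt.
have msp (S' : simple_process T R) : measurable_fun `[0 : R, 1] (fun u => sp_val S' u w).
  by apply: measurable_funTS; exact: measurable_sp_val.
apply: le_trans (integral_sqrB_le (g := fun u => sp_val (S k) u w) _ (msp _) (msp _) ms) _ => //.
have -> : delta%:E = (2%:E * (delta / 4)%:E + 2%:E * (delta / 4)%:E)%E.
  by rewrite -!EFinM -EFinD; congr (_%:E); lra.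
apply: leeD; apply: lee_wpmul2l => //.
apply: le_trans (integral_grid_step_le w (hS k) C0 hC _ (M0 n n0) (hx n ^~ n0)) _.
  by rewrite divr_ge0.
by rewrite lee_fin mulrA.
Qed.

Local Notation U j := (fun k n w => cell_error m n (fun q => c (obs_time n q) w)
  (fun q => W (obs_time n q) w) (fun i => step_coef k n i w) j).

Lemma ilim0_cell_error j : (j <= 2)%N -> ilim0 P (U j).
Proof.
move=> j2.
pose U1 k n w := \sum_(q < n * m) (I (obs_time n q.+1) w - I (obs_time n q) w -
  step_coef k n (q %/ m - j) w * (W (obs_time n q.+1) w - W (obs_time n q) w)) ^+ 2.
pose U2 (k : nat) n w := \sum_(q < n * m) (Dr (obs_time n q.+1) w - Dr (obs_time n q) w) ^+ 2.
apply: (ilim0_le (Z2 := fun k n w => 2 * U1 k n w + 2 * U2 k n w) (n0 := 0%N) hc); last first.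
  move=> k n w hw _; rewrite /cell_error /U1 /U2 !mulr_sumr -big_split/=.
  apply: ler_sum => q _; rewrite !hw ?obs_time_ge0//.
  set a := I _ _; set b := I _ _; set e := step_coef _ _ _ _ * _.
  set f := Dr _ _; set g := Dr _ _.
  by have := sqr_ge0 ((a - b - e) - (f - g)); nra.
apply: ilim0D; last by apply: ilim0Z => //; exact: prob0_ilim0.
apply: ilim0Z => // e eta e0 eta0.
have nv0 := normal_var_ge0 R.
(* Chosen so that the second term of [ito_grid] is at most [eta / 2]; the added 1 keeps the
   denominator positive. *)
pose delta := e * (eta / 2) / (16 * normal_var R + 1).
have nv1 : 0 < 16 * normal_var R + 1 by lra.
have d0 : 0 < delta by rewrite divr_gt0// mulr_gt0// divr_gt0.
have [//|n q n0 qM||K HK] := @grid_step_close (fun n => (n * m)%N)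
  (fun n q => obs_time n ((q %/ m - j) * m)) delta (eta / 2) _ _ d0.
- by move=> n n0; rewrite muln_gt0 n0.
- have n0' : 0 < n%:R :> R by rewrite ltr0n.
  split.
    apply: obs_time_le; apply: leq_trans (leq_divM q m).
    by rewrite leq_mul2r leq_subr orbT.
  have -> : obs_time n ((q %/ m - j) * m) + 3 / n%:R = ((q %/ m - j) * m + 3 * m)%:R / (n * m)%:R.
    rewrite obs_timeE natrD [RHS]mulrDl; congr (_ + _).
    by rewrite !natrM; field; rewrite !pnatr_eq0 -!lt0n n0 m0.
  rewrite ler_wpM2r ?invr_ge0// ler_nat -mulnDl.
  apply: leq_trans (ltn_ceil q m0) _.
  by rewrite leq_mul2r; apply/orP; right; lia.
- by rewrite divr_gt0.
exists K => k /HK[N HN]; exists (maxn 1 N) => n; rewrite geq_max => /andP[n0 Nn].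
have M0 : (0 < n * m)%N by rewrite muln_gt0 n0.
have hv q : (q < n * m)%N -> measurable_wrt (F (q%:R / (n * m)%:R)) (step_coef k n (q %/ m - j)).
  move=> _; apply: (obs_wrt_le hF) (step_coef_wrt k n (q %/ m - j)).
  apply: leq_trans (leq_divM q m).
  by rewrite leq_mul2r leq_subr orbT.
apply: le_trans (ito_grid hF hW hsm hI M0 hv e0 d0) _.
have -> : eta%:E = ((eta / 2)%:E + (eta / 2)%:E)%E by rewrite -EFinD; congr (_%:E); lra.
apply: leeD; first exact: HN.
rewrite lee_fin /delta.
have -> : 16 * normal_var R * (e * (eta / 2) / (16 * normal_var R + 1)) / e =
  (16 * normal_var R / (16 * normal_var R + 1)) * (eta / 2) by field; rewrite !gt_eqF.
rewrite ler_piMl ?divr_ge0 ?(ltW eta0)//.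
by rewrite ler_pdivrMr// mul1r lerDl.
Qed.

Definition int_vol (w : T) : R := \int[mu]_(u in `[0%R, 1%R]) (sigma u w ^+ 2).

Lemma int_vol_ge0 w : 0 <= int_vol w.
Proof. by apply: Rintegral_ge0 => u _; exact: sqr_ge0. Qed.

(** One simple integrand close to [sigma] suffices: it is bounded by a deterministic constant, and
    [sigma] is at squared distance at most 1 from it with high probability. *)
Lemma tight_int_vol : tight P int_vol.
Proof.
move=> eta eta0; have [K HK] := cvg0_in_probability_near hs ltr01 eta0.
have [C [C0 hC]] := sp_val_bounded (hS K).
exists (2 * C ^+ 2 + 2 + 1); split; first by have := sqr_ge0 C; lra.
apply: le_trans (HK K (leqnn K)); apply: (outer_ae hsm) => w ms /=.
apply: contraPP => /negP; rewrite -leNgt => h; apply/negP; rewrite -leNgt.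
have msp : measurable_fun `[0 : R, 1] (fun u => sp_val (S K) u w).
  by apply: measurable_funTS; exact: measurable_sp_val.
have fin : (\int[mu]_(u in `[0%R, 1%R]) ((sp_val (S K) u w - sigma u w) ^+ 2)%:E < +oo)%E.
  by apply: le_lt_trans h _; rewrite ltry.
have [_ le2] := integral_sqr_close msp ms (hC ^~ w) ltr01 fin.
apply: le_trans le2 _.
have : \int[mu]_(u in `[0%R, 1%R]) ((sp_val (S K) u w - sigma u w) ^+ 2) <= 1.
  rewrite -lee_fin /Rintegral fineK// ge0_fin_numE//.
  by apply: integral_ge0 => u _; rewrite lee_fin sqr_ge0.
lra.
Qed.

Lemma integral_grid_sqr (M : nat) (v : nat -> T -> R) w : (0 < M)%N ->
  \int[mu]_(u in `[0%R, 1%R]) (sp_val (grid_process M v) u w ^+ 2) =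
  M%:R^-1 * \sum_(i < M) v i w ^+ 2.
Proof.
move=> M0; have M0' : M%:R != 0 :> R by rewrite pnatr_eq0 -lt0n.
have le i : (i%:R / M%:R : R) <= i.+1%:R / M%:R by rewrite ler_wpM2r ?invr_ge0// ler_nat.
rewrite /Rintegral -integral_itv_obnd_cbnd; last first.
  apply: measurable_funTS; apply: measurable_EFin_fun; apply: measurable_funX.
  exact: measurable_sp_val.
rewrite (_ : `]0%R, 1%R]%classic = `](0%:R / M%:R)%R, (M%:R / M%:R)%R]%classic); last first.
  by rewrite mul0r divff.
rewrite (@ge0_integral_chain _ (fun q => q%:R / M%:R)).
- rewrite (eq_bigr (fun i : 'I_M => (M%:R^-1 * v i w ^+ 2)%:E)).
    by rewrite sumEFin/= mulr_sumr.
  move=> i _; rewrite (@integral_itv_cst _ _ _ (v i w ^+ 2)%:E)//.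
    rewrite -EFinM; congr (_%:E); rewrite -mulrBl -natrB// subSnn mul1r; exact: mulrC.
  by move=> u h1 h2; rewrite (grid_process_val v M0 w (ltn_ord i) h1 h2).
- by move=> i _; exact: le.
- by apply: measurable_EFin_fun; apply: measurable_funX; exact: measurable_sp_val.
- by move=> u; rewrite lee_fin sqr_ge0.
Qed.

Lemma ilim0_int_vol : ilim0 P (fun k n w =>
  `|n%:R^-1 * \sum_(i < n) step_coef k n i w ^+ 2 - int_vol w|).
Proof.
apply: (ilim0_tight (Y := int_vol) (n0 := 1%N) hsm tight_int_vol int_vol_ge0) => eta eta0.
pose g k n := sp_val (grid_process n (step_coef k n)).
pose J k n w := (\int[mu]_(u in `[0%R, 1%R]) ((g k n u w - sigma u w) ^+ 2)%:E)%E.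
pose Z k n w := `|n%:R^-1 * \sum_(i < n) step_coef k n i w ^+ 2 - int_vol w|.
(* Where [J] is infinite its real value is meaningless, so [G] is there the quantity to be bounded.
   That event is contained in the one where [J] is large, whose outer probability is already
   small. *)
pose G k n w : R := if (J k n w < +oo)%E then (1 + eta^-1) * fine (J k n w) else Z k n w.
have J0 k n w : (0 <= J k n w)%E by apply: integral_ge0 => u _; rewrite lee_fin sqr_ge0.
have eta1 : 0 < 1 + eta^-1 by rewrite addr_gt0// invr_gt0.
exists G; last first.
  move=> k n w ms n0; rewrite /G; case: ifPn => [fin|_]; last first.
    by rewrite lerDr mulr_ge0 ?int_vol_ge0// ltW.
  have mg : measurable_fun `[0 : R, 1] (fun u => g k n u w).
    by apply: measurable_funTS; exact: measurable_sp_val.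
  have gC u : `|g k n u w| <= \sum_(i < n) `|step_coef k n i w|.
    rewrite /g /sp_val; apply: le_trans (ler_norm_sum _ _ _) _.
    apply: ler_sum => i _ /=; rewrite normrM indicE.
    by case: (_ \in _); rewrite ?normr0 ?normr1 ?mulr1 ?mulr0.
  have [h _] := integral_sqr_close mg ms gC eta0 fin.
  by rewrite -integral_grid_sqr.
move=> e e' e0 e'0; have d0 : 0 < e / (1 + eta^-1) by rewrite divr_gt0.
have [//|n q n0 qM|K HK] := @grid_step_close id (fun n q => obs_time n (q * m)) _ _ _ _ d0 e'0.
  have -> : obs_time n (q * m) = q%:R / n%:R.
    by rewrite obs_timeE !natrM; field; rewrite !pnatr_eq0 -!lt0n n0 m0.
  split => //; rewrite -mulrDl ler_wpM2r ?invr_ge0// -natrD ler_nat; lia.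
exists K => k /HK[n0 Hn0]; exists n0 => n /Hn0; apply: le_trans.
apply: outer_le => w /=; rewrite /G -/(J k n w); case: ifPn => [fin h|].
  rewrite -[ltRHS]fineK ?ge0_fin_numE// lte_fin ltr_pdivrMr// mulrC//.
by rewrite -leNgt leye_eq => /eqP h _; rewrite -/(g k n) -/(J k n w) h ltry.
Qed.

Lemma prob0_inv (X : nat -> T -> R) (K : R) :
  (forall n (e : R), (0 < n)%N -> 0 < e ->
    (mu_ext P [set w | (e < X n w)%R] <= (K / e ^+ 2 / n%:R)%:E)%E) -> prob0 P X.
Proof.
move=> h e eta e0 eta0; exists (Num.truncn (K / e ^+ 2 / eta)).+1 => n Nn.
have n0 : (0 < n)%N by exact: leq_trans Nn.
apply: le_trans (h n e n0 e0) _.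
rewrite lee_fin ler_pdivrMr ?ltr0n// [leRHS]mulrC -ler_pdivrMr//; apply: ltW.
by apply: lt_le_trans (truncnS_gt _) _; rewrite ler_nat.
Qed.

Lemma prob0_le_inv (X : nat -> T -> R) (K : R) :
  (forall n w, (0 < n)%N -> X n w <= K / n%:R) -> prob0 P X.
Proof.
move=> h e eta e0 eta0; exists (Num.truncn (K / e)).+1 => n Nn.
have n0 : (0 < n)%N by exact: leq_trans Nn.
rewrite (_ : [set w | (e < X n w)%R] = set0) ?outer_measure0 ?lee_fin ?ltW//.
rewrite -subset0 => w /=; apply/negP; rewrite -leNgt; apply: le_trans (h n w n0) _.
rewrite ler_pdivrMr ?ltr0n// [leRHS]mulrC -ler_pdivrMr//; apply: ltW.
by apply: lt_le_trans (truncnS_gt _) _; rewrite ler_nat.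
Qed.

Definition obs_range (p : R -> T -> R) n i w := win_range m (fun q => p (obs_time n q) w) i.

Lemma norm_range_sqr n i w : (0 < n)%N -> n%:R^-1 * Y n i w ^+ 2 = obs_range W n i w ^+ 2.
Proof.
move=> n0; rewrite (norm_rangeE W m0 _ _ n0) exprMn sqr_sqrtr// mulrA mulVf ?mul1r//.
by rewrite pnatr_eq0 -lt0n.
Qed.

Lemma norm_range_powR n i j k w : (0 < n)%N ->
  n%:R^-1 * (Y n i w `^ (2 / 3) * Y n j w `^ (2 / 3) * Y n k w `^ (2 / 3)) =
  obs_range W n i w `^ (2 / 3) * obs_range W n j w `^ (2 / 3) * obs_range W n k w `^ (2 / 3).
Proof.
move=> n0; rewrite !(norm_rangeE W m0 _ _ n0).
rewrite !powRM ?sqrtr_ge0 ?grid_range_ge0// -!/(obs_range W n _ w).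
have E : (Num.sqrt n%:R `^ (2 / 3)) ^+ 3 = n%:R :> R.
  by rewrite powR_third_cube ?sqrtr_ge0// sqr_sqrtr.
rewrite (_ : forall r x y z : R, r * x * (r * y) * (r * z) = r ^+ 3 * (x * y * z)); last first.
  by move=> *; ring.
by rewrite E mulKf// pnatr_eq0 -lt0n.
Qed.

Local Notation l2 := (lambda P W 2 m).
Local Notation l3 := (lambda P W (2 / 3) m).
Local Notation obs_triple p n i w := (obs_range p n i w `^ (2 / 3) *
  obs_range p n i.+1 w `^ (2 / 3) * obs_range p n i.+2 w `^ (2 / 3)).

(** For fixed [k] the coefficients are bounded, and the variance bound of order 1 / n applies with a
    constant depending on [k]. *)
Lemma ilim0_sqr_lln : ilim0 P (fun k n w => `|\sum_(i < n)
  step_coef k n i w ^+ 2 * obs_range W n i w ^+ 2 -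
  l2 * (n%:R^-1 * \sum_(i < n) step_coef k n i w ^+ 2)|).
Proof.
apply: each_ilim0 => k; have [C [C0 hC]] := sp_val_bounded (hS k).
apply: prob0_inv => n e n0 e0.
apply: le_trans (range_sqr_lln hF hW m0 C0 (step_coef_wrt k n) _ e0 n0).
  apply: outer_le => w /=; congr (_ < `|_|).
  rewrite !mulr_sumr -sumrB; apply: eq_bigr => i _.
  by rewrite -norm_range_sqr//; ring.
by move=> i w; exact: hC.
Qed.

Lemma ilim0_powR_lln : ilim0 P (fun k n w => `|\sum_(i < n - 2)
  step_coef k n i w ^+ 2 * obs_triple W n i w -
  l3 ^+ 3 * (n%:R^-1 * \sum_(i < n - 2) step_coef k n i w ^+ 2)|).
Proof.
apply: each_ilim0 => k; have [C [C0 hC]] := sp_val_bounded (hS k).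
apply: prob0_inv => n e n0 e0.
apply: le_trans (range_powR_lln hF hW m0 C0 (step_coef_wrt k n) _ e0 n0).
  apply: outer_le => w /=; congr (_ < `|_|).
  rewrite !mulr_sumr -sumrB; apply: eq_bigr => i _.
  rewrite -(norm_range_powR i i.+1 i.+2 w n0).
  by move: (_ * _ * _ `^ _) => y; ring.
by move=> i w; exact: hC.
Qed.

(** At most two terms differ, each of order 1 / n for fixed [k]. *)
Lemma ilim0_last_windows : ilim0 P (fun k n w =>
  `|n%:R^-1 * \sum_(i < n) step_coef k n i w ^+ 2 -
    n%:R^-1 * \sum_(i < n - 2) step_coef k n i w ^+ 2|).
Proof.
apply: each_ilim0 => k; have [C [C0 hC]] := sp_val_bounded (hS k).
apply: (@prob0_le_inv _ (2 * C ^+ 2)) => n w n0.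
rewrite -mulrBr normrM ger0_norm ?invr_ge0// mulrC ler_wpM2r ?invr_ge0//.
have vC i : step_coef k n i w ^+ 2 <= C ^+ 2 by rewrite -real_normK ?num_real// lerXn2r ?nnegrE// hC.
rewrite -!(big_mkord xpredT (fun i => step_coef k n i w ^+ 2)).
rewrite (big_cat_nat (n := (n - 2)%N) (leq0n _) (leq_subr 2 n))/= addrAC subrr add0r.
rewrite ger0_norm; last by apply: sumr_ge0 => *; exact: sqr_ge0.
apply: le_trans (ler_sum_nat (fun i _ => vC i)) _.
rewrite sumr_const_nat -[leLHS]mulr_natl ler_wpM2r ?sqr_ge0// ler_nat.
by lia.
Qed.

Lemma cvg_sqr_range_sum :
  prob0 P (fun n w => `|\sum_(i < n) obs_range c n i w ^+ 2 - l2 * int_vol w|).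
Proof.
apply: ilim0_prob0; have l20 := lambda2_gt0 hF hW m0.
apply: (ilim0_tight (Y := int_vol) (n0 := 1%N) hsm tight_int_vol int_vol_ge0) => e e0.
(* Young's inequality leaves an error [eta] times a sum close to [l2] times the integrated variance;
   this choice makes it [e] times the integrated variance. *)
pose eta := e / l2; have eta0 : 0 < eta by rewrite divr_gt0.
have eta1 : 0 < 1 + eta^-1 by rewrite addr_gt0// invr_gt0.
pose Z' k n w := (1 + eta) * (`|\sum_(i < n)
  step_coef k n i w ^+ 2 * obs_range W n i w ^+ 2 -
  l2 * (n%:R^-1 * \sum_(i < n) step_coef k n i w ^+ 2)| +
  l2 * `|n%:R^-1 * \sum_(i < n) step_coef k n i w ^+ 2 - int_vol w|) +
  (1 + eta^-1) * (m%:R * U 0%N k n w).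
exists Z'.
  apply: ilim0D; apply: ilim0Z; rewrite ?(ltW eta1)//.
  - by rewrite addr_ge0// ltW.
  - apply: ilim0D; first exact: ilim0_sqr_lln.
    by apply: ilim0Z; [exact: ltW|exact: ilim0_int_vol].
  - by apply: ilim0Z => //; exact: ilim0_cell_error.
move=> k n w _ n0; rewrite /Z'.
have := sqr_range_sum_dist n (fun q => c (obs_time n q) w) (fun q => W (obs_time n q) w)
   (fun i => step_coef k n i w) m0 eta0.
rewrite -/(obs_range c n _ w).
move: (\sum_(i < n) win_range m _ i ^+ 2) => A.
move: (\sum_(i < n) _ * _) => X.
move: (_^-1 * \sum_(i < n) _) => v.
have := int_vol_ge0 w; move: (int_vol w) => s s0.
have -> : e = eta * l2 by rewrite /eta divfK// gt_eqF.
move: (_ * (_ * cell_error _ _ _ _ _ _)) => E h1.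
have h2 := ler_distD (l2 * v) X (l2 * s).
rewrite -mulrBr normrM (gtr0_norm l20) in h2.
have h3 := ler_distD X A (l2 * s).
have h4 : X <= l2 * s + `|X - l2 * v| + l2 * `|v - s|.
  by have := ler_norm (X - l2 * s); lra.
have := ler_wpM2l (ltW eta0) h4; lra.
Qed.

(** The comparison of triple products leaves a small multiple of the sum of squared ranges of [c],
    whose limit [l2 * int_vol] is already known and tight. *)
Lemma cvg_powR_range_sum :
  prob0 P (fun n w => `|\sum_(i < n - 2) obs_triple c n i w - l3 ^+ 3 * int_vol w|).
Proof.
apply: ilim0_prob0; have l20 := lambda2_gt0 hF hW m0; have l30 := lambda23_gt0 hF hW m0.
apply: (ilim0_tight (Y := int_vol) (n0 := 1%N) hsm tight_int_vol int_vol_ge0) => e e0.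
(* As [k0 <= 1], its cube is at most [k0], and the weight [18 * k0 ^+ 3 * l2] is at most [e]. *)
pose k0 := Num.min 1 (e / (18 * l2)); have k00 : 0 < k0.
  by rewrite lt_min ltr01 divr_gt0// mulr_gt0.
have k0e : 18 * k0 ^+ 3 * l2 <= e.
  have h1 : k0 <= 1 by rewrite ge_min lexx.
  have h2 : k0 * (18 * l2) <= e by rewrite -ler_pdivlMr ?mulr_gt0// ge_min lexx orbT.
  have h3 : k0 ^+ 3 <= k0 by rewrite exprS ler_piMr ?exprn_ile1// ltW.
  have := ler_wpM2r (ltW (mulr_gt0 (ltr0n R 18) l20)) h3; lra.
pose b := k0^-1 ^+ 6 + 4 * k0 ^+ 3; have b0 : 0 <= b.
  by rewrite /b addr_ge0 ?mulr_ge0 ?exprn_ge0 ?invr_ge0 ?(ltW k00).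
have k30 : 0 <= 18 * k0 ^+ 3 by rewrite mulr_ge0// exprn_ge0// ltW.
have l330 : 0 <= l3 ^+ 3 by rewrite exprn_ge0// ltW.
pose Z' k n w := b * (m%:R * (U 0%N k n w + U 1%N k n w + U 2%N k n w)) +
  18 * k0 ^+ 3 * `|\sum_(i < n) obs_range c n i w ^+ 2 - l2 * int_vol w| +
  (`|\sum_(i < n - 2) step_coef k n i w ^+ 2 * obs_triple W n i w -
    l3 ^+ 3 * (n%:R^-1 * \sum_(i < n - 2) step_coef k n i w ^+ 2)| +
   l3 ^+ 3 * (`|n%:R^-1 * \sum_(i < n) step_coef k n i w ^+ 2 -
      n%:R^-1 * \sum_(i < n - 2) step_coef k n i w ^+ 2| +
     `|n%:R^-1 * \sum_(i < n) step_coef k n i w ^+ 2 - int_vol w|)).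
exists Z'.
  apply: ilim0D; first apply: ilim0D.
  - apply: ilim0Z => //; apply: ilim0Z => //.
    apply: ilim0D; first apply: ilim0D; exact: ilim0_cell_error.
  - by apply: ilim0Z => //; apply: prob0_ilim0; exact: cvg_sqr_range_sum.
  - apply: ilim0D; first exact: ilim0_powR_lln.
    apply: ilim0Z => //; apply: ilim0D; first exact: ilim0_last_windows.
    exact: ilim0_int_vol.
move=> k n w _ n0; rewrite /Z'.
have := powR_range_sum_dist n (fun q => c (obs_time n q) w) (fun q => W (obs_time n q) w)
   (fun i => step_coef k n i w) m0 k00.
rewrite -/b.
move: (\sum_(i < n) win_range m _ i ^+ 2) => A.
move: (\sum_(i < n - 2) _ * _ * _) => TT.
move: (\sum_(i < n - 2) _ * _) => X.
move: (_^-1 * \sum_(i < n - 2) _) => v'.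
move: (_^-1 * \sum_(i < n) _) => v.
have := int_vol_ge0 w; move: (int_vol w) => s s0.
move: (b * _) (l3 ^+ 3) l330 => E l l0 h1.
have h2 := ler_distD (l * v') X (l * s).
rewrite -mulrBr normrM (ger0_norm l0) in h2.
have h3 := ler_distD X TT (l * s).
have h4 : `|v' - s| <= `|v - v'| + `|v - s|.
  by apply: le_trans (ler_distD v v' s) _; rewrite (distrC v' v).
have h5 : A <= l2 * s + `|A - l2 * s| by have := ler_norm (A - l2 * s); lra.
have := ler_wpM2l k30 h5; have := ler_wpM2l l0 h4; have := ler_wpM2r s0 k0e; lra.
Qed.

End continuous_part.

(** * Regularity of the volatility and of the drift *)

Section path_regularity.
Context (R : realType).
Local Notation mu := (@lebesgue_measure R).

(** Pointwise limit of step functions that take on each cell the value at its right end, so that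
    only limits from the right occur. The origin is treated apart because cells are open on the
    left. *)
Lemma right_continuous_measurable (x : R -> R) :
  (forall t : R, 0 <= t -> x s @[s --> t^'+] --> x t) -> measurable_fun `[0 : R, 1] x.
Proof.
move=> xc; rewrite -(@setU1itv _ _ (BRight 1) 0 false) ?bnd_simp//.
apply/measurable_funU => //; split; first exact: measurable_fun_set1.
pose f n (u : R) : R := sp_val (grid_process n.+1 (fun q (_ : R) => x (q.+1%:R / n.+1%:R))) u 0.
apply: (@measurable_fun_cvg _ _ _ _ f).
  by move=> n; apply: measurable_funTS; exact: measurable_sp_val.
move=> t; rewrite /= in_itv/= => /andP[t0 t1].
apply/cvgrPdist_lt => e e0.
have /cvgrPdist_lt/(_ e e0) := xc t (ltW t0).
move=> [delta /= delta0 h].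
near=> n.
have n0 : 0 < n.+1%:R :> R by [].
have [|q qn /andP[h1 h2]] := @grid_cell_exists _ n.+1 n.+1 t t0; first by rewrite divff ?gt_eqF.
rewrite /f (grid_process_val _ _ _ qn h1 h2)//.
move: h2; rewrite le_eqVlt => /predU1P[<-|h2]; first by rewrite subrr normr0.
apply: h => //=; rewrite ltr0_norm ?subr_lt0// opprB.
have : q.+1%:R / n.+1%:R - q%:R / n.+1%:R = n.+1%:R^-1 :> R by rewrite -mulrBl -natrB// subSnn mul1r.
have : n.+1%:R^-1 < delta by near: n; exact: near_infty_natSinv_lt (PosNum delta0).
have key (a1 a2 a3 a4 a5 : R) : a2 < a4 -> a3 < a5 -> a1 - a2 = a3 -> a1 - a4 < a5 by lra.
exact: key.
Unshelve. all: by end_near.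
Qed.

End path_regularity.

Section continuity_from_above.
Context d (T : measurableType d) (R : realType) (P : probability T R).

(** Continuity of [P] from above, in the form of an explicit index. *)
Lemma nonincreasing_negligible (A : nat -> set T) (eta : R) :
  (forall k, measurable (A k)) -> nonincreasing_seq A -> P.-negligible (\bigcap_k A k) ->
  0 < eta -> exists K, (P (A K) <= eta%:E)%E.
Proof.
move=> mA nA null eta0.
have mI : measurable (\bigcap_k A k) by apply: bigcap_measurable => //; exists 0%N.
have cv := nonincreasing_cvg_mu (le_lt_trans (probability_le1 P (mA 0%N)) (ltry 1)) mA mI nA.
have eta0' : (P (\bigcap_k A k) < eta%:E)%E by rewrite (measure_negligible mI null) lte_fin.
have [K _ hK] := cv _ (open_ereal_lt' eta0').
exists K; apply: ltW; exact: (hK K (leqnn K)).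
Qed.

(* Measurability is used here: the outer probability is not continuous from above. *)
Lemma ae_prob0 (X : nat -> T -> R) : (forall n, measurable_fun [set: T] (X n)) ->
  {ae P, forall w, forall e : R, 0 < e -> exists n0, forall n, (n0 <= n)%N -> X n w <= e} ->
  prob0 P X.
Proof.
move=> mX cvX e eta e0 eta0; pose A k := \bigcup_(n in [set n | (k <= n)%N]) [set w | e < X n w].
have mA k : measurable (A k).
  apply: bigcup_measurable => n _; rewrite (_ : [set w | e < X n w] = X n @^-1` `]e, +oo[%classic).
    by rewrite -[X in measurable X]setTI; apply: mX => //; exact: measurable_itv.
  by apply/seteqP; split => w /=; rewrite in_itv/= andbT.
have nA : nonincreasing_seq A.
  by move=> i j ij; apply/subsetPset => w [n /= jn h]; exists n => //=; exact: leq_trans jn.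
have null : P.-negligible (\bigcap_k A k).
  apply: negligibleS cvX => w h /(_ e e0)[n0 hn0].
  by have [n /= n0n] := h n0 I; rewrite ltNge (hn0 n n0n).
have [K PK] := nonincreasing_negligible mA nA null eta0.
exists K => n Kn; apply: le_trans PK.
have -> : P (A K) = mu_ext P (A K) by rewrite measurable_mu_extE.
by apply: outer_le => w /= h; exists n.
Qed.

End continuity_from_above.

Section drift.
Context d (T : measurableType d) (R : realType) (P : probability T R)
  (F : R -> set (set T)) (b : R -> T -> R).
Hypotheses (hF : filtration F) (hb : predictable F b) (hlb : locally_bounded P F b).
Local Notation mu := (@lebesgue_measure R).

(** The sets whose section at [w] is measurable in time form a sigma-algebra on the half-line
    containing the predictable rectangles. *)
Lemma predictable_section w : measurable_fun `[0 : R, 1] (b ^~ w).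
Proof.
pose D : set (R * T) := `[0, +oo[ `*` [set: T].
pose C : set (set (R * T)) := [set E | measurable [set u : R | E (u, w)]].
have sub : <<s D, predictable_rectangles F >> `<=` C.
  apply: smallest_sub => /=.
    split.
    - exact: measurable0.
    - move=> A CA; rewrite /C/=.
      rewrite (_ : [set u | _] = `[0, +oo[%classic `\` [set u : R | A (u, w)]).
        exact: measurableD.
      by apply/seteqP; split => u /=; rewrite /D/=; tauto.
    - move=> A CA; rewrite /C/=.
      rewrite (_ : [set u | _] = \bigcup_n [set u : R | A n (u, w)]).
        by apply: bigcup_measurable => n _; exact: CA.
      by apply/seteqP; split.
  move=> E [[A [_ ->]]|[s [t [A [_ _ _ ->]]]]]; rewrite /C/=.
  - have [Aw|nAw] := pselect (A w).
      rewrite (_ : [set u | _] = [set 0]); first exact: measurable_set1.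
      by apply/seteqP; split => u /=; tauto.
    rewrite (_ : [set u | _] = set0); first exact: measurable0.
    by apply/seteqP; split => u //=; tauto.
  - have [Aw|nAw] := pselect (A w).
      rewrite (_ : [set u | _] = `]s, t]%classic); first exact: measurable_itv.
      by apply/seteqP; split => u /=; tauto.
    rewrite (_ : [set u | _] = set0); first exact: measurable0.
    by apply/seteqP; split => u //=; tauto.
move=> _ B mB; have := sub _ (hb mB); rewrite /C/= => h.
rewrite (_ : _ `&` _ = `[0, 1]%classic `&` [set u : R | (`[0, +oo[%classic u /\ True) /\ B (b u w)]).
  exact: measurableI.
apply/seteqP; split => u /= [u01 Bu]; split=> //; last by case: Bu.
by split=> //; split=> //; move: u01; rewrite !in_itv/= andbT => /andP[].
Qed.

Lemma drift_increment_le (f : R -> R) (C s t : R) : measurable_fun `[0 : R, 1] f ->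
  (forall u, 0 <= u <= 1 -> `|f u| <= C) -> 0 <= s -> s <= t -> t <= 1 ->
  `|\int[mu]_(u in `[0, t]) f u - \int[mu]_(u in `[0, s]) f u| <= C * (t - s).
Proof.
move=> mf fC s0 st t1.
have int (D : set R) : @measurable _ (measurableTypeR R) D -> D `<=` `[0, 1]%classic ->
    mu.-integrable D (EFin \o f).
  move=> mD D01; apply: (@integrableS _ _ _ mu `[0, 1]%classic) => //.
  apply: measurable_bounded_integrable => //.
    by rewrite /= lebesgue_measure_itv/= lte_fin ltr01 ltry.
  exists C; split; first by rewrite num_real.
  by move=> x Cx u /=; rewrite in_itv/= => /fC h; apply: le_trans h _; exact: ltW.
rewrite Rintegral_itvB ?bnd_simp//; last first.
  by apply: int => // u /=; rewrite !in_itv/= => /andP[-> ut]; exact: le_trans t1.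
have sub : `]s, t]%classic `<=` (`[0, 1]%classic : set R).
  move=> u /=; rewrite !in_itv/= => /andP[su ut].
  by rewrite (le_trans s0 (ltW su)) (le_trans ut t1).
have ints := int `]s, t]%classic (measurable_itv _) sub.
apply: le_trans (le_normr_Rintegral _ ints) _ => //.
have -> : C * (t - s) = \int[mu]_(u in `]s, t]) C.
  rewrite Rintegral_cst//= lebesgue_measure_itv/= lte_fin; case: ltP => //= ts.
  by rewrite (_ : t = s) ?subrr//; apply/eqP; rewrite eq_le ts st.
apply: le_Rintegral => //.
- exact: integrable_norm.
- apply: measurable_bounded_integrable => //.
    by rewrite /= lebesgue_measure_itv/=; case: ifP => _; rewrite ltry.
  by exists `|C|; split => //= x Cx u _; exact: ltW.
- by move=> u /sub; rewrite /= in_itv/=; exact: fC.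
Qed.

(** The drift is bounded on the unit interval by a deterministic constant once the localising time
    exceeds 1, which fails with small probability for a large index. *)
Lemma locally_bounded_on_unit (eta : R) : 0 < eta -> exists C : R, 0 <= C /\
  exists A, (mu_ext P A <= eta%:E)%E /\
  {ae P, forall w, ~ A w -> forall u, 0 <= u <= 1 -> `|b u w| <= C}.
Proof.
move=> eta0; have [tau [st inc bd]] := hlb.
pose E k := [set w | (tau k w <= 1%:E)%E].
have mE k : measurable (E k).
  by apply: (filtration_sub hF ler01); exact: (st k).2.
(* The stopping times are monotone only almost surely; the running intersection makes the events
   monotone everywhere, as continuity from above requires. *)
pose E' k := \bigcap_(j < k.+1) E j.
have mE' k : measurable (E' k) by apply: bigcap_measurable => //; exists 0%N.
have nE' : nonincreasing_seq E'.
  move=> i j ij; apply/subsetPset => w h l /= li; apply: h => /=; exact: leq_trans ij.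
have null : P.-negligible (\bigcap_k E' k).
  apply: negligibleS inc => w h [_ ty].
  have [K _ hK] := ty _ (open_ereal_gt' (ltry 2)).
  have := hK K (leqnn K); rewrite /= ltNge => /negP; apply.
  have : (tau K w <= 1%:E)%E by exact: (h K I K (ltnSn K)).
  by move/le_trans; apply; rewrite lee_fin ler1n.
have [K PK] := nonincreasing_negligible mE' nE' null eta0.
have [C hC] := bd K.
exists `|C|; split=> //; exists (E K); split.
  apply: le_trans PK.
  have -> : P (E' K) = mu_ext P (E' K) by rewrite measurable_mu_extE.
  apply: (outer_ae inc) => w [hw _] Ek j /= jK.
  by apply: le_trans Ek; exact: hw.
apply: filterS hC => w hC /negP; rewrite -ltNge => h u /andP[u0 u1].
apply: le_trans (ler_norm C).
have u1' : (u%:E <= tau K w)%E by apply: le_trans (ltW h); rewrite lee_fin.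
by apply: hC => //; apply: lt_trans h; rewrite lte_fin.
Qed.

Lemma locally_bounded_path :
  {ae P, forall w, exists C : R, forall u, 0 <= u <= 1 -> `|b u w| <= C}.
Proof.
have [tau [_ inc /choice[C /ae_foralln hC]]] := hlb.
apply: filterS2 inc hC => w [_ ty] hC.
have [K _ hK] := ty _ (open_ereal_gt' (ltry 1)).
have h : (1%:E < tau K w)%E := hK K (leqnn K).
exists (C K) => u /andP[u0 u1]; apply: hC => //; first by apply: lt_trans h; rewrite lte_fin.
by apply: le_trans (ltW h); rewrite lee_fin.
Qed.

(** Off a set of small outer probability, [n * m] increments of size at most C / (n m) give a sum at
    most C^2 / (n m). *)
Lemma drift_quadratic_variation (m : nat) : (0 < m)%N ->
  prob0 P (fun n w => \sum_(q < n * m)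
    (\int[mu]_(u in `[0, obs_time R m n q.+1]) b u w -
     \int[mu]_(u in `[0, obs_time R m n q]) b u w) ^+ 2).
Proof.
move=> m0 e eta e0 eta0.
have [C [C0 [A [PA hA]]]] := locally_bounded_on_unit eta0.
exists (Num.truncn (C ^+ 2 / e)).+1 => n Nn.
have n0 : (0 < n)%N by exact: leq_trans Nn.
apply: le_trans PA; apply: (outer_ae hA) => w hw /=; apply: contraPP => nA; apply/negP.
rewrite -leNgt; have nm0 : (0 < n * m)%N by rewrite muln_gt0 n0.
have nm0' : 0 < (n * m)%:R :> R by rewrite ltr0n.
apply: (@le_trans _ _ (\sum_(q < n * m) (C / (n * m)%:R) ^+ 2)).
  apply: ler_sum => q _; rewrite -real_normK ?num_real// lerXn2r ?nnegrE// ?divr_ge0//.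
  have q1 : obs_time R m n q.+1 <= 1 by rewrite obs_timeE ler_pdivrMr// mul1r ler_nat.
  apply: le_trans (drift_increment_le (predictable_section w) (hw nA) (obs_time_ge0 _ _ _ _)
    (obs_time_le _ _ _ (leqnSn q)) q1) _.
  by rewrite !obs_timeE -mulrBl -natrB// subSnn mul1r.
rewrite sumr_const card_ord -[leLHS]mulr_natl.
have -> : (n * m)%:R * (C / (n * m)%:R) ^+ 2 = C ^+ 2 / (n * m)%:R.
  by field; rewrite natrM in nm0'; move/lt0r_neq0: nm0'; rewrite mulf_eq0 negb_or => /andP[-> ->].
rewrite ler_pdivrMr// [leRHS]mulrC -ler_pdivrMr//; apply: ltW.
apply: lt_le_trans (truncnS_gt _) _; rewrite ler_nat; apply: leq_trans Nn _.
by rewrite leq_pmulr.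
Qed.

End drift.

(** * Jumps *)

Section one_jump_windows.
Context (R : realType) (m n : nat) (y c J : nat -> R) (k : nat -> nat) (y0 M e : R).
Hypotheses (m0 : (0 < m)%N) (M0 : 0 <= M) (e0 : 0 <= e) (kS : forall q, (k q <= k q.+1)%N)
  (yE : forall q, y q = y0 + c q + \sum_(1 <= r < (k q).+1) J r)
  (JM : forall r, (1 <= r <= k (n * m))%N -> `|J r| <= M)
  (ce : forall i, (i < n)%N -> win_range m c i <= e).
Local Notation a := (win_range m y).
Local Notation b := (win_range m c).
Local Notation g i := (k (i * m)).
Local Notation sqJ l := (\sum_(1 <= r < l.+1) J r ^+ 2).

Lemma jump_count_le p q : (p <= q)%N -> (k p <= k q)%N.
Proof. by move=> /(homo_leq leqnn leq_trans kS). Qed.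

Let g_le p q : (p <= q)%N -> (g p <= g q)%N.
Proof. by move=> pq; apply: jump_count_le; rewrite leq_mul2r pq orbT. Qed.

Lemma win_range_no_jump i : g i.+1 = g i -> a i = b i.
Proof.
rewrite mulSnr => gi; apply: eq_grid_range => s t sm tm.
have kE u : (u <= m)%N -> k (i * m + u) = g i.
  move=> um; apply/eqP; rewrite eqn_leq -{1}gi !jump_count_le ?leq_add2l ?leq_addr//.
by rewrite !yE !kE//; lra.
Qed.

(** The jump part of the path takes two values in the window, with difference [J], so its own range
    is [|J|]; the continuous part perturbs every difference by at most its range. *)
Lemma win_range_one_jump i : g i.+1 = (g i).+1 -> `|a i - `|J (g i).+1| | <= b i.
Proof.
rewrite mulSnr => gi; pose z t : R := \sum_(1 <= r < (k (i * m + t)).+1) J r.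
have zE u : (u <= m)%N -> z u = z 0%N \/ z u = z 0%N + J (g i).+1.
  move=> um; rewrite /z addn0.
  have : (g i <= k (i * m + u))%N by rewrite jump_count_le// leq_addr.
  have : (k (i * m + u) <= (g i).+1)%N by rewrite -gi jump_count_le// leq_add2l.
  rewrite leq_eqVlt => /predU1P[-> _|]; first by right; rewrite big_nat_recr.
  by rewrite ltnS => h1 h2; left; congr (\sum_(1 <= r < _.+1) _); apply/eqP; rewrite eqn_leq h1.
have zm : z m = z 0%N + J (g i).+1.
  by rewrite /z addn0 gi big_nat_recr.
have <- : grid_range m z = `|J (g i).+1|.
  apply/eqP; rewrite eq_le; apply/andP; split; last first.
    have := grid_range_abs z (leq0n m) (leqnn m).
    by rewrite zm addrAC subrr add0r.
  apply: grid_range_le => // s t sm tm; have := ler_norm (J (g i).+1).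
  have := ler_norm (- J (g i).+1); rewrite normrN.
  have := normr_ge0 (J (g i).+1).
  by case: (zE _ sm) => ->; case: (zE _ tm) => ->; lra.
apply: grid_range_dist => s t sm tm.
rewrite (_ : _ - _ - _ = c (i * m + t)%N - c (i * m + s)%N).
  exact: (grid_range_abs (fun t => c (i * m + t)%N)).
by rewrite !yE -/(z t) -/(z s); lra.
Qed.

(** The factor is the number of jumps in the window, 0 or 1. It makes the bounds telescope to the
    total number of jumps instead of the number of windows. *)
Lemma sqr_win_range_jump i : (i < n)%N -> (g i.+1 <= (g i).+1)%N ->
  `|a i ^+ 2 - b i ^+ 2 - (sqJ (g i.+1) - sqJ (g i))| <=
  ((g i.+1)%:R - (g i)%:R) * (2 * M * e + 2 * e ^+ 2).
Proof.
move=> in_ h; have h' := g_le (leqnSn i).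
have [gi|ne] := eqVneq (g i.+1) (g i).
  by rewrite gi !subrr (win_range_no_jump gi) subrr sub0r oppr0 normr0 mul0r.
have gi : g i.+1 = (g i).+1 by apply/eqP; rewrite eqn_leq h ltn_neqAle eq_sym ne.
have h1 := win_range_one_jump gi.
have JMi : `|J (g i).+1| <= M by apply: JM; rewrite /= -gi g_le.
have -> : (g i.+1)%:R - (g i)%:R = 1 :> R by rewrite gi -natr1 addrAC subrr add0r.
rewrite gi big_nat_recr//= (addrAC _ (J _ ^+ 2)) subrr add0r mul1r.
rewrite -(real_normK (num_real (J _))).
move: (normr_ge0 (J (g i).+1)) h1 JMi (ce in_) (win_range_ge0 m c i) (win_range_ge0 m y i).
move: (`|J _|) (a i) (b i) => j u v j0; rewrite ler_norml => /andP[h1 h2] jM ve v0 u0.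
have jv : j * v <= M * e by exact: ler_pM.
have vv : v * v <= e * e by exact: ler_pM.
by rewrite ler_norml; apply/andP; split; nra.
Qed.

Lemma sqr_range_sum_jump : (forall i, (i < n)%N -> (g i.+1 <= (g i).+1)%N) ->
  `|\sum_(i < n) a i ^+ 2 - \sum_(i < n) b i ^+ 2 - (sqJ (g n) - sqJ (g 0%N))| <=
  (g n)%:R * (2 * M * e + 2 * e ^+ 2).
Proof.
move=> h; have B0 : 0 <= 2 * M * e + 2 * e ^+ 2 by rewrite addr_ge0 ?mulr_ge0// exprn_ge0.
rewrite -sumrB -[X in `|_ - X|](telescope_sumr (fun i => sqJ (g i)) (leq0n n)).
rewrite big_mkord -sumrB; apply: le_trans (ler_norm_sum _ _ _) _.
apply: (@le_trans _ _ (\sum_(i < n) ((g i.+1)%:R - (g i)%:R) * (2 * M * e + 2 * e ^+ 2))).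
  by apply: ler_sum => i _; apply: sqr_win_range_jump => //; exact: h.
rewrite -mulr_suml ler_wpM2r//.
rewrite -(big_mkord xpredT (fun i => (g i.+1)%:R - (g i)%:R)) (telescope_sumr (fun i => (g i)%:R))//.
by rewrite lerBlDr lerDl.
Qed.

Local Notation tri x i := (x i `^ (2 / 3) * x i.+1 `^ (2 / 3) * x i.+2 `^ (2 / 3)).

Lemma win_range_jump_le i : (i < n)%N -> (g i.+1 <= (g i).+1)%N ->
  a i <= M + e /\ (g i.+1 = g i -> a i <= e).
Proof.
move=> in_ h; split; last by move=> gi; rewrite (win_range_no_jump gi); exact: ce.
have [gi|ne] := eqVneq (g i.+1) (g i).
  by rewrite (win_range_no_jump gi); have := ce in_; have := M0; lra.
have gi : g i.+1 = (g i).+1 by apply/eqP; rewrite eqn_leq h ltn_neqAle eq_sym ne g_le.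
have := win_range_one_jump gi; have := ce in_.
have : `|J (g i).+1| <= M by apply: JM; rewrite /= -gi g_le.
by move=> J_M bi_e; rewrite ler_norml => /andP[h1 h2]; lra.
Qed.

(** With at most one jump in three windows, at least two factors are at most [e] to the power 2/3.
    Both triple products then lie between 0 and the same bound, and so does the distance between
    them. *)
Lemma triple_jump i : (i.+2 < n)%N -> (g i.+3 <= (g i).+1)%N ->
  `|tri a i - tri b i| <= ((g i.+3)%:R - (g i)%:R) * ((M + e) `^ (2 / 3) * (e `^ (2 / 3)) ^+ 2).
Proof.
move=> in_ h; have g1 := g_le (leqnSn i); have g2 := g_le (leqnSn i.+1).
have g3 := g_le (leqnSn i.+2).
have [gi|ne] := eqVneq (g i.+3) (g i).
  rewrite gi subrr mul0r !win_range_no_jump ?subrr ?normr0//; lia.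
have gi : g i.+3 = (g i).+1 by lia.
have c1 : g i.+1 <> g i -> g i.+2 = g i.+1 /\ g i.+3 = g i.+2 by clear -g1 g2 g3 gi; lia.
have c2 : g i.+2 <> g i.+1 -> g i.+3 = g i.+2 by clear -g1 g2 g3 gi; lia.
have pw (u v : R) : 0 <= u -> u <= v -> 0 <= u `^ (2 / 3) <= v `^ (2 / 3).
  by move=> u0 uv; rewrite powR_ge0 ge0_ler_powR ?nnegrE// ?(le_trans u0 uv)// divr_ge0.
have b' j : (j < n)%N -> 0 <= b j `^ (2 / 3) <= e `^ (2 / 3).
  by move=> jn; apply: pw (ce jn); exact: win_range_ge0.
have em : e `^ (2 / 3) <= (M + e) `^ (2 / 3).
  by have /andP[] : 0 <= e `^ (2 / 3) <= (M + e) `^ (2 / 3) by apply: pw => //; have := M0; lra.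
have a' j : (j < n)%N -> (g j.+1 <= (g j).+1)%N -> (0 <= a j `^ (2 / 3) <= (M + e) `^ (2 / 3)) /\
    (g j.+1 = g j -> a j `^ (2 / 3) <= e `^ (2 / 3)).
  move=> jn gj; have [h1 h2] := win_range_jump_le jn gj.
  split=> [|/h2 h3]; first by apply: pw h1; exact: win_range_ge0.
  by have /andP[] : 0 <= a j `^ (2 / 3) <= e `^ (2 / 3) by apply: pw h3; exact: win_range_ge0.
have -> : (g i.+3)%:R - (g i)%:R = 1 :> R by rewrite gi -natr1 addrAC subrr add0r.
rewrite mul1r.
have i1 : (i.+1 < n)%N by exact: ltnW.
have i0 : (i < n)%N by exact: ltnW.
have tri_le (x1 x2 x3 u v w : R) : 0 <= x1 <= u -> 0 <= x2 <= v -> 0 <= x3 <= w ->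
    0 <= x1 * x2 * x3 <= u * v * w.
  move=> /andP[? ?] /andP[? ?] /andP[? ?].
  by rewrite !mulr_ge0// !ler_pM// mulr_ge0.
have e30 := powR_ge0 e (2 / 3).
have := tri_le _ _ _ _ _ _ (b' i i0) (b' i.+1 i1) (b' i.+2 in_).
have [] := a' i i0; first by lia.
have [] := a' i.+1 i1; first by lia.
have [] := a' i.+2 in_; first by lia.
move: (a i `^ _) (a i.+1 `^ _) (a i.+2 `^ _) (tri b i) (e `^ _) ((M + e) `^ _) em e30.
move=> x1 x2 x3 tb dl mm dm d0 x3m x3d x2m x2d x1m x1d tbd.
have d3 : dl * dl * dl <= mm * dl ^+ 2.
  by rewrite -mulrA -expr2 ler_wpM2r ?sqr_ge0.
suff : 0 <= x1 * x2 * x3 <= mm * dl ^+ 2.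
  by move: (x1 * x2 * x3) (mm * dl ^+ 2) d3 tbd; move=> X B; move: (dl * dl * dl) => D;
     rewrite ler_norml; lra.
have le3 (P1 : Prop) (x : R) : 0 <= x <= mm -> (P1 -> x <= dl) -> P1 -> 0 <= x <= dl.
  by move=> /andP[x0 _] f /f ->; rewrite x0.
have [j1|/eqP /c1[j2 j3]] := eqVneq (g i.+1) (g i); last first.
  have := tri_le _ _ _ _ _ _ x1m (le3 _ _ x2m x2d j2) (le3 _ _ x3m x3d j3).
  by rewrite (_ : mm * dl * dl = mm * dl ^+ 2) //; ring.
have [j2|/eqP /c2 j3] := eqVneq (g i.+2) (g i.+1); last first.
  have := tri_le _ _ _ _ _ _ (le3 _ _ x1m x1d j1) x2m (le3 _ _ x3m x3d j3).
  by rewrite (_ : dl * mm * dl = mm * dl ^+ 2) //; ring.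
have := tri_le _ _ _ _ _ _ (le3 _ _ x1m x1d j1) (le3 _ _ x2m x2d j2) x3m.
by rewrite (_ : dl * dl * mm = mm * dl ^+ 2) //; ring.
Qed.

(** A window belongs to at most three triples, so each jump is counted at most three times. *)
Lemma powR_range_sum_jump : (forall i, (i.+2 < n)%N -> (g i.+3 <= (g i).+1)%N) ->
  `|\sum_(i < n - 2) tri a i - \sum_(i < n - 2) tri b i| <=
  3 * (g n)%:R * ((M + e) `^ (2 / 3) * (e `^ (2 / 3)) ^+ 2).
Proof.
move=> h; set B := _ * _ ^+ 2.
have B0 : 0 <= B by rewrite mulr_ge0 ?powR_ge0// sqr_ge0.
rewrite -sumrB; apply: le_trans (ler_norm_sum _ _ _) _.
apply: (@le_trans _ _ (\sum_(i < n - 2) ((g i.+3)%:R - (g i)%:R) * B)).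
  apply: ler_sum => i _; have i2 : (i.+2 < n)%N by have := ltn_ord i; lia.
  by apply: triple_jump => //; exact: h.
rewrite -mulr_suml ler_wpM2r//.
pose f i : R := (g i.+1)%:R - (g i)%:R.
have f0 i : 0 <= f i by rewrite subr_ge0 ler_nat g_le.
have fS : \sum_(i < n) f i <= (g n)%:R.
  rewrite -(big_mkord xpredT f) (telescope_sumr (fun i => (g i)%:R))//.
  by rewrite lerBlDr lerDl.
have shift j (j2 : (j <= 2)%N) : \sum_(i < n - 2) f (i + j)%N <= \sum_(i < n) f i.
  exact: (ler_sum_shift n m0 f0 j2).
have := shift 0%N isT; have := shift 1%N isT.
have := shift 2%N isT.
have -> : \sum_(i < n - 2) ((g i.+3)%:R - (g i)%:R : R) =
  \sum_(i < n - 2) f (i + 0)%N + \sum_(i < n - 2) f (i + 1)%N + \sum_(i < n - 2) f (i + 2)%N.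
  by rewrite -!big_split/=; apply: eq_bigr => i _; rewrite /f addn0 addn1 addn2; lra.
lra.
Qed.

End one_jump_windows.

(** * Uniform moduli on the unit interval by compactness *)

Section lebesgue_number.
Context (R : realType).

(** Compactness of the unit segment makes a local property of short intervals uniform. It is stated
    for any relation between end points so as to serve both path continuity and jump counting. *)
Lemma lebesgue_number (Q : R -> R -> Prop) :
  (forall x : R, 0 <= x <= 1 -> exists2 delta : R, 0 < delta & forall s u : R,
     0 <= s -> s <= u -> u <= 1 -> `|s - x| < delta -> `|u - x| < delta -> Q s u) ->
  exists2 rho : R, 0 < rho & forall s u : R, 0 <= s -> s <= u -> u <= 1 -> u - s <= rho -> Q s u.
Proof.
move=> hQ; pose Pn n s := forall u : R, 0 <= s -> s <= u -> u <= 1 -> u - s <= n.+1%:R^-1 -> Q s u.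
have /compact_near_coveringP cov := @segment_compact R 0 1.
have [] := cov nat \oo Pn _ _.
  move=> x; rewrite /= in_itv/= => /[dup] x01 /hQ[delta d0 h].
  have d20 : 0 < delta / 2 by rewrite divr_gt0.
  exists (ball (x : R) (delta / 2), [set n : nat | n.+1%:R^-1 < delta / 2 :> R]).
    split=> /=; last exact: near_infty_natSinv_lt (PosNum d20).
    exact: nbhsx_ballx.
  move=> [s n] [/= sx nd] u s0 su u1 us; rewrite /ball/= distrC in sx.
  have key (z v d i : R) : `|z - v| < d / 2 -> z <= u -> u - z <= i -> i < d / 2 ->
      `|z - v| < d /\ `|u - v| < d.
    move=> h1 h2 h3 h4; have := normr_ge0 (z - v); split; first lra.
    have := ler_distD z u v; rewrite (ger0_norm (_ : 0 <= u - z)) ?subr_ge0//; lra.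
  by have [] := key _ _ _ _ sx su us nd; exact: h.
move=> n _ /(_ n (leqnn n)) h; exists n.+1%:R^-1; first by rewrite invr_gt0.
move=> s u s0 su u1; apply: h => //.
by rewrite /= in_itv/= s0 (le_trans su u1).
Qed.

(** Just to the right of a point [x] the count equals [N x], and just to the left it is at least
    [N x] minus one. A short interval around [x] therefore sees at most one jump. *)
Lemma counting_modulus (N : R -> nat) : simple_counting_path N ->
  exists2 rho : R, 0 < rho & forall s u : R, 0 <= s -> s <= u -> u <= 1 -> u - s <= rho ->
    (N u <= (N s).+1)%N.
Proof.
move=> [N0 Nle Nr Nl]; apply: lebesgue_number => x /andP[x0 x1].
have [r r0 hr] : exists2 r : R, 0 < r & forall s, x <= s -> s - x < r -> N s = N x.
  have [r /= r0 hr] := Nr x x0; exists r => // s; rewrite le_eqVlt => /predU1P[->//|xs sr].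
  by apply: hr => //=; rewrite distrC ger0_norm// subr_ge0 ltW.
have [l l0 hl] : exists2 l : R, 0 < l & forall s, 0 <= s -> s <= x -> x - s < l -> (N x <= (N s).+1)%N.
  move: x0; rewrite le_eqVlt => /predU1P[<-|x0].
    by exists 1 => // s s0 sle _; have -> : s = 0 by apply/eqP; rewrite eq_le sle.
  have [l /= l0 hl] := Nl x x0; exists l => // s _; rewrite le_eqVlt => /predU1P[->//|xs sr].
  by apply: hl => //=; rewrite ger0_norm// subr_ge0 ltW.
exists (Num.min r l); first by rewrite lt_min r0.
move=> s u s0 su u1; rewrite !lt_min => /andP[sr sl] /andP[ur ul].
have [xs|sx] := leP x s.
  rewrite (hr u (le_trans xs su)) ?(hr s xs)//.
    by apply: le_lt_trans sr; exact: ler_norm.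
  by apply: le_lt_trans ur; exact: ler_norm.
have hs : (N x <= (N s).+1)%N.
  by apply: hl => //; [exact: ltW|apply: le_lt_trans sl; rewrite distrC; exact: ler_norm].
have [xu|ux] := leP x u; last by apply: leq_trans hs; apply: Nle (ltW ux); exact: le_trans su.
rewrite (hr u xu)//; by apply: le_lt_trans ur; exact: ler_norm.
Qed.

Lemma continuous_modulus (f : R -> R) (e : R) : {within `[0, +oo[, continuous f} -> 0 < e ->
  exists2 rho : R, 0 < rho & forall s u : R, 0 <= s -> s <= u -> u <= 1 -> u - s <= rho ->
    `|f u - f s| <= e.
Proof.
move=> /subspace_continuousP fc e0; apply: lebesgue_number => x /andP[x0 x1].
have e20 : 0 < e / 2 by rewrite divr_gt0.
have xin : (`[0, +oo[%classic : set R) x by rewrite /= in_itv/= x0.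
have /cvgrPdist_lt/(_ _ e20)[r /= r0 hr] := fc x xin.
exists r => // s u s0 su u1 sr ur.
have h v : 0 <= v -> `|v - x| < r -> `|f x - f v| < e / 2.
  by move=> v0 vr; apply: hr => /=; [rewrite distrC|rewrite in_itv/= v0].
have := h s s0 sr; have := h u (le_trans s0 su) ur.
by move=> h1 h2; apply: ltW; have := ler_distD (f x) (f u) (f s); rewrite (distrC (f u) (f x)); lra.
Qed.

End lebesgue_number.

Section jumping_path.
Context (R : realType) (m : nat) (y c : R -> R) (N : R -> nat) (J : nat -> R) (y0 : R).
Hypotheses (m0 : (0 < m)%N) (hN : simple_counting_path N)
  (hc : forall e : R, 0 < e -> exists2 rho : R, 0 < rho & forall s u : R,
     0 <= s -> s <= u -> u <= 1 -> u - s <= rho -> `|c u - c s| <= e)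
  (hy : forall t, 0 <= t -> y t = y0 + c t + \sum_(1 <= r < (N t).+1) J r).
Local Notation obs_time := (@obs_time R m).
Local Notation a n := (win_range m (fun q => y (obs_time n q))).
Local Notation b n := (win_range m (fun q => c (obs_time n q))).
Local Notation tri x i := (x i `^ (2 / 3) * x i.+1 `^ (2 / 3) * x i.+2 `^ (2 / 3)).

(** The mesh is chosen so that three windows together are shorter than both moduli. *)
Lemma fine_grid (e : R) : 0 < e -> exists n0, forall n, (n0 <= n)%N ->
  [/\ (0 < n)%N, forall i, (i < n)%N -> b n i <= e,
   forall i, (i < n)%N -> (N (obs_time n (i.+1 * m)) <= (N (obs_time n (i * m))).+1)%N &
   forall i, (i.+2 < n)%N -> (N (obs_time n (i.+3 * m)) <= (N (obs_time n (i * m))).+1)%N].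
Proof.
move=> e0; have [r1 r10 h1] := hc e0; have [r2 r20 h2] := counting_modulus hN.
pose r := Num.min r1 r2; have r0 : 0 < r by rewrite lt_min r10.
exists (Num.truncn (3 / r)).+1 => n Nn.
have n0 : (0 < n)%N by exact: leq_trans Nn.
have n0' : 0 < n%:R :> R by rewrite ltr0n.
have nr : 3 / n%:R <= r.
  rewrite ler_pdivrMr// [leRHS]mulrC -ler_pdivrMr//; apply: ltW.
  by apply: lt_le_trans (truncnS_gt _) _; rewrite ler_nat.
have near p q : (q <= p + 3 * m)%N -> obs_time n q - obs_time n p <= r.
  move=> qp; apply: le_trans nr; rewrite lerBlDr.
  have -> : 3 / n%:R + obs_time n p = obs_time n (p + 3 * m).
    rewrite obs_timeE [RHS]obs_timeE [in RHS]natrD [RHS]mulrDl addrC; congr (_ + _).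
    by rewrite !natrM; field; rewrite !pnatr_eq0 -!lt0n n0 m0.
  exact: obs_time_le.
have le1 q : (q <= n * m)%N -> obs_time n q <= 1.
  by move=> qn; rewrite obs_timeE ler_pdivrMr ?mul1r ?ler_nat// ltr0n muln_gt0 n0.
have r_le1 : r <= r1 by rewrite ge_min lexx.
have r_le2 : r <= r2 by rewrite ge_min lexx orbT.
split=> // i in_.
- apply: grid_range_le => [|s t sm tm]; first exact: ltW.
  have key p q : (p <= q)%N -> (q <= m)%N ->
      `|c (obs_time n (i * m + q)) - c (obs_time n (i * m + p))| <= e.
    move=> pq qm; apply: h1 => //.
    + exact: obs_time_ge0.
    + by apply: obs_time_le; rewrite leq_add2l.
    + apply: le1; apply: leq_trans (_ : (i.+1 * m <= _)%N); last by rewrite leq_mul2r in_ orbT.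
      by rewrite mulSnr leq_add2l.
    + apply: le_trans (near _ _ _) r_le1; rewrite -addnA leq_add2l.
      by apply: leq_trans (leq_addl _ _); apply: leq_trans qm _; rewrite leq_pmull.
  case/orP: (leq_total s t) => st; first by apply: le_trans (ler_norm _) _; exact: key.
  by apply: le_trans (ler_norm _) _; rewrite distrC; exact: key.
- apply: h2.
  + exact: obs_time_ge0.
  + by apply: obs_time_le; rewrite leq_mul2r leqnSn orbT.
  + by apply: le1; rewrite leq_mul2r in_ orbT.
  + by apply: le_trans (near _ _ _) r_le2; rewrite -mulnDl leq_mul2r; apply/orP; right; lia.
- apply: h2.
  + exact: obs_time_ge0.
  + by apply: obs_time_le; rewrite leq_mul2r; apply/orP; right; lia.
  + by apply: le1; rewrite leq_mul2r in_ orbT.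
  + by apply: le_trans (near _ _ _) r_le2; rewrite -mulnDl leq_mul2r; apply/orP; right; lia.
Qed.

Let M := \sum_(1 <= r < (N 1).+1) `|J r|.

Let M0 : 0 <= M.
Proof. by apply: sumr_ge0. Qed.

Let JM r : (1 <= r <= N 1)%N -> `|J r| <= M.
Proof.
move=> /andP[r1 rN]; rewrite /M (big_cat_nat (n := r))//=; last exact: leqW.
by rewrite [X in _ + X]big_ltn// addrCA lerDl addr_ge0//; apply: sumr_ge0.
Qed.

Let obs1 n : (0 < n)%N -> obs_time n (n * m) = 1.
Proof. by move=> n0; rewrite obs_timeE divff// pnatr_eq0 muln_eq0 negb_or -!lt0n n0. Qed.

Let NS n q : (N (obs_time n q) <= N (obs_time n q.+1))%N.
Proof. by have [_ h _ _] := hN; apply: h (obs_time_le _ _ _ (leqnSn q)); exact: obs_time_ge0. Qed.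

Lemma sqr_range_sum_jump_cvg (e : R) : 0 < e -> exists n0, forall n, (n0 <= n)%N ->
  `|\sum_(i < n) a n i ^+ 2 - \sum_(i < n) b n i ^+ 2 - \sum_(1 <= r < (N 1).+1) J r ^+ 2| <= e.
Proof.
(* With e' <= 1 one has e'^2 <= e', so the bound for the sum of squares is linear in e'; the added 1
   keeps [K] positive. *)
move=> e0; pose K := (N 1)%:R * (2 * M + 2) + 1 : R.
have K0 : 0 < K by rewrite ltr_wpDl// mulr_ge0// addr_ge0// mulr_ge0.
pose e' := Num.min 1 (e / K).
have e'0 : 0 < e' by rewrite lt_min ltr01 divr_gt0.
have [n0 hn0] := fine_grid e'0; exists n0 => n /hn0[np be k1 _].
have yE q : y (obs_time n q) = y0 + c (obs_time n q) +
    \sum_(1 <= r < (N (obs_time n q)).+1) J r by apply: hy; exact: obs_time_ge0.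
have JM' r : (1 <= r <= N (obs_time n (n * m)))%N -> `|J r| <= M by rewrite obs1//; exact: JM.
have := sqr_range_sum_jump M0 (ltW e'0) (NS n) yE JM' be k1.
rewrite obs1// mul0n obs_timeE mul0r; have [-> _ _ _] := hN.
rewrite [X in _ - (_ - X)]big_geq// subr0 => /le_trans; apply.
have e'1 : e' <= 1 by rewrite ge_min lexx.
have e'e : K * e' <= e by rewrite mulrC -ler_pdivlMr// ge_min lexx orbT.
apply: le_trans e'e.
have -> : K * e' = (N 1)%:R * ((2 * M + 2) * e') + e' by rewrite /K mulrDl mul1r mulrA.
apply: ler_wpDr; first exact: ltW.
rewrite ler_wpM2l//; have : e' ^+ 2 <= e' by rewrite expr2 ler_piMl// ltW.
lra.
Qed.

Lemma powR_range_sum_jump_cvg (e : R) : 0 < e -> exists n0, forall n, (n0 <= n)%N ->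
  `|\sum_(i < n - 2) tri (a n) i - \sum_(i < n - 2) tri (b n) i| <= e.
Proof.
move=> e0; pose K := 3 * (N 1)%:R * (M + 1) `^ (2 / 3) + 1 : R.
have K0 : 0 < K by rewrite ltr_wpDl// mulr_ge0// powR_ge0.
pose h := Num.min 1 (e / K); have h0 : 0 < h by rewrite lt_min ltr01 divr_gt0.
have h1 : h <= 1 by rewrite ge_min lexx.
(* A cube, so that its power 2/3 is the square of [h]; the square of that is at most [h] because
   [h <= 1]. *)
pose e' := h ^+ 3; have e'0 : 0 < e' by rewrite exprn_gt0.
have [n0 hn0] := fine_grid e'0; exists n0 => n /hn0[np be _ k3].
have yE q : y (obs_time n q) = y0 + c (obs_time n q) +
    \sum_(1 <= r < (N (obs_time n q)).+1) J r by apply: hy; exact: obs_time_ge0.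
have JM' r : (1 <= r <= N (obs_time n (n * m)))%N -> `|J r| <= M by rewrite obs1//; exact: JM.
have := powR_range_sum_jump m0 M0 (ltW e'0) (NS n) yE JM' be k3.
rewrite obs1// => /le_trans; apply.
have -> : e' `^ (2 / 3) = h ^+ 2.
  apply/eqP; rewrite -(eqrXn2 (n := 3)) ?powR_ge0 ?exprn_ge0 ?(ltW h0)//.
  by rewrite powR_third_cube ?(ltW e'0)// /e' -!exprM.
have he : K * h <= e by rewrite mulrC -ler_pdivlMr// ge_min lexx orbT.
apply: le_trans he.
have -> : K * h = 3 * (N 1)%:R * (M + 1) `^ (2 / 3) * h + h by rewrite /K mulrDl mul1r.
rewrite mulrA; apply: ler_wpDr; first exact: ltW.
have e'1 : e' <= 1 by rewrite exprn_ile1// ltW.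
apply: ler_pM; rewrite ?mulr_ge0 ?powR_ge0 ?exprn_ge0 ?(ltW h0)//.
  rewrite ler_wpM2l// ge0_ler_powR ?nnegrE ?divr_ge0 ?addr_ge0 ?(ltW e'0)//.
  by rewrite lerD2l.
rewrite -exprM (_ : (2 * 2)%N = 4%N)// exprS ler_piMr ?(ltW h0)// exprn_ile1// ltW.
Qed.

End jumping_path.

(** * The jump diffusion *)

Section random_sums.
Context d (T : measurableType d) (R : realType).

(** The preimage is split according to the countably many values of [k]. *)
Lemma measurable_random_sum (k : T -> nat) (Z : nat -> T -> R) :
  (forall l, measurable [set w | k w = l]) -> (forall l, measurable_fun [set: T] (Z l)) ->
  measurable_fun [set: T] (fun w => Z (k w) w).
Proof.
move=> mk mZ _ B mB; rewrite setTI.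
rewrite (_ : _ @^-1` B = \bigcup_l ([set w | k w = l] `&` (Z l @^-1` B))).
  by apply: bigcup_measurable => l _; apply: measurableI => //; rewrite -[X in measurable X]setTI; exact: mZ.
apply/seteqP; split => w /= => [h|[l _ [<-]]//].
by exists (k w).
Qed.

Lemma measurable_win_range (m : nat) (y : nat -> T -> R) i :
  (forall q, measurable_fun [set: T] (y q)) ->
  measurable_fun [set: T] (fun w => win_range m (fun q => y q w) i).
Proof. by move=> my; apply: measurable_grid_range => t _; exact: my. Qed.

End random_sums.

Section jump_diffusion.
Context (R : realType) d (T : measurableType d) (P : probability T R) (F : R -> set (set T))
  (p b sigma W I : R -> T -> R) (N : R -> T -> nat) (J : nat -> {RV P >-> R}) (m : nat).
Hypotheses (hF : filtration F) (hW : brownian_motion P F W) (hp : adapted F p)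
  (hb : predictable F b) (hlb : locally_bounded P F b)
  (hsigmac : {ae P, forall w, cadlag (sigma ^~ w)})
  (hI : ito_integral P F W sigma I)
  (hNm : forall (t : R) k, 0 <= t -> measurable [set w | N t w = k])
  (hN : {ae P, forall w, simple_counting_path (N ^~ w)})
  (hpE : {ae P, forall w, forall t : R, 0 <= t ->
     p t w = p 0 w + (\int[lebesgue_measure]_(u in `[0, t]) b u w)
             + I t w + \sum_(1 <= i < (N t w).+1) J i w})
  (m0 : (0 < m)%N).
Local Notation mu := (@lebesgue_measure R).
Local Notation obs_time := (@obs_time R m).
Local Notation l2 := (lambda P W 2 m).
Local Notation l3 := (lambda P W (2 / 3) m).
Local Notation obs_triple q n i w := (obs_range m q n i w `^ (2 / 3) *
  obs_range m q n i.+1 w `^ (2 / 3) * obs_range m q n i.+2 w `^ (2 / 3)).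

(** Defined by subtraction, not as drift plus integral: its measurability in [w] then comes directly
    from that of [p], [N] and [J], whereas [I] is not assumed measurable. The two expressions agree
    almost surely. *)
Definition continuous_part t w : R := p t w - p 0 w - \sum_(1 <= i < (N t w).+1) J i w.

Local Notation c := continuous_part.

Let hsm : {ae P, forall w, measurable_fun `[0 : R, 1] (sigma ^~ w)}.
Proof. by apply: filterS hsigmac => w [h _]; exact: right_continuous_measurable. Qed.

Let Dr t w : R := \int[mu]_(u in `[0, t]) b u w.

Let hc : {ae P, forall w, forall t : R, 0 <= t -> c t w = Dr t w + I t w}.
Proof. by apply: filterS hpE => w h t t0; rewrite /c h// /Dr; lra. Qed.

Let mp t : 0 <= t -> measurable_fun [set: T] (p t).
Proof. by move=> t0; apply: measurable_wrt_fun (filtration_sub hF t0) _; exact: hp. Qed.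

Lemma measurable_continuous_part t : 0 <= t -> measurable_fun [set: T] (c t).
Proof.
move=> t0; apply: measurable_funB; first by apply: measurable_funB; exact: mp.
apply: (measurable_random_sum (Z := fun l w => \sum_(1 <= i < l.+1) J i w)).
  by move=> l; exact: hNm.
by move=> l; apply: measurable_sum => i; exact: measurable_funPT.
Qed.

Lemma continuous_part_modulus : {ae P, forall w (e : R), 0 < e ->
  exists2 rho : R, 0 < rho & forall s u : R, 0 <= s -> s <= u -> u <= 1 -> u - s <= rho ->
    `|c u w - c s w| <= e}.
Proof.
have [hIc _] := hI; have hbp := locally_bounded_path hlb.
apply: filterS3 hIc hbp hc => w Ic [C hC] hcw e e0.
have e20 : 0 < e / 2 by rewrite divr_gt0.
have [r r0 hr] := continuous_modulus Ic e20.
have C0 : 0 <= C by apply: le_trans (hC 0 _); rewrite ?lexx ?ler01.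
have C1 : 0 < C + 1 by rewrite ltr_wpDl.
exists (Num.min r (e / 2 / (C + 1))); first by rewrite lt_min r0 divr_gt0.
move=> s u s0 su u1; rewrite le_min => /andP[ur uC].
have u0 := le_trans s0 su; rewrite !hcw//.
have h1 := hr s u s0 su u1 ur.
have h2 := drift_increment_le (predictable_section hb w) hC s0 su u1.
have h3 : C * (u - s) <= e / 2.
  rewrite ler_pdivlMr// mulrC in uC; apply: le_trans uC.
  by rewrite ler_wpM2r ?subr_ge0// lerDl.
rewrite -/(Dr u w) -/(Dr s w) in h2.
move: (Dr u w) (Dr s w) (I u w) (I s w) h1 h2 => x1 x2 x3 x4 h1 h2.
have := ler_normD (x1 - x2) (x3 - x4).
by rewrite (_ : x1 + x3 - (x2 + x4) = x1 - x2 + (x3 - x4)); [lra|ring].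
Qed.

Let pE t w : 0 <= t -> p t w = p 0 w + c t w + \sum_(1 <= r < (N t w).+1) J r w.
Proof. by move=> t0; rewrite /c; lra. Qed.

Lemma measurable_obs_range (q : R -> T -> R) n i : (forall t, 0 <= t -> measurable_fun [set: T] (q t)) ->
  measurable_fun [set: T] (fun w => obs_range m q n i w).
Proof.
move=> mq; apply: (@measurable_win_range _ T R m (fun j => q (obs_time n j)) i) => j.
exact: mq (obs_time_ge0 _ _ _ _).
Qed.

(** Almost every path satisfies the deterministic statement; measurability of the terms turns this
    into convergence in probability. *)
Lemma cvg_sqr_range_jump : prob0 P (fun n w =>
  `|\sum_(i < n) obs_range m p n i w ^+ 2 - \sum_(i < n) obs_range m c n i w ^+ 2
    - \sum_(1 <= r < (N 1 w).+1) J r w ^+ 2|).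
Proof.
apply: ae_prob0.
  move=> n; apply: measurable_fun_abs; apply: measurable_funB.
    apply: measurable_funB; apply: measurable_sum => i; apply: measurable_funX;
      apply: measurable_obs_range; [exact: mp|exact: measurable_continuous_part].
  apply: (measurable_random_sum (Z := fun l w => \sum_(1 <= r < l.+1) J r w ^+ 2)).
    by move=> l; apply: hNm.
  by move=> l; apply: measurable_sum => i; apply: measurable_funX; exact: measurable_funPT.
apply: filterS2 hN continuous_part_modulus => w hNw hcw e e0.
by have := sqr_range_sum_jump_cvg m0 hNw hcw (fun t => pE w) e0.
Qed.

Lemma cvg_powR_range_jump : prob0 P (fun n w =>
  `|\sum_(i < n - 2) obs_triple p n i w - \sum_(i < n - 2) obs_triple c n i w|).
Proof.
have mpw (q : R -> T -> R) n i : (forall t, 0 <= t -> measurable_fun [set: T] (q t)) ->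
    measurable_fun [set: T] (fun w => obs_range m q n i w `^ (2 / 3)).
  move=> mq; apply: (measurableT_comp (f := fun x : R => x `^ (2 / 3))).
    exact: measurable_powR.
  exact: measurable_obs_range.
apply: ae_prob0.
  move=> n; apply: measurable_fun_abs; apply: measurable_funB;
    apply: measurable_sum => i; do 2?apply: measurable_funM; apply: mpw;
    solve [exact: mp|exact: measurable_continuous_part].
apply: filterS2 hN continuous_part_modulus => w hNw hcw e e0.
by have := powR_range_sum_jump_cvg m0 hNw hcw (fun t => pE w) e0.
Qed.

Lemma observed_rangeE n i w : (0 < n)%N -> observed_range p n m i.+1 w = obs_range m p n i w.
Proof.
move=> n0; congr grid_range; apply/funext => t; congr (p _ w).
rewrite obs_timeE -natr1 addrK natrD [RHS]mulrDl; congr (_ + _).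
by rewrite !natrM; field; rewrite !pnatr_eq0 -!lt0n n0 m0.
Qed.

(** The factor [l2] cancels the normalisation of the range variance, and the windows are renumbered
    from 0. *)
Lemma RRVE n w : (0 < n)%N -> RRV P W p n m w =
  \sum_(i < n) obs_range m p n i w ^+ 2 +
  (1 - l2) * (n%:R / (n%:R - 2) * (\sum_(i < n - 2) obs_triple p n i w / l3 ^+ 3)).
Proof.
move=> n0; rewrite /RRV /RRVb mulVKf ?gt_eqF ?(lambda2_gt0 hF hW m0)//.
rewrite big_add1/= big_mkord; congr (_ + _ * (_ * _)).
  by apply: eq_bigr => i _; rewrite observed_rangeE.
rewrite big_add1/= big_mkord; apply: eq_bigr => i _.
rewrite big_ltn// big_ltn// big_nat1 addn1 addn2 addn3 !subSS !subn0 !observed_rangeE//.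
have l30 : l3 != 0 by rewrite gt_eqF// (lambda23_gt0 hF hW m0).
by move: (obs_range m p n i w `^ _) (obs_range m p n i.+1 w `^ _)
  (obs_range m p n i.+2 w `^ _) => x1 x2 x3; field.
Qed.

Lemma cvg_RRV : prob0 P (fun n w => `|RRV P W p n m w -
  (int_vol sigma w + \sum_(1 <= i < (N 1 w).+1) J i w ^+ 2)|).
Proof.
have [_ [S [hS /(_ 1 ltr01)[hs _]]]] := hI.
have hDr := drift_quadratic_variation hF hb hlb m0.
have l20 := lambda2_gt0 hF hW m0; have l30 := lambda23_gt0 hF hW m0.
have l330 : 0 < l3 ^+ 3 by rewrite exprn_gt0.
have E1 := cvg_sqr_range_sum hF hW m0 hsm hI hc hDr hS hs.
have E2 := cvg_powR_range_sum hF hW m0 hsm hI hc hDr hS hs.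
have J1 := cvg_sqr_range_jump; have J2 := cvg_powR_range_jump.
have tg := tight_int_vol hsm hS hs.
(* A bound for the distance of n / (n - 2) to 1: [harmonic n] is 1 / (n + 1), and 2 / (n - 2) <= 4 /
   (n + 1) exactly when n >= 5, for n > 2. *)
pose x n : R := 4 * harmonic n.
have x0 : x @ \oo --> 0.
  rewrite -[X in _ --> X](mulr0 (4 : R)); apply: cvgM; [exact: cvg_cst|exact: cvg_harmonic].
have E3 := prob0_tight x0 (fun n => _) tg.
pose X n w := (`|\sum_(i < n) obs_range m p n i w ^+ 2 - \sum_(i < n) obs_range m c n i w ^+ 2
    - \sum_(1 <= r < (N 1 w).+1) J r w ^+ 2| +
  `|\sum_(i < n) obs_range m c n i w ^+ 2 - l2 * int_vol sigma w|) +
  `|1 - l2| * (2 / l3 ^+ 3 * (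
    `|\sum_(i < n - 2) obs_triple p n i w - \sum_(i < n - 2) obs_triple c n i w| +
    `|\sum_(i < n - 2) obs_triple c n i w - l3 ^+ 3 * int_vol sigma w|) + x n * int_vol sigma w).
have hX : prob0 P X.
  apply: prob0D; first exact: prob0D.
  apply: prob0Z => //; apply: prob0D.
    apply: prob0Z; first by rewrite divr_ge0// ltW.
    exact: prob0D.
  by apply: E3 => n; rewrite /x mulr_ge0// /harmonic/= invr_ge0.
apply: (prob0_le (n0 := 5%N) hsm hX) => n w _ n5.
have n0 : (0 < n)%N by exact: leq_trans n5.
rewrite RRVE// /X -mulr_suml.
have s0 := int_vol_ge0 sigma w; move: (int_vol sigma w) s0 => s s0.
move: (\sum_(1 <= r < _) _) => JJ.
move: (\sum_(i < n) obs_range m p n i w ^+ 2) (\sum_(i < n) obs_range m c n i w ^+ 2) => A B.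
move: (\sum_(i < n - 2) obs_triple p n i w) (\sum_(i < n - 2) obs_triple c n i w) => Tp Tc.
have n5' : 5 <= n%:R :> R by rewrite ler_nat.
have n20 : 0 < n%:R - 2 :> R by lra.
have r2 : n%:R / (n%:R - 2) <= 2 :> R by rewrite ler_pdivrMr//; lra.
have r0 : 0 <= n%:R / (n%:R - 2) :> R by rewrite divr_ge0// ltW.
have rx : `|n%:R / (n%:R - 2) - 1| <= x n.
  have -> : n%:R / (n%:R - 2) - 1 = 2 / (n%:R - 2) :> R by field; rewrite gt_eqF.
  rewrite ger0_norm ?divr_ge0 ?(ltW n20)// /x /harmonic/= -natr1.
  by rewrite ler_pdivrMr// mulrAC ler_pdivlMr; lra.
move: (n%:R / _) (x n) r2 r0 rx => r xn r2 r0 rx.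
have h1 : `|A - (l2 * s + JJ)| <= `|A - B - JJ| + `|B - l2 * s|.
  by rewrite (_ : A - (l2 * s + JJ) = (A - B - JJ) + (B - l2 * s)); [exact: ler_normD|ring].
have h2 : `|r * (Tp / l3 ^+ 3) - s| <= 2 / l3 ^+ 3 * (`|Tp - Tc| + `|Tc - l3 ^+ 3 * s|) + xn * s.
  have -> : r * (Tp / l3 ^+ 3) - s = r * ((Tp - l3 ^+ 3 * s) / l3 ^+ 3) + (r - 1) * s.
    by field; rewrite gt_eqF.
  apply: le_trans (ler_normD _ _) _; apply: lerD; last first.
    by rewrite normrM (ger0_norm s0) ler_wpM2r.
  rewrite !normrM (ger0_norm r0) (gtr0_norm (_ : 0 < (l3 ^+ 3)^-1)) ?invr_gt0//.
  rewrite -mulrA; apply: ler_pM => //; first by rewrite mulr_ge0// invr_ge0 ltW.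
  rewrite mulrC ler_wpM2l ?invr_ge0 ?(ltW l330)//.
  exact: ler_distD.
(* The weights [l2] and [1 - l2] of the integrated variance add up to one, and the squared jumps
   come from the first sum only. *)
have -> : A + (1 - l2) * (r * (Tp / l3 ^+ 3)) - (s + JJ) =
    (A - (l2 * s + JJ)) + (1 - l2) * (r * (Tp / l3 ^+ 3) - s) by ring.
apply: le_trans (ler_normD _ _) _; apply: lerD => //.
by rewrite normrM ler_wpM2l.
Qed.

End jump_diffusion.

Unset Implicit Arguments.

Theorem mainTheorem3 (R : realType) (d : measure_display)
    (T : measurableType d) (P : probability T R) (F : R -> set (set T))
    (p mu sigma W I : R -> T -> R) (N : R -> T -> nat) (J : nat -> {RV P >-> R})
    (m : nat)
    (hF : filtration F)
    (hW : brownian_motion P F W)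
    (hp : adapted F p)
    (hmu : predictable F mu) (hmub : locally_bounded P F mu)
    (hsigma : adapted F sigma) (hsigmac : {ae P, forall w, cadlag (sigma ^~ w)})
    (hI : ito_integral P F W sigma I)
    (hNm : forall (t : R) k, 0 <= t -> measurable [set w | N t w = k])
    (hN : {ae P, forall w, simple_counting_path (N ^~ w)})
    (hJ : {ae P, forall w, forall i, (1 <= i)%N -> J i w <> 0})
    (hpE : {ae P, forall w, forall t : R, 0 <= t ->
       p t w = p 0 w + (\int[lebesgue_measure]_(u in `[0, t]) mu u w)
               + I t w + \sum_(1 <= i < (N t w).+1) J i w})
    (hm : (0 < m)%N) :
  cvg_in_probability P (fun n => RRV P W p n m)
    (fun w => (\int[lebesgue_measure]_(u in `[0, 1]) (sigma u w ^+ 2))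
              + \sum_(1 <= i < (N 1 w).+1) (J i w) ^+ 2).
Proof.
exact: prob0_cvg0 (cvg_RRV hF hW hp hmu hmub hsigmac hI hNm hN hpE hm).
Qed.
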